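(* The guaranteed estimate of $l(\mathbf j,\varphi)$ has the form $$\widehat{\widehat{l(\mathbf j,\varphi)}}=l(\hat{\mathbf j},\hat\varphi),$$ where the pair $(\hat{\mathbf j},\hat\varphi)\in H(\mathrm{div};D)\times L^2(D)$ is (together with $\hat{\mathbf p}_1\in H(\mathrm{div};D)$, $\hat p_2\in L^2(D)$) the solution of the problem $$a^*(\hat{\mathbf p}_1,\mathbf q_1)+b(\mathbf q_1,\hat p_2)=\int_D(C_1^tJ_{H_1}\tilde Q_1(y_1-C_1\hat{\mathbf j}),\mathbf q_1)_{\mathbb R^n}dx\quad\forall\mathbf q_1\in H(\mathrm{div};D),$$ $$b(\hat{\mathbf p}_1,v_1)-m(\hat p_2,v_1)=\int_DC_2^tJ_{H_2}\tilde Q_2(y_2-C_2\hat\varphi)\,v_1\,dx\quad\forall v_1\in L^2(D),$$ $$a(\hat{\mathbf j},\mathbf q_2)+b(\mathbf q_2,\hat\varphi)=0\quad\forall\mathbf q_2\in H(\mathrm{div};D),$$ $$b(\hat{\mathbf j},v_2)-m(\hat\varphi,v_2)=\int_Dv_2\,(Q^{-1}\hat p_2-f_0)\,dx\quad\forall v_2\in L^2(D),$$ these equalities being fulfilled with probability $1$. This problem is uniquely solvable. The random fields $\hat{\mathbf j},\hat{\mathbf p}_1$ and $\hat\varphi,\hat p_2$, whose realizations satisfy this problem, belong to $L^2(\Omega,H(\mathrm{div};D))$ and $L^2(\Omega,L^2(D))$, respectively.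
   Context: All Hilbert spaces are real. $D\subset\mathbb R^n$ is a bounded domain with Lipschitz boundary $\Gamma$, and $H(\mathrm{div};D)=\{\mathbf q\in L^2(D)^n:\ \mathrm{div}\,\mathbf q\in L^2(D)\}$. $\mathbf A(x)=(a_{ij}(x))$ is an $n\times n$ matrix (not assumed symmetric) with $a_{ij}\in L^\infty(D)$ and, for some $\mu>0$, $\mu\sum_i\xi_i^2\le\sum_{i,j}a_{ij}(x)\xi_i\xi_j$ for all $x\in D$, $\xi\in\mathbb R^n$. The coefficient $c(x)$ is piecewise continuous with $0\le c_0\le c(x)\le c_1$, $c_0,c_1$ constants. Put $$a(\mathbf q_1,\mathbf q_2)=\int_D(\mathbf A^{-1}\mathbf q_1,\mathbf q_2)_{\mathbb R^n}dx,\quad a^*(\mathbf q_1,\mathbf q_2)=a(\mathbf q_2,\mathbf q_1)=\int_D((\mathbf A^{-1})^T\mathbf q_1,\mathbf q_2)_{\mathbb R^n}dx,$$ $$b(\mathbf q,v)=-\int_Dv\,\mathrm{div}\,\mathbf q\,dx,\quad m(v_1,v_2)=\int_Dc(x)v_1v_2\,dx.$$ State. For $f\in L^2(D)$ the state $(\mathbf j,\varphi)\in H(\mathrm{div};D)\times L^2(D)$ is the unique solution of $a(\mathbf j,\mathbf q)+b(\mathbf q,\varphi)=0$ for all $\mathbf q\in H(\mathrm{div};D)$ and $b(\mathbf j,v)-m(\varphi,v)=-\int_Dfv\,dx$ for all $v\in L^2(D)$ (the mixed formulation of $-\mathrm{div}(\mathbf A\,\mathbf{grad}\,\varphi)+c\varphi=f$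 in $D$, $\varphi=0$ on $\Gamma$, $\mathbf j=-\mathbf A\,\mathbf{grad}\,\varphi$). Uncertainty sets. $f$ is unknown and belongs to $G_0=\{\tilde f\in L^2(D):(Q(\tilde f-f_0),\tilde f-f_0)_{L^2(D)}\le1\}$, where $f_0\in L^2(D)$ is given and $Q$ is a bounded positive selfadjoint operator in $L^2(D)$ with bounded inverse. $H_1,H_2$ are separable Hilbert spaces, $H=H_1\times H_2$. $(\Omega,\mathcal B,P)$ is a probability space carrying two uncorrelated real random variables of mean $0$ and variance $1$; $\mathbb E$ is expectation, and $L^2(\Omega,X)$ is the Bochner space of square-integrable $X$-valued random variables. $G_1$ is the set of pairs $(\tilde\eta_1,\tilde\eta_2)$, $\tilde\eta_i\in L^2(\Omega,H_i)$, $\mathbb E\tilde\eta_i=0$, that are uncorrelated, i.e. $\mathbb E[(\tilde\eta_1,u_1)_{H_1}(\tilde\eta_2,u_2)_{H_2}]=0$ for all $u_1\in H_1,u_2\in H_2$, and satisfy $\mathbb E(\tilde Q_i\tilde\eta_i,\tilde\eta_i)_{H_i}\le1$, $i=1,2$; here $\tilde Q_i$ are bounded positive definite selfadjoint operators in $H_i$ with bounded inverses. Observations. $y_1=C_1\mathbf j+\eta_1$, $y_2=C_2\varphi+\eta_2$, with bounded linear $C_1:L^2(D)^n\to H_1$, $C_2:L^2(D)\to H_2$, and $(\eta_1,\eta_2)\in G_1$. $J_{H_i}:H_i\to H_i'$ is the Riesz operator, $(v,u)_{H_i}=\langle v,J_{H_i}u\rangle$; $C_1^t:H_1'\to L^2(D)^n$,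 $C_2^t:H_2'\to L^2(D)$ are the transposes, $\int_D(v,C_1^tw)_{\mathbb R^n}dx=\langle C_1v,w\rangle$, $\int_Dv\,C_2^tw\,dx=\langle C_2v,w\rangle$. Guaranteed estimate. For given $\mathbf l_1\in L^2(D)^n$, $l_2\in L^2(D)$ let $l(\mathbf j,\varphi)=\int_D(\mathbf l_1,\mathbf j)_{\mathbb R^n}dx+\int_Dl_2\varphi\,dx$. For $u=(u_1,u_2)\in H$, $\kappa\in\mathbb R$ set $$\sigma(u,\kappa)=\sup_{\tilde f\in G_0,(\tilde\eta_1,\tilde\eta_2)\in G_1}\mathbb E\left|l(\tilde{\mathbf j},\tilde\varphi)-(\tilde y_1,u_1)_{H_1}-(\tilde y_2,u_2)_{H_2}-\kappa\right|^2,$$ where $(\tilde{\mathbf j},\tilde\varphi)$ is the state for $f=\tilde f$ and $\tilde y_1=C_1\tilde{\mathbf j}+\tilde\eta_1$, $\tilde y_2=C_2\tilde\varphi+\tilde\eta_2$. There is a unique $(\hat u,\hat c)\in H\times\mathbb R$ with $\sigma(\hat u,\hat c)=\inf_{u\in H,\kappa\in\mathbb R}\sigma(u,\kappa)$; the guaranteed (minimax) estimate is $\widehat{\widehat{l(\mathbf j,\varphi)}}=(y_1,\hat u_1)_{H_1}+(y_2,\hat u_2)_{H_2}+\hat c$. *)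

(* Defs.v *)
From HB Require Import structures.
From mathcomp Require Import all_boot all_order all_algebra.
From mathcomp Require Import all_classical all_reals all_analysis.
Set Implicit Arguments.
Unset Strict Implicit.
Unset Printing Implicit Defensive.
Import Order.TTheory GRing.Theory Num.Theory.
Import numFieldNormedType.Exports.
Local Open Scope classical_set_scope.
Local Open Scope ring_scope.

Definition rV_display : measure_display.
Proof. exact: default_measure_display. Qed.

Section measurable_rV.
Variables (R : realType) (n : nat).

(* The sigma-algebra generated by the coordinates; by [open_measurable_rV]
   below it contains the open sets, hence it is the Borel sigma-algebra. *)
Let coord (i : 'I_n) (x : 'rV[R]_n) : R := x 0 i.

Let rV_set0 : g_sigma_preimage coord set0.
Proof. exact: sigma_algebra0. Qed.

Let rV_setC A : g_sigma_preimage coord A -> g_sigma_preimage coord (~` A).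
Proof. exact: sigma_algebraC. Qed.

Let rV_bigcup (F : (set 'rV[R]_n)^nat) :
  (forall i, g_sigma_preimage coord (F i)) ->
  g_sigma_preimage coord (\bigcup_i (F i)).
Proof. exact: sigma_algebra_bigcup. Qed.

HB.instance Definition _ := @isMeasurable.Build rV_display
  'rV[R]_n (g_sigma_preimage coord) rV_set0 rV_setC rV_bigcup.

Lemma measurable_coord (i : 'I_n) :
  measurable_fun [set: 'rV[R]_n] (fun x : 'rV[R]_n => x 0 i).
Proof.
move=> _ Y mY; rewrite setTI; apply: sub_sigma_algebra => /=.
rewrite -bigcup_seq/=; exists i => /=; first by rewrite mem_index_enum.
by exists Y => //; rewrite setTI.
Qed.

Lemma measurable_rVP d (T : measurableType d) (f : T -> 'rV[R]_n) :
  measurable_fun setT f <->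
  forall i, measurable_fun [set: T] (fun x => f x 0 i).
Proof.
split=> [mf i|mf].
  exact: (measurableT_comp (measurable_coord i) mf).
have : <<s preimage_set_system setT f
    (\big[setU/set0]_(i < n) preimage_set_system setT (coord i) measurable)
    >> `<=` measurable.
  apply: smallest_sub; first exact: sigma_algebra_measurable.
  move=> _ [B + <-]; rewrite -bigcup_seq/= => -[i _ [A mA <-]].
  by rewrite !setTI -[X in measurable X]setTI; exact: (mf i).
rewrite g_sigma_preimageE => H _ A mA.
by apply: H; exists A.
Qed.

Let box (q : 'rV[rat]_n) (k : nat) : set 'rV[R]_n :=
  [set x | forall i, `|x 0 i - ratr (q 0 i)| < k.+1%:R^-1].

Let measurable_box (q : 'rV[rat]_n) k : measurable (box q k).
Proof.
have -> : box q k = \bigcap_(i in [set: 'I_n])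
    ((fun x : 'rV[R]_n => x 0 i) @^-1`
      `]ratr (q 0 i) - k.+1%:R^-1, ratr (q 0 i) + k.+1%:R^-1[%classic).
  apply/seteqP; split => [x xq i _|x xq i].
    by rewrite /= in_itv/= -ltr_distl; exact: xq.
  by have := xq i I; rewrite /= in_itv/= -ltr_distl.
apply: fin_bigcap_measurable => [|i _]; first exact: finite_finset.
by rewrite -[X in measurable X]setTI; exact: measurable_coord.
Qed.

Lemma open_measurable_rV (O : set 'rV[R]_n) : open O -> measurable O.
Proof.
move=> oO.
pose F (qk : 'rV[rat]_n * nat) :=
  if `[< box qk.1 qk.2 `<=` O >] then box qk.1 qk.2 else set0.
have -> : O = \bigcup_qk F qk.
  apply/seteqP; split => [x Ox|x [qk _]]; last first.
    by rewrite /F; case: asboolP => // /[apply].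
  have /nbhs_ballP[e /= e0 xeO] : nbhs x O by apply: open_nbhs_nbhs.
  have [k ke] : exists k : nat, k.+1%:R^-1 < e / 2.
    have e20 : 0 < e / 2 by rewrite divr_gt0.
    near \oo => k; exists k; near: k.
    exact: (near_infty_natSinv_lt (PosNum e20)).
  have k0 : 0 < k.+1%:R^-1 :> R by rewrite invr_gt0.
  have /choice[f fP] : forall i : 'I_n, exists r : rat,
      `|x 0 i - ratr r| < k.+1%:R^-1.
    move=> i; have /rat_in_itvoo[r] : x 0 i < x 0 i + k.+1%:R^-1.
      by rewrite ltrDl.
    rewrite in_itv/= => /andP[r1 r2]; exists r.
    by rewrite distrC ltr_distl r2 andbT; apply: lt_trans r1; rewrite gtrBl.
  exists (\row_i f i, k) => //; rewrite /F /=.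
  case: asboolP => [_ i /=|[]]; first by rewrite mxE.
  move=> y /= yq; apply: xeO; split => // i j.
  rewrite (ord1 i) /ball /= [ltRHS](splitr e).
  apply: le_lt_trans (ler_distD (ratr (f j)) _ _) _.
  apply: ltrD; first exact: lt_trans (fP j) ke.
  by rewrite distrC; apply: lt_trans ke; have := yq j; rewrite mxE.
apply: countable_bigcupT_measurable => // qk.
by rewrite /F; case: ifP.
Unshelve. all: by end_near. Qed.

End measurable_rV.

Section lebesgue_rV.
Variable R : realType.

Definition rV_cons n (xy : R * 'rV[R]_n) : 'rV[R]_n.+1 :=
  \row_i (if unlift ord0 i is Some j then xy.2 0 j else xy.1).

Lemma rV_cons0 n (xy : R * 'rV[R]_n) : rV_cons xy 0 0 = xy.1.
Proof. by rewrite mxE unlift_none. Qed.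

Lemma rV_consS n (xy : R * 'rV[R]_n) j : rV_cons xy 0 (lift ord0 j) = xy.2 0 j.
Proof. by rewrite mxE liftK. Qed.

Lemma measurable_rV_cons n : measurable_fun setT (@rV_cons n).
Proof.
apply/measurable_rVP => i; case: (unliftP ord0 i) => [j|] ->.
  under eq_fun do rewrite rV_consS.
  exact: (measurableT_comp (measurable_coord j) measurable_snd).
by under eq_fun do rewrite rV_cons0; exact: measurable_fst.
Qed.

Section cons_measure.
Variables (n : nat) (mu : {sigma_finite_measure set 'rV[R]_n -> \bar R}).

Definition cons_measure : set 'rV[R]_n.+1 -> \bar R :=
  pushforward (@lebesgue_measure R \x mu)%E (@rV_cons n).

Let measurable_preimage A : measurable A -> measurable (@rV_cons n @^-1` A).
Proof.
by move=> mA; rewrite -[X in measurable X]setTI; exact: measurable_rV_cons.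
Qed.

Let cons_measure0 : cons_measure set0 = 0%E.
Proof. by rewrite /cons_measure /pushforward preimage_set0 measure0. Qed.

Let cons_measure_ge0 A : (0 <= cons_measure A)%E.
Proof. by rewrite /cons_measure /pushforward; exact: measure_ge0. Qed.

Let cons_measure_sigma_additive : semi_sigma_additive cons_measure.
Proof.
move=> F mF tF mUF; rewrite /cons_measure /pushforward preimage_bigcup.
apply: measure_semi_sigma_additive.
- by move=> k; exact: measurable_preimage.
- apply/trivIsetP => /= i j _ _ ij; rewrite -preimage_setI.
  by move/trivIsetP : tF => /(_ _ _ _ _ ij) ->//; rewrite preimage_set0.
- by rewrite -preimage_bigcup; exact: measurable_preimage.
Qed.

HB.instance Definition _ := isMeasure.Build _ _ _ cons_measure
  cons_measure0 cons_measure_ge0 cons_measure_sigma_additive.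

Let rV_uncons (x : 'rV[R]_n.+1) : R * 'rV[R]_n :=
  (x 0 0, \row_j x 0 (lift ord0 j)).

Let measurable_rV_uncons : measurable_fun setT rV_uncons.
Proof.
apply/measurable_fun_pairP; split; first exact: measurable_coord.
apply/measurable_rVP => i /=; rewrite /comp /=.
under eq_fun do rewrite mxE.
exact: measurable_coord.
Qed.

Let cons_measure_sigma_finite : sigma_finite setT cons_measure.
Proof.
have /sigma_finiteP[F [TF ndF Foo]] := sigma_finiteT (@lebesgue_measure R).
have /sigma_finiteP[G [TG ndG Goo]] := sigma_finiteT mu.
exists (fun k => rV_uncons @^-1` (F k `*` G k)).
  rewrite -preimage_bigcup (_ : \bigcup_k (F k `*` G k) = setT) //.
  rewrite -setXTT TF TG; apply/seteqP; split.
    by move=> [x y] [k _ []]; split; exists k.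
  move=> [x y] [[k _ Fkx] [l _ Gly]]; exists (maxn k l) => //; split.
  - by apply: (subsetPset _ _ (ndF _ _ (leq_maxl k l))) Fkx.
  - by apply: (subsetPset _ _ (ndG _ _ (leq_maxr k l))) Gly.
move=> k; have [mF Fkoo] := Foo k; have [mG Gkoo] := Goo k; split.
  rewrite -[X in measurable X]setTI; apply: measurable_rV_uncons => //.
  exact: measurableX.
rewrite /cons_measure /pushforward -comp_preimage.
suff -> : rV_uncons \o @rV_cons n = id.
  by rewrite preimage_id product_measure1E// lte_mul_pinfty// ge0_fin_numE.
apply/funext => -[a x]; rewrite /rV_uncons /= rV_cons0; congr pair.
by apply/rowP => j; rewrite mxE rV_consS.
Qed.

HB.instance Definition _ := Measure_isSigmaFinite.Build _ _ _ cons_measure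
  cons_measure_sigma_finite.

End cons_measure.

(* [R^0] is a point, of mass one. *)
Fixpoint lebesgue_rV n : {sigma_finite_measure set 'rV[R]_n -> \bar R} :=
  if n is k.+1 return {sigma_finite_measure set 'rV[R]_n -> \bar R}
  then cons_measure (lebesgue_rV k) else \d_(0 : 'rV[R]_0).

Lemma lebesgue_rV_box n (a b : 'rV[R]_n) : (forall i, a 0 i <= b 0 i) ->
  lebesgue_rV n [set x | forall i, a 0 i <= x 0 i <= b 0 i] =
  (\prod_(i < n) (b 0 i - a 0 i))%:E.
Proof.
elim: n a b => [|n IHn] a b ab.
  by rewrite big_ord0 /= diracE mem_set// => -[].
pose a' := \row_j a 0 (lift ord0 j); pose b' := \row_j b 0 (lift ord0 j).
rewrite [LHS]/= /cons_measure /pushforward.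
rewrite (_ : _ @^-1` _ = `[a 0 0, b 0 0]%classic `*`
    [set x : 'rV[R]_n | forall i, a' 0 i <= x 0 i <= b' 0 i]); last first.
  apply/seteqP; split => [[t x] /= tx|[t x] /= [t0 x0] i].
    split; first by have := tx 0; rewrite in_itv/= rV_cons0.
    by move=> i; have := tx (lift ord0 i); rewrite rV_consS !mxE.
  case: (unliftP ord0 i) => [j|] ->; last by rewrite rV_cons0; move: t0; rewrite in_itv.
  by have := x0 j; rewrite rV_consS !mxE.
rewrite product_measure1E//=; last first.
  have -> : [set x : 'rV[R]_n | forall i, a' 0 i <= x 0 i <= b' 0 i] =
    \bigcap_(i in [set: 'I_n])
      ((fun x : 'rV[R]_n => x 0 i) @^-1` `[a' 0 i, b' 0 i]%classic).
    apply/seteqP; split => [x ? i _|x xi i] /=; first by rewrite in_itv/=.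
    by have := xi i I; rewrite /= in_itv.
  apply: fin_bigcap_measurable => [|i _]; first exact: finite_finset.
  by rewrite -[X in measurable X]setTI; exact: measurable_coord.
rewrite IHn => [|i]; last by rewrite !mxE.
rewrite lebesgue_measure_itv/= lte_fin big_ord_recl.
rewrite (_ : (if _ then _ else _) = (b 0 0 - a 0 0)%:E); last first.
  case: ltP => // ba; have /eqP-> : b 0 0 == a 0 0 by rewrite eq_le ba ab.
  by rewrite subrr.
rewrite -EFinM; congr ((_ * _)%:E).
by apply: eq_bigr => i _; rewrite !mxE.
Qed.

End lebesgue_rV.

Section domains.
Variables (R : realType) (n : nat).

(* Near each boundary point [D] is, in suitable orthonormal coordinates
   [y = (x - x0) O], the strict epigraph [g (y_1, ..., y_n) < y_0] of a
   Lipschitz function. *)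
Definition lipschitz_boundary (D : set 'rV[R]_n.+1) : Prop :=
  forall x0, (closure D `\` D°) x0 ->
  exists (O : 'M[R]_n.+1) (g : 'rV[R]_n -> R),
    [/\ O *m O^T = 1%:M, lipschitz g &
        \forall x \near x0,
          let y := (x - x0) *m O in D x <-> g (col' ord0 y) < y 0 0].

(* The ambient dimension is [n.+1], so that it is at least one. *)
Record lipschitz_domain := LipschitzDomain {
  dom :> set 'rV[R]_n.+1;
  dom_open : open dom;
  dom_neq0 : dom !=set0;
  dom_connected : connected dom;
  dom_bounded : bounded_set dom;
  dom_lipschitz : lipschitz_boundary dom }.

End domains.

(* [L^2(D)] is handled below through representatives, so that its inner product
   is only positive semidefinite; a space is then a module with a form [ip],
   and its elements are identified by [semi_eq ip].  In a Hilbert space,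
   [semi_eq hdot] is Leibniz equality. *)

Section operators.
Variable R : realType.
Implicit Types V W : lmodType R.

Definition semi_eq V (ip : V -> V -> R) (x y : V) : Prop :=
  ip (x - y) (x - y) = 0.

Definition bounded_linear V W (ipV : V -> V -> R) (ipW : W -> W -> R)
    (T : V -> W) : Prop :=
  (forall a x y, semi_eq ipW (T (a *: x + y)) (a *: T x + T y)) /\
  (exists K : R, forall x, ipW (T x) (T x) <= K * ipV x x).

(* [T] is a bounded positive (definite) selfadjoint operator and [Ti] its bounded
   inverse. *)
Definition positive_selfadjoint V (ip : V -> V -> R) (T Ti : V -> V) : Prop :=
  [/\ bounded_linear ip ip T,
      forall x y, ip (T x) y = ip x (T y),
      forall x, ~ semi_eq ip x 0 -> 0 < ip (T x) x,
      bounded_linear ip ip Ti &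
      forall x, semi_eq ip (T (Ti x)) x /\ semi_eq ip (Ti (T x)) x].

Record hilbert := Hilbert {
  hcarrier :> completeNormedModType R;
  hdot : {dot hcarrier for idfun};
  hnormE : forall x : hcarrier, `|x| ^+ 2 = hdot x x }.
Arguments hdot {h} : rename.

Definition separable (H : hilbert) : Prop :=
  exists2 S : set H, countable S & dense S.

Definition dual (H : hilbert) : set (H -> R) :=
  [set w : H -> R | scalar w /\ continuous w].

Definition riesz (H : hilbert) (u : H) : H -> R := fun v => hdot v u.

(* [Ct] is only constrained on the dual of [H]. *)
Definition transpose V (ip : V -> V -> R) (H : hilbert) (C : V -> H)
    (Ct : (H -> R) -> V) : Prop :=
  forall w, dual w -> forall v, ip v (Ct w) = w (C v).

End operators.

Arguments hdot {R h} : rename.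

Section spaces.
Variables (R : realType) (n : nat) (D : lipschitz_domain R n).
Notation E := 'rV[R]_n.+1.
Notation leb := (lebesgue_rV R n.+1).

(* Elements are representatives: measurable functions on the whole space whose
   square has a finite integral over [D]. *)
Definition L2 :=
  LfunType (mrestr leb (open_measurable_rV (@dom_open _ _ D))) (lee1n 2).

Definition L2n := {ffun 'I_n.+1 -> L2}.

Definition l2_dot (f g : L2) : R := \int[leb]_(x in D) (f x * g x).

Definition l2n_dot (p q : L2n) : R :=
  \int[leb]_(x in D) (\sum_(i < n.+1) p i x * q i x).

Definition partial (i : 'I_n.+1) (f : E -> R) : E -> R :=
  'D_(delta_mx 0 i) f.

Fixpoint Ck (k : nat) (f : E -> R) : Prop :=
  continuous f /\
  if k is k'.+1 then
    forall i, (forall x, derivable f x (delta_mx 0 i)) /\ Ck k' (partial i f)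
  else True.

Definition test_function (f : E -> R) : Prop :=
  [/\ forall k, Ck k f, compact (closure [set x | f x != 0]) &
      closure [set x | f x != 0] `<=` D].

Definition weak_div (q : L2n) (d : L2) : Prop :=
  forall f, test_function f ->
  \int[leb]_(x in D) (\sum_(i < n.+1) q i x * partial i f x) =
  - \int[leb]_(x in D) (d x * f x).

Definition Hdiv : set L2n := [set q | exists d, weak_div q d].

(* Meaningful on [Hdiv], where it is determined up to equality a.e. in [D]. *)
Definition wdiv (q : L2n) : L2 := xget 0 (weak_div q).

Definition hdiv_dot (p q : L2n) : R :=
  l2n_dot p q + l2_dot (wdiv p) (wdiv q).

(* Vanishing measure of [D \ U_1 u ... u U_k] accounts for the interfaces between
   the pieces, where the values of [c] are irrelevant but for measurability. *)
Definition piecewise_continuous (c : E -> R) : Prop :=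
  measurable_fun D c /\
  exists (k : nat) (U : 'I_k -> set E) (g : 'I_k -> E -> R),
    [/\ forall i, open (U i) /\ U i `<=` D,
        trivIset setT U,
        leb.-negligible (D `\` \bigcup_i U i),
        forall i, {within closure (U i), continuous (g i)} &
        forall i x, U i x -> c x = g i x].

Definition coercive_coefficients (A : E -> 'M[R]_n.+1) : Prop :=
  (forall i j, measurable_fun D (fun x => A x i j) /\
     exists M : R, {ae leb, forall x, dom D x -> `|A x i j| <= M}) /\
  exists2 mu : R, 0 < mu &
    forall x, dom D x -> forall xi : 'I_n.+1 -> R,
      mu * (\sum_i xi i ^+ 2) <= \sum_i \sum_j A x i j * xi i * xi j.

Variables (A : E -> 'M[R]_n.+1) (c : E -> R).

Definition form_a (q1 q2 : L2n) : R :=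
  \int[leb]_(x in D)
    (\sum_(i < n.+1) (\sum_(j < n.+1) invmx (A x) i j * q1 j x) * q2 i x).

Definition form_a_adj (q1 q2 : L2n) : R := form_a q2 q1.

Definition form_b (q : L2n) (v : L2) : R :=
  - \int[leb]_(x in D) (v x * wdiv q x).

Definition form_m (v1 v2 : L2) : R :=
  \int[leb]_(x in D) (c x * v1 x * v2 x).

Definition state (f : L2) (j : L2n) (phi : L2) : Prop :=
  [/\ Hdiv j,
      forall q, Hdiv q -> form_a j q + form_b q phi = 0 &
      forall v, form_b j v - form_m phi v = - \int[leb]_(x in D) (f x * v x)].

Definition functional (l1 : L2n) (l2 : L2) (j : L2n) (phi : L2) : R :=
  l2n_dot l1 j + l2_dot l2 phi.

Definition source_set (Q : L2 -> L2) (f0 : L2) : set L2 :=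
  [set f | l2_dot (Q (f - f0)) (f - f0) <= 1].

(* The optimality system for given observations [y1], [y2]; [Qi] is the inverse
   of [Q]. *)
Definition estimation_system (Qi : L2 -> L2) (f0 : L2) (H1 H2 : hilbert R)
    (Q1 : H1 -> H1) (Q2 : H2 -> H2) (C1 : L2n -> H1) (C2 : L2 -> H2)
    (C1t : (H1 -> R) -> L2n) (C2t : (H2 -> R) -> L2) (y1 : H1) (y2 : H2)
    (p1 : L2n) (p2 : L2) (j : L2n) (phi : L2) : Prop :=
  [/\ Hdiv p1 /\ Hdiv j,
      forall q1, Hdiv q1 -> form_a_adj p1 q1 + form_b q1 p2 =
        l2n_dot (C1t (riesz (Q1 (y1 - C1 j)))) q1,
      forall v1, form_b p1 v1 - form_m p2 v1 =
        l2_dot (C2t (riesz (Q2 (y2 - C2 phi)))) v1,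
      forall q2, Hdiv q2 -> form_a j q2 + form_b q2 phi = 0 &
      forall v2, form_b j v2 - form_m phi v2 = l2_dot v2 (Qi p2 - f0)].

End spaces.

Section random.
Variables (R : realType) (d : measure_display) (Omega : measurableType d).
Variable P : probability Omega R.

Definition simple_rv (V : Type) (s : Omega -> V) : Prop :=
  finite_set (range s) /\ forall v, measurable (s @^-1` [set v]).

(* Strongly measurable random elements of the subspace [S], with finite second
   moment, the norm being that of the form [ip]. *)
Definition L2_rv (V : lmodType R) (S : set V) (ip : V -> V -> R)
    (X : Omega -> V) : Prop :=
  [/\ forall w, S (X w),
      exists s : nat -> Omega -> V,
        (forall k, simple_rv (s k) /\ forall w, S (s k w)) /\
        forall w, ip (s k w - X w) (s k w - X w) @[k --> \oo] --> (0 : R) &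
      (\int[P]_w (ip (X w) (X w))%:E < +oo)%E].

Definition simple_mean (H : hilbert R) (s : Omega -> H) : H :=
  \sum_(v \in range s) fine (P (s @^-1` [set v])) *: v.

(* [m] is the Bochner integral of [X]. *)
Definition bochner_mean (H : hilbert R) (X : Omega -> H) (m : H) : Prop :=
  exists s : nat -> Omega -> H,
    [/\ forall k, simple_rv (s k),
        (\int[P]_w (`|X w - s k w|)%:E)%E @[k --> \oo] --> 0%E &
        simple_mean (s k) @[k --> \oo] --> m].

Definition noise_set (H1 H2 : hilbert R) (Q1 : H1 -> H1) (Q2 : H2 -> H2) :
    set ((Omega -> H1) * (Omega -> H2)) :=
  [set e | [/\ L2_rv setT hdot e.1 /\ L2_rv setT hdot e.2,
      bochner_mean e.1 0 /\ bochner_mean e.2 0,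
      forall u1 u2,
        ('E_P[(fun w => hdot (e.1 w) u1 * hdot (e.2 w) u2)%R] = 0)%E,
      ('E_P[(fun w => hdot (Q1 (e.1 w)) (e.1 w))] <= 1)%E &
      ('E_P[(fun w => hdot (Q2 (e.2 w)) (e.2 w))] <= 1)%E]].

Variables (n : nat) (D : lipschitz_domain R n).
Variables (A : 'rV[R]_n.+1 -> 'M[R]_n.+1) (c : 'rV[R]_n.+1 -> R).
Variables (Q : L2 D -> L2 D) (f0 : L2 D) (H1 H2 : hilbert R).
Variables (Q1 : H1 -> H1) (Q2 : H2 -> H2) (C1 : L2n D -> H1) (C2 : L2 D -> H2).
Variables (l1 : L2n D) (l2 : L2 D).

Definition worst_case_error (u1 : H1) (u2 : H2) (k : R) : \bar R :=
  ereal_sup [set s | exists f j phi e1 e2,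
    [/\ source_set Q f0 f, state A c f j phi, noise_set Q1 Q2 (e1, e2) &
        s = ('E_P[(fun w => `|functional l1 l2 j phi
          - hdot (C1 j + e1 w) u1 - hdot (C2 phi + e2 w) u2 - k| ^+ 2)%R])%E]].

Definition optimal (u1 : H1) (u2 : H2) (k : R) : Prop :=
  worst_case_error u1 u2 k =
  ereal_inf [set s | exists v1 v2 k', s = worst_case_error v1 v2 k'].

End random.

(* Main.v *)
(* Eliminating the flux from the mixed system leaves a coercive problem on the
   graph of the weak gradient, so Lax-Milgram gives existence, uniqueness and
   bounds for the state and the adjoint equations; let [S] be the operator
   taking a source to its state.  The noise is centred and uncorrelated, so the
   mean square error splits into a source part and two noise parts, whose
   suprema are explicit: for [kap] the Riesz representative of the source part
   for the form [(Q ., .)], the worst case error is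
     [(|e0 - k| + |kap|_Q)^2 + (Q1^-1 u1, u1) + (Q2^-1 u2, u2)],
   where [e0] is the error at [f0].  Hence [k = e0], and the remaining quadratic
   problem is solved by [u_i = Q_i C_i S kh], with [kh] the Riesz representative
   of [l o S] for the form
     [G(h, k) = (Q h, k) + (Q1 C1 S h, C1 S k) + (Q2 C2 S h, C2 S k)].
   In the estimation system, duality between the state and the adjoint equation
   shows that [h = - Q^-1 p2] represents the data
     [k |-> (Q1 (y1 - C1 S f0), C1 S k) + (Q2 (y2 - C2 S f0), C2 S k)]
   for the same form [G], and that the state is [S (f0 + h)].  So the system is
   uniquely solvable, its solution is Lipschitz in the observations (hence
   square integrable), and symmetry of [G] gives
   [l (S (f0 + h)) = (y1, u1) + (y2, u2) + k]. *)
Require Import Defs.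
From HB Require Import structures.
From mathcomp Require Import all_boot all_order all_algebra.
From mathcomp Require Import all_classical all_reals all_analysis.
From mathcomp Require Import measurable_realfun simple_functions ring lra.
Set Implicit Arguments.
Unset Strict Implicit.
Unset Printing Implicit Defensive.
Import Order.TTheory GRing.Theory Num.Theory.
Import numFieldNormedType.Exports.
Local Open Scope classical_set_scope.
Local Open Scope ring_scope.

(** * Semi-inner products *)

(** Because elements are representatives, the inner products have null vectors, and operators or
    solution maps obtained by choice are linear only up to null vectors. The Riesz and Lax-Milgram
    theorems are therefore proved for positive semidefinite forms, and identities are tested against
    vectors rather than stated between them.

    Coercivity cannot come from [c], which may vanish; it comes from a Poincare inequality. For test
    functions this is an integration along the first coordinate. By Riesz representation it makes
    the divergence surjective onto [L2] with a bound, and by duality that surjectivity gives the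
    inequality on the whole annihilator [grad_graph]. The same surjectivity determines the potential
    in the uniqueness proof. The divergence itself is determined almost everywhere by the
    fundamental lemma, for which smooth bumps are built from exp(-1/t).

    Random solutions are the composition of a deterministic Lipschitz solution map with the
    observations, so simple approximations of the noise are carried to simple approximations of the
    solution. *)

Section semi_inner_product.
Variables (R : realType) (V : lmodType R).

Record semi_inner (ip : V -> V -> R) : Prop := SemiInner {
  ip_linl : forall a x y z, ip (a *: x + y) z = a * ip x z + ip y z;
  ipC : forall x y, ip x y = ip y x;
  ip_ge0 : forall x, 0 <= ip x x }.

Definition submodule (S : set V) : Prop :=
  S 0 /\ forall a x y, S x -> S y -> S (a *: x + y).

Definition ip_cauchy (ip : V -> V -> R) (s : nat -> V) : Prop :=
  forall e, 0 < e -> exists N, forall k l, (N <= k)%N -> (N <= l)%N ->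
    ip (s k - s l) (s k - s l) < e.

Definition ip_cvg (ip : V -> V -> R) (s : nat -> V) (u : V) : Prop :=
  forall e, 0 < e -> exists N, forall k, (N <= k)%N ->
    ip (s k - u) (s k - u) < e.

(** The limit may lie in a larger set [L], so that Riesz representation applies to subspaces that
    are not closed, such as that of the test functions. *)
Definition ip_complete (ip : V -> V -> R) (S L : set V) : Prop :=
  forall s, (forall k, S (s k)) -> ip_cauchy ip s ->
    exists2 u, L u & ip_cvg ip s u.

Section semi_inner_theory.
Variables (ip : V -> V -> R) (hip : semi_inner ip).

Lemma ip0l x : ip 0 x = 0.
Proof.
have := ip_linl hip 1 0 0 x; rewrite scaler0 addr0 mul1r.
by move/eqP; rewrite -subr_eq subrr eq_sym => /eqP.
Qed.

Lemma ipDl x y z : ip (x + y) z = ip x z + ip y z.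
Proof. by have := ip_linl hip 1 x y z; rewrite scale1r mul1r. Qed.

Lemma ipZl a x z : ip (a *: x) z = a * ip x z.
Proof. by have := ip_linl hip a x 0 z; rewrite ip0l !addr0. Qed.

Lemma ipNl x z : ip (- x) z = - ip x z.
Proof. by rewrite -scaleN1r ipZl mulN1r. Qed.

Lemma ipBl x y z : ip (x - y) z = ip x z - ip y z.
Proof. by rewrite ipDl ipNl. Qed.

Lemma ip0r x : ip x 0 = 0.
Proof. by rewrite ipC// ip0l. Qed.

Lemma ipDr x y z : ip z (x + y) = ip z x + ip z y.
Proof. by rewrite ![ip z _]ipC// ipDl. Qed.

Lemma ipZr a x z : ip z (a *: x) = a * ip z x.
Proof. by rewrite ![ip z _]ipC// ipZl. Qed.

Lemma ipNr x z : ip z (- x) = - ip z x.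
Proof. by rewrite ![ip z _]ipC// ipNl. Qed.

Lemma ipBr x y z : ip z (x - y) = ip z x - ip z y.
Proof. by rewrite ![ip z _]ipC// ipBl. Qed.

Definition ipE := (ipDl, ipDr, ipBl, ipBr, ipZl, ipZr, ipNl, ipNr, ip0l, ip0r).

(** The discriminant argument, with the leading coefficient allowed to vanish because the forms are
    only semidefinite; in that case an affine function bounded below must be constant. *)
Lemma quadratic_ge0 (a b c : R) : 0 <= c ->
  (forall t, 0 <= a + 2 * t * b + t ^+ 2 * c) -> b ^+ 2 <= a * c.
Proof.
rewrite le_eqVlt => /predU1P[<-|c0] H.
  rewrite mulr0; have [->|b0] := eqVneq b 0; first by rewrite expr0n.
  have := H (- (a + 1) / (2 * b)); rewrite mulr0 addr0.
  have -> : a + 2 * (- (a + 1) / (2 * b)) * b = -1 by field.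
  by rewrite lerNr oppr0 ler10.
have := H (- b / c); have -> : a + 2 * (- b / c) * b + (- b / c) ^+ 2 * c =
  (a * c - b ^+ 2) / c by field; rewrite gt_eqF.
by rewrite pmulr_lge0 ?invr_gt0// subr_ge0.
Qed.

Lemma ip_CS x y : ip x y ^+ 2 <= ip x x * ip y y.
Proof.
apply: quadratic_ge0 => [|t]; first exact: ip_ge0.
have := ip_ge0 hip (x + t *: y); rewrite !ipE (ipC hip y x).
by congr (_ <= _); ring.
Qed.

Lemma ip_null x y : ip x x = 0 -> ip x y = 0.
Proof.
move=> x0; have := ip_CS x y; rewrite x0 mul0r => h.
by apply/eqP; rewrite -sqrf_eq0 eq_le h sqr_ge0.
Qed.

Lemma ip_sumsqr x y : ip (x + y) (x + y) <= 2 * (ip x x + ip y y).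
Proof.
have := ip_ge0 hip (x - y); rewrite !ipE (ipC hip y x); lra.
Qed.

Lemma ip_diffsqr x y : ip (x - y) (x - y) <= 2 * (ip x x + ip y y).
Proof.
have := ip_ge0 hip (x + y); rewrite !ipE (ipC hip y x); lra.
Qed.

Lemma semi_eq_refl x : semi_eq ip x x.
Proof. by rewrite /semi_eq subrr ip0l. Qed.

Lemma semi_eq_ipl x y z : semi_eq ip x y -> ip x z = ip y z.
Proof. by move=> /(@ip_null _ z); rewrite ipBl => /eqP; rewrite subr_eq0 => /eqP. Qed.

Lemma semi_eq_ipr x y z : semi_eq ip x y -> ip z x = ip z y.
Proof. by move=> /semi_eq_ipl h; rewrite ![ip z _]ipC// h. Qed.

Lemma ip_cvg_ip s u v : ip_cvg ip s u -> forall e, 0 < e ->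
  exists N, forall k, (N <= k)%N -> `|ip (s k) v - ip u v| < e.
Proof.
move=> su e e0; have q0 : 0 < ip v v + 1 by have := ip_ge0 hip v; lra.
have [|N HN] := su (e ^+ 2 / (ip v v + 1)); first by rewrite divr_gt0// exprn_gt0.
exists N => k /HN; rewrite ltr_pdivlMr// => h.
rewrite -ipBl -(@ltr_pXn2r _ 2) ?nnegrE ?(ltW e0)//.
rewrite real_normK ?num_real//.
apply: le_lt_trans h; apply: le_trans (ip_CS _ _) _.
rewrite ler_wpM2l// ?ip_ge0//; lra.
Qed.

(** The representative minimises [J x = ip x x - 2 * F x] over [S]. A minimising sequence is Cauchy
    by the parallelogram law, and its limit [u] in [L] satisfies the Euler equation against [S]. The
    bound on [ip u u] is the bound on [F] along the sequence, passed to the limit. *)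
Theorem riesz_representation (S L : set V) (F : V -> R) (K : R) :
  submodule S -> ip_complete ip S L ->
  (forall a x y, F (a *: x + y) = a * F x + F y) ->
  (forall x, S x -> F x ^+ 2 <= K * ip x x) ->
  exists2 u, L u & (forall v, S v -> ip u v = F v) /\ (0 <= K -> ip u u <= K).
Proof.
move=> [S0 SD] Scomp Flin FK.
pose J x := ip x x - 2 * F x.
pose im := [set J x | x in S].
have Jlb x : S x -> - `|K| <= J x.
  move=> Sx; have := FK _ Sx; rewrite /J; have := ler_norm K.
  have := ip_ge0 hip x; move: (ip x x) (F x) (normr_ge0 K) => q f h1 h2 h3 h4.
  have h5 : f ^+ 2 <= `|K| * q by apply: le_trans h4 _; rewrite ler_wpM2r.
  rewrite leNgt; apply/negP => h6.
  have : (q + `|K|) ^+ 2 < (2 * f) ^+ 2 by rewrite ltr_pXn2r ?nnegrE//; lra.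
  have := sqr_ge0 (q - `|K|); nra.
have im0 : has_inf im.
  split; first by exists (J 0); exists 0.
  by exists (- `|K|) => _ [x Sx <-]; exact: Jlb.
pose m := inf im.
have mJ x : S x -> m <= J x.
  by move=> Sx; apply: ge_inf; [exact: (proj2 im0) | exists x].
have /choice[s sP] : forall k : nat, exists x, S x /\ J x < m + k.+1%:R^-1.
  move=> k; have k0 : 0 < k.+1%:R^-1 :> R by rewrite invr_gt0.
  by have [_ [x Sx <-] ?] := inf_adherent k0 im0; exists x.
have F0 : F 0 = 0.
  have := Flin 1 0 0; rewrite scaler0 addr0 mul1r.
  by move/eqP; rewrite -subr_eq subrr eq_sym => /eqP.
have FD x y : F (x + y) = F x + F y by have := Flin 1 x y; rewrite scale1r mul1r.
have FZ a x : F (a *: x) = a * F x by have := Flin a x 0; rewrite F0 !addr0.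
have SZ a x : S x -> S (a *: x).
  by move=> Sx; have := SD a x 0 Sx S0; rewrite addr0.
have SDD x y : S x -> S y -> S (x + y).
  by move=> Sx Sy; have := SD 1 x y Sx Sy; rewrite scale1r.
have invN e : 0 < e -> exists N : nat, forall k, (N <= k)%N -> k.+1%:R^-1 < e :> R.
  move=> e0; have := near_infty_natSinv_lt (PosNum e0).
  by case=> N _ HN; exists N => k Nk; apply: HN.
have cs : ip_cauchy ip s.
  move=> e e0; have [|N HN] := invN (e / 4); first by rewrite divr_gt0.
  exists N => k l /HN hk /HN hl.
  have [Sk Jk] := sP k; have [Sl Jl] := sP l.
  (* At the midpoint [J] is still at least [m], so [ip (s k - s l) (s k - s l)] is below twice the
     sum of the two defects; each defect is less than [e / 4]. *)
  have := mJ (2^-1 *: (s k + s l)) (SZ _ _ (SDD _ _ Sk Sl)).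
  move: hk hl Jk Jl; rewrite /J FZ FD !ipE (ipC hip (s l) (s k)).
move: k.+1%:R^-1 l.+1%:R^-1 => a b; lra.
have [u Lu su] := Scomp s (fun k => proj1 (sP k)) cs.
have uF v : S v -> ip u v = F v.
  move=> Sv; set d := ip u v - F v.
  suff h t : 0 <= 0 + 2 * t * d + t ^+ 2 * ip v v.
    have := quadratic_ge0 (ip_ge0 hip v) h; rewrite mul0r => h'; apply/eqP.
    by rewrite -subr_eq0 -sqrf_eq0 eq_le h' sqr_ge0.
  (* The variation is taken at [s k] and not at [u], which may lie outside [S]. A negative value [e]
     leaves room for two errors of size [- e / 4]: the defect of [s k] and the replacement of [u] by
     [s k] in the linear term. *)
  rewrite add0r leNgt; apply/negP; set e := _ + _ => e0.
  have t1 : 0 < 2 * `|t| + 1 by have := normr_ge0 t; lra.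
  have e4 : 0 < - e / 4 by lra.
  have [|N1 H1] := @ip_cvg_ip s u v su (- e / 4 / (2 * `|t| + 1)).
    by rewrite divr_gt0.
  have [N2 H2] := invN _ e4.
  have := H1 _ (leq_maxl N1 N2); have := H2 _ (leq_maxr N1 N2).
  set k := maxn N1 N2 => hk; rewrite (ltr_pdivlMr _ _ t1) => hd.
  have [Sk Jk] := sP k.
  have := mJ _ (SDD _ _ Sk (SZ t _ Sv)); move: Jk.
  rewrite /J FD FZ !ipE (ipC hip v (s k)) => h1 h2.
  have h3 : 2 * t * (ip (s k) v - ip u v) <= 2 * `|t| * `|ip (s k) v - ip u v|.
    rewrite -!mulrA ler_wpM2l// -normrM; exact: ler_norm.
  have h4 := normr_ge0 (ip (s k) v - ip u v).
  move: e0 hk hd h1 h2 h3 h4; rewrite /e /d; move: k.+1%:R^-1 => a.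
  move: (ip (s k) v) (ip u v) => x y; move: `|x - y| `|t| => z w.
  lra.
exists u => //; split=> // K0; set q := ip u u.
rewrite leNgt; apply/negP => Kq.
(* Write e for this number. Then [ip (s k) u > q - e] and [ip (s k) (s k) < q + 3e], while
   [K = q - 5e]. The bound on [F] would give (q - e)^2 <= (q - 5e)(q + 3e), whose sides differ by 16
   e^2 in the wrong direction. *)
have e0 : 0 < (q - K) / 5 by rewrite divr_gt0// subr_gt0.
have [N1 H1] := ip_cvg_ip u su e0; have [N2 H2] := su _ e0.
have := H1 _ (leq_maxl N1 N2); have := H2 _ (leq_maxr N1 N2).
set k := maxn N1 N2; have [Sk _] := sP k.
have := FK _ Sk; rewrite -uF// !ipE (ipC hip u (s k)) -/q.
move: (ip (s k) (s k)) (ip (s k) u) => a b h1 h2.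
rewrite ltr_norml => /andP[h3 h4].
nra.
Qed.

End semi_inner_theory.

Section lax_milgram.
Variables (ip : V -> V -> R) (hip : semi_inner ip).

(** Riesz representation is used three times: [T x] represents [B x], [f] represents [F], and [u]
    represents [ip f (T v)] for the form [ip (T x) (T y)], which coercivity makes equivalent to [ip]
    on [S]. Then [z = T u - f] is orthogonal to [T z], so [B z z = 0] and [z] is a null vector. [T]
    is a pointwise choice, hence linear only when tested against [S]. *)
Theorem lax_milgram (S : set V) (B : V -> V -> R) (F : V -> R) (M alpha K : R) :
  submodule S -> ip_complete ip S S ->
  (forall a x y z, B (a *: x + y) z = a * B x z + B y z) ->
  (forall a x y z, B z (a *: x + y) = a * B z x + B z y) ->
  (forall x y, B x y ^+ 2 <= M * ip x x * ip y y) ->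
  0 < alpha -> (forall x, S x -> alpha * ip x x <= B x x) ->
  (forall a x y, F (a *: x + y) = a * F x + F y) ->
  0 <= K -> (forall x, S x -> F x ^+ 2 <= K * ip x x) ->
  exists2 u, S u & (forall v, S v -> B u v = F v) /\ alpha ^+ 2 * ip u u <= K.
Proof.
move=> Ssub Scomp Bl Br BM a0 Ba Flin K0 FK.
have /choice[T TP] : forall x, exists u, S u /\ forall v, S v -> ip u v = B x v.
  move=> x; have [] := @riesz_representation ip hip S S (B x) (M * ip x x) Ssub Scomp.
  - by move=> a y z; exact: Br.
  - by move=> y _; exact: BM.
  - by move=> u Su [hu _]; exists u.
have ST x : S (T x) by have [] := TP x.
have TE x v : S v -> ip (T x) v = B x v by have [_] := TP x; apply.
have TM x : ip (T x) (T x) <= `|M| * ip x x.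
  have := BM x (T x); rewrite -TE//; move: (ip_ge0 hip (T x)) (ip_ge0 hip x).
  move: (ip (T x) (T x)) (ip x x) => q p q0 p0 h.
  have {}h : q ^+ 2 <= `|M| * p * q.
    by apply: le_trans h _; rewrite ler_wpM2r// ler_wpM2r// ler_norm.
  have [->|qn0] := eqVneq q 0; first by rewrite mulr_ge0.
  have qp : 0 < q by rewrite lt_neqAle eq_sym qn0.
  by rewrite -(@ler_pM2r _ q)// -expr2.
have Ta x : S x -> alpha ^+ 2 * ip x x <= ip (T x) (T x).
  move=> Sx; have := Ba _ Sx; rewrite -TE//.
  have := ip_CS hip (T x) x; move: (ip_ge0 hip (T x)) (ip_ge0 hip x).
  move: (ip (T x) (T x)) (ip x x) (ip (T x) x) => q p b q0 p0 h1 h2.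
  have [->|pn0] := eqVneq p 0; first by rewrite mulr0.
  have pp : 0 < p by rewrite lt_neqAle eq_sym pn0.
  rewrite -(@ler_pM2r _ p)//; apply: le_trans h1.
  have : (alpha * p) ^+ 2 <= b ^+ 2.
    by rewrite ler_pXn2r ?nnegrE// ?mulr_ge0 ?(ltW a0)//; apply: le_trans h2; rewrite mulr_ge0// ltW.
  by rewrite exprMn; congr (_ <= _); ring.
pose ip' x y := ip (T x) (T y).
have TL a x y v : S v -> ip (T (a *: x + y)) v = a * ip (T x) v + ip (T y) v.
  by move=> Sv; rewrite !TE.
have hip' : semi_inner ip'.
  split.
  - by move=> a x y z; rewrite /ip' TL.
  - by move=> x y; rewrite /ip' (ipC hip).
  - by move=> x; exact: (ip_ge0 hip).
have ipTB x y v : S v -> ip (T (x - y)) v = ip (T x) v - ip (T y) v.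
  move=> Sv; have := TL (-1) y x v Sv; rewrite scaleN1r mulN1r.
  by rewrite addrC => ->; rewrite addrC.
have [S0 SD] := Ssub.
have SB x y : S x -> S y -> S (x - y).
  by move=> Sx Sy; rewrite addrC -scaleN1r; exact: SD.
have Scomp' : ip_complete ip' S S.
  move=> s Ss cs; case: (Scomp s Ss).
    move=> e e0; have [|N HN] := cs (alpha ^+ 2 * e); first by rewrite mulr_gt0// exprn_gt0.
    exists N => k l Nk Nl; have := HN k l Nk Nl.
    rewrite /ip' => /(le_lt_trans (Ta _ (SB _ _ (Ss k) (Ss l)))).
    by rewrite ltr_pM2l// exprn_gt0.
  move=> u Su su; exists u => // e e0.
  have M1 : 0 < `|M| + 1 by have := normr_ge0 M; lra.
  have [|N HN] := su (e / (`|M| + 1)); first by rewrite divr_gt0.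
  exists N => k /HN; rewrite ltr_pdivlMr// => h.
  apply: le_lt_trans h; apply: le_trans (TM _) _.
  by rewrite mulrC ler_wpM2l ?(ip_ge0 hip)//; lra.
have [f Sf [fP _]] := @riesz_representation ip hip S S F K Ssub Scomp Flin FK.
case: (@riesz_representation ip' hip' S S (ip f \o T) (ip f f) Ssub Scomp').
- by move=> a x y /=; rewrite (ipC hip)// TL// ![ip f _](ipC hip).
- by move=> x _ /=; exact: (ip_CS hip).
move=> u Su [uP _]; exists u => //.
have z0 v : S v -> ip (T u - f) v = 0.
  move=> Sv; rewrite (@ip_null _ hip (T u - f))//.
  set z := T u - f; have Sz : S z by exact: SB.
  have : ip (T z) z = 0.
    have e : ip (T u) (T z) = ip f (T z) := uP z Sz.
    by rewrite (ipC hip) {1}/z (ipBl hip) e subrr.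
  rewrite TE// => Bz; apply/eqP; rewrite eq_le (ip_ge0 hip)// andbT.
  by have := Ba _ Sz; rewrite Bz pmulr_rle0.
have uE v : S v -> B u v = F v.
  by move=> Sv; rewrite -TE// -fP//; apply/eqP; rewrite -subr_eq0 -(ipBl hip) z0.
split=> //; have := Ba _ Su; rewrite uE//; have := FK _ Su.
move: (ip_ge0 hip u); move: (ip u u) (F u) => q f' q0 h1 h2.
have [->|qn0] := eqVneq q 0; first by rewrite mulr0.
have qp : 0 < q by rewrite lt_neqAle eq_sym qn0.
rewrite -(@ler_pM2r _ q)//; apply: le_trans h1.
have : (alpha * q) ^+ 2 <= f' ^+ 2.
  by rewrite ler_pXn2r ?nnegrE// ?mulr_ge0 ?(ltW a0)//; apply: le_trans h2; rewrite mulr_ge0// ltW.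
by rewrite exprMn; congr (_ <= _); ring.
Qed.

End lax_milgram.

End semi_inner_product.

(** * The spaces of square integrable functions *)

Section riesz_fischer.
Context d (T : measurableType d) (R : realType).
Variables (mu : {measure set T -> \bar R}) (D : set T) (mD : measurable D).

Lemma limn_einf_le (u : (\bar R)^nat) (l : \bar R) (N : nat) :
  (forall n, (N <= n)%N -> u n <= l)%E -> (limn_einf u <= l)%E.
Proof.
move=> ul; rewrite limn_einf_lim; apply: lime_le; first exact: is_cvg_einfs.
apply: nearW => n; apply: le_trans (ul (maxn N n) (leq_maxl _ _)).
by apply: ereal_inf_lbound; exists (maxn N n) => //=; exact: leq_maxr.
Qed.

(** A subsequence [t] has increments so small that the squares of its increments, weighted by 2^i,
    have an integrable sum. Where this sum is finite the increments are absolutely summable, which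
    defines the limit; the Cauchy bound is passed to that limit by Fatou with the first index
    fixed. *)
Lemma riesz_fischer (s : nat -> T -> R) :
  (forall k, measurable_fun D (s k)) ->
  (forall e : R, 0 < e -> exists N, forall k l, (N <= k)%N -> (N <= l)%N ->
    (\int[mu]_(x in D) ((s k x - s l x) ^+ 2)%:E <= e%:E)%E) ->
  exists f : T -> R, measurable_fun D f /\
    forall e : R, 0 < e -> exists N, forall k, (N <= k)%N ->
      (\int[mu]_(x in D) ((s k x - f x) ^+ 2)%:E <= e%:E)%E.
Proof.
move=> ms cs.
have p2 i : 0 < (2 ^ i)%:R :> R by rewrite ltr0n expn_gt0.
have /choice[nu nuP] : forall i : nat, exists N, forall k l,
    (N <= k)%N -> (N <= l)%N ->
    (\int[mu]_(x in D) ((s k x - s l x) ^+ 2)%:E <=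
     (((2 ^ i)%:R * (2 ^ i.+1)%:R)^-1)%:E)%E.
  by move=> i; apply: cs; rewrite invr_gt0 mulr_gt0.
(* The sum dominates every threshold [nu j] with [j <= i]; the summand [i] gives [i <= phi i], so
   that the subsequence enters any Cauchy range. *)
pose phi i := (i + \sum_(j < i.+1) nu j)%N.
have nu_phi i k : (i <= k)%N -> (nu i <= phi k)%N.
  move=> ik; by rewrite /phi (bigD1 (inord i))//= inordK// addnCA leq_addr.
pose t i := s (phi i).
have mst k l : measurable_fun D ((fun x => ((s k x - s l x) ^+ 2)%:E) : T -> \bar R).
  apply/measurable_EFinP; apply: measurable_funX.
  exact: measurable_funB.
pose g i x : \bar R := ((2 ^ i)%:R * (t i x - t i.+1 x) ^+ 2)%:E.
have mg i : measurable_fun D (g i).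
  by apply/measurable_EFinP; apply: measurable_funM => //;
    apply/measurable_EFinP; exact: mst.
have g0 i x : (0 <= g i x)%E by rewrite lee_fin mulr_ge0// sqr_ge0.
pose h x := (\sum_(0 <= i <oo) g i x)%E.
have mh : measurable_fun D h by apply: ge0_emeasurable_sum => // ? ? _ _.
have h0 x : (0 <= h x)%E by apply: nneseries_ge0.
have ih : mu.-integrable D h.
  apply/integrableP; split=> //.
  under eq_integral do rewrite gee0_abs//.
  rewrite integral_nneseries//.
  apply: (@le_lt_trans _ _ (1%:E)); last exact: ltry.
  apply: le_trans (@epsilon_trick0 R 1 xpredT ler01).
  apply: lee_nneseries => [i _ _|i _]; first exact: integral_ge0.
  under eq_integral do rewrite /g EFinM.
  rewrite ge0_integralZl//; [|exact: mst|by move=> x _; rewrite lee_fin sqr_ge0].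
  have := nuP i (phi i) (phi i.+1) (nu_phi _ _ (leqnn _)) (nu_phi _ _ (leqnSn _)).
  have p2i : (0 <= (2 ^ i)%:R%:E :> \bar R)%E by rewrite lee_fin ltW.
  by move=> /(lee_wpmul2l p2i); rewrite -EFinM invfM mulrA divff ?gt_eqF.
pose G := D `&` [set x | h x \is a fin_num].
have mG : measurable G by apply: emeasurable_fin_num.
have GD : G `<=` D by move=> x [].
have NG : mu (D `\` G) = 0.
  have [N [mN N0 DN]] := integrable_ae mD ih.
  apply: (@subset_measure0 _ _ _ _ _ N) => //; first exact: measurableD.
  move=> x [Dx nGx]; apply: DN => /= /(_ Dx) hx; apply: nGx; split=> //.
have cvgt x : G x -> cvgn (fun k => t k x).
  move=> [Dx hx]; set M := fine (h x).
  have gM n : \sum_(0 <= i < n) (2 ^ i)%:R * (t i x - t i.+1 x) ^+ 2 <= M.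
    rewrite -lee_fin /M fineK// -sumEFin.
    by apply: nneseries_lim_ge => i _ _; exact: g0.
  have cs' : cvgn [series `|t i.+1 x - t i x|]_i.
    apply: nondecreasing_is_cvgn.
      by apply: nondecreasing_series => i _ _; exact: normr_ge0.
    exists (M + 1) => _ [n _ <-]; rewrite seriesEnat/=.
    have e1 n' : \sum_(0 <= i < n') 1 / (2 ^ i.+1)%:R <= 1 :> R.
      have := @epsilon_trick0 R 1 xpredT ler01.
      rewrite -lee_fin; apply: le_trans; rewrite -sumEFin.
      by apply: nneseries_lim_ge => i _ _; rewrite lee_fin divr_ge0.
    apply: le_trans (lerD (gM n) (e1 n)); rewrite -big_split/=.
    apply: ler_sum => i _; rewrite distrC.
    rewrite -[X in _ * X + _]real_normK ?num_real//.
    move: `|_| (p2 i) => y; rewrite expnS natrM; move: (2 ^ i)%:R => p pp.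
    (* Completing the square shows that an increment [y] is at most [p * y ^+ 2 + 1 / (2 * p)]. With
       p = 2^i the last terms sum to at most 1, so the weighted squares control the increments
       themselves. *)
    have -> : p * y ^+ 2 + 1 / (2 * p) = y + (2 * p * y - 1) ^+ 2 / (4 * p) + 1 / (4 * p).
      by field; rewrite gt_eqF.
    by rewrite -addrA lerDl addr_ge0// ?divr_ge0// ?sqr_ge0// mulr_ge0// ltW.
  have {}cs' : cvgn (series (telescope (fun k => t k x))) by exact: normed_cvg.
  rewrite (_ : (fun k => t k x) =
    (fun k => t 0%N x + series (telescope (fun k => t k x)) k)).
    exact: is_cvgD (is_cvg_cst _) cs'.
  by apply/funext => k; rewrite -eq_sum_telescope.
pose f x := if x \in G then limn (fun k => t k x) else 0.
have fG x : G x -> t k x @[k --> \oo] --> f x.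
  by move=> Gx; rewrite /f mem_set//; exact: cvgt.
have mf : measurable_fun D f.
  apply: (@measurable_fun_cvg _ _ _ _ (fun k => (t k) \_ G)) => [k|x Dx].
    apply: measurable_funTS.
    have mtG : measurable_fun G (t k) by apply: measurable_funS (ms _).
    by apply/(measurable_restrictT (t k) mG).
  have -> : (fun k => (t k \_ G) x) = if x \in G then (fun k => t k x) else cst 0.
    by apply/funext => k; rewrite /patch; case: ifPn.
  case: ifPn => xG; first exact: fG (set_mem xG).
  by rewrite /f (negbTE xG); exact: cvg_cst.
exists f; split=> // e e0.
have [N HN] := cs e e0; exists N => k Nk.
have msf k' : measurable_fun D ((fun x => ((s k' x - f x) ^+ 2)%:E) : T -> \bar R).
  apply/measurable_EFinP; apply: measurable_funX.
  exact: measurable_funB.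
rewrite (@ge0_negligible_integral _ _ _ _ _ (D `\` G))//; last 2 first.
- exact: measurableD.
- by move=> x _; rewrite lee_fin sqr_ge0.
rewrite setDD setIidr//.
have -> : (\int[mu]_(x in G) ((s k x - f x) ^+ 2)%:E =
    \int[mu]_(x in G) limn_einf (fun l => ((s k x - t l x) ^+ 2)%:E))%E.
  apply: eq_integral => x /set_mem Gx.
  rewrite (@cvg_limn_einf_sup _ _ ((s k x - f x) ^+ 2)%:E)//.
  apply: cvg_EFin; first exact: nearW.
  have h1 : s k x - t l x @[l --> \oo] --> s k x - f x.
    by apply: cvgB (fG _ Gx); exact: cvg_cst.
  exact: (cvgM h1 h1).
apply: le_trans (fatou _ _ _ _) _ => //.
- by move=> l; apply: measurable_funS (mst _ _).
- by move=> l x _; rewrite lee_fin sqr_ge0.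
apply: (@limn_einf_le _ _ N) => l Nl.
apply: le_trans (HN k (phi l) Nk (leq_trans Nl (leq_addr _ _))); apply: ge0_subset_integral => //; first exact: mst.
by move=> x _; rewrite lee_fin sqr_ge0.
Qed.

End riesz_fischer.

Section integral_mrestr.
Context d (T : measurableType d) (R : realType).
Variables (mu : {measure set T -> \bar R}) (D : set T) (mD : measurable D).

Lemma ge0_integral_mrestr (f : T -> \bar R) : measurable_fun setT f ->
  (forall x, (0 <= f x)%E) ->
  (\int[mrestr mu mD]_x f x = \int[mu]_(x in D) f x)%E.
Proof.
move=> mf f0; rewrite (@ge0_negligible_integral _ _ _ (mrestr mu mD) _ (~` D))//.
- rewrite setTD setCK; apply: eq_measure_integral => A mA AD.
  by rewrite /= /mrestr setIidl.
- exact: measurableC.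
- by rewrite /= /mrestr setICl measure0.
Qed.

Lemma integrable_mrestr (f : T -> R) : measurable_fun setT f ->
  (mrestr mu mD).-integrable setT (EFin \o f) <-> mu.-integrable D (EFin \o f).
Proof.
move=> mf; have mEf : measurable_fun setT (EFin \o f) by exact/measurable_EFinP.
have e : (\int[mrestr mu mD]_x `|(EFin \o f) x| =
    \int[mu]_(x in D) `|(EFin \o f) x|)%E.
  by apply: ge0_integral_mrestr => //; exact: measurableT_comp.
split=> /integrableP[_ h]; apply/integrableP; split=> //.
- exact: measurable_funTS.
- by rewrite -e.
- by rewrite e.
Qed.

End integral_mrestr.

Section L2_space.
Variables (R : realType) (n : nat) (D : lipschitz_domain R n).
Notation E := 'rV[R]_n.+1.
Notation leb := (lebesgue_rV R n.+1).

Lemma mdom : measurable (dom D).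
Proof. by apply: open_measurable_rV; exact: dom_open. Qed.
Hint Resolve mdom : core.

Lemma L2_measurable (f : L2 D) (A : set E) : measurable_fun A f.
Proof. by apply: measurable_funTS; have := measurable_funPT f. Qed.
Hint Resolve L2_measurable : core.

Lemma L2_integrableM (f g : L2 D) :
  leb.-integrable D (EFin \o (fun x => f x * g x)).
Proof.
apply/(integrable_mrestr leb (open_measurable_rV (@dom_open _ _ D))).
  exact: measurable_funM.
by apply/Lfun1_integrable/Lfun2_mul_Lfun1; exact: LfunP.
Qed.

(** Elements of [L2] are functions on the whole space, so [f] is cut off by zero outside [D].
    Products, test functions and limits become elements of [L2] in this way. *)
Lemma L2_of (f : E -> R) : measurable_fun D f ->
  (\int[leb]_(x in D) (f x ^+ 2)%:E < +oo)%E ->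
  exists g : L2 D, forall x, dom D x -> g x = f x.
Proof.
move=> mf foo; pose h := f \_ D.
have mh : measurable_fun setT h by apply/(measurable_restrictT f mdom).
suff hL : h \in Lfun (mrestr leb (open_measurable_rV (@dom_open _ _ D))) 2%:E.
  exists (Lfun_Sub (lee1n 2) hL) => x Dx.
  by rewrite Lfun_valP /h /patch mem_set.
rewrite inE; apply/andP; split; rewrite inE//=.
rewrite /finite_norm unlock /Lnorm poweR_lty//.
under eq_integral.
  move=> x _; rewrite /= powR_mulrn// -normrX ger0_norm ?sqr_ge0//.
  over.
rewrite ge0_integral_mrestr//; last 2 first.
- by apply/measurable_EFinP; exact: measurable_funX.
- by move=> x; rewrite lee_fin sqr_ge0.
rewrite (eq_integral (fun x => (f x ^+ 2)%:E))// => x xD.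
by rewrite /h /patch xD.
Qed.

Lemma l2_dotE (f g : L2 D) :
  ((l2_dot f g)%:E = \int[leb]_(x in D) (f x * g x)%:E)%E.
Proof.
rewrite /l2_dot /Rintegral fineK//.
by apply: integrable_fin_num => //; exact: L2_integrableM.
Qed.

Lemma L2_coordE (a : R) (f g : L2 D) x : (a *: f + g) x = a * f x + g x.
Proof. by []. Qed.

Lemma L2_subE (f g : L2 D) x : (f - g) x = f x - g x.
Proof. by []. Qed.

Lemma l2_dot_semi_inner : semi_inner (@l2_dot R n D).
Proof.
split.
- move=> a f g h; rewrite /l2_dot.
  rewrite -RintegralZl//; last exact: L2_integrableM.
  rewrite -RintegralD//; last exact: L2_integrableM.
    by apply: eq_Rintegral => x _; rewrite L2_coordE mulrDl mulrA.
  have := L2_integrableM (a *: f) h; congr (integrable _ _ _).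
  by apply/funext => x /=; congr EFin; rewrite mulrA.
- by move=> f g; apply: eq_Rintegral => x _; rewrite mulrC.
- by move=> f; apply: Rintegral_ge0 => x _; rewrite -expr2 sqr_ge0.
Qed.

Lemma l2n_dotE (p q : L2n D) : l2n_dot p q = \sum_i l2_dot (p i) (q i).
Proof.
rewrite /l2n_dot /Rintegral; under eq_integral do rewrite -sumEFin.
rewrite integral_sum//; last by move=> i; exact: L2_integrableM.
rewrite (eq_bigr (fun i => (l2_dot (p i) (q i))%:E)) ?sumEFin// => i _.
by rewrite l2_dotE.
Qed.

Lemma L2n_coordE (a : R) (f g : L2n D) i : (a *: f + g) i = a *: f i + g i.
Proof. by rewrite !ffunE. Qed.

Lemma l2n_dot_semi_inner : semi_inner (@l2n_dot R n D).
Proof.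
split.
- move=> a f g h; rewrite !l2n_dotE mulr_sumr -big_split/=.
  by apply: eq_bigr => i _; rewrite L2n_coordE (ip_linl l2_dot_semi_inner).
- move=> f g; rewrite !l2n_dotE; apply: eq_bigr => i _.
  exact: ipC l2_dot_semi_inner _ _.
- by move=> f; rewrite l2n_dotE sumr_ge0// => i _; exact: ip_ge0 l2_dot_semi_inner _.
Qed.

Lemma eqon_semi_eq (f g : L2 D) : (forall x, dom D x -> f x = g x) ->
  semi_eq (@l2_dot R n D) f g.
Proof.
move=> fg; rewrite /semi_eq /l2_dot /Rintegral.
rewrite (eq_integral (fun=> 0%:E)) ?integral0// => x /set_mem Dx.
by rewrite L2_subE fg// subrr mul0r.
Qed.

Lemma ae_semi_eq (f g : L2 D) : {ae leb, forall x, dom D x -> f x = g x} ->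
  semi_eq (@l2_dot R n D) f g.
Proof.
move=> fg; rewrite /semi_eq /l2_dot /Rintegral.
rewrite (@ae_eq_integral _ _ _ leb D (fun=> 0%:E))//.
- by rewrite integral0.
- by apply/measurable_EFinP; apply: measurable_funM; exact: L2_measurable.
- by apply: filterS fg => x fg Dx; rewrite L2_subE fg// subrr mul0r.
Qed.

Lemma l2_complete : ip_complete (@l2_dot R n D) setT setT.
Proof.
move=> s _ cs.
have [||f [mf fP]] := @riesz_fischer _ _ _ leb D mdom (fun k x => s k x).
- by move=> k; exact: L2_measurable.
- move=> e /cs[N HN]; exists N => k l Nk Nl; have := HN k l Nk Nl.
  by rewrite -lte_fin l2_dotE; exact: ltW.
have [g gf] : exists g : L2 D, forall x, dom D x -> g x = f x.
  apply: L2_of => //; have [N /(_ N (leqnn _)) HN] := fP _ ltr01.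
  apply: (@le_lt_trans _ _
    (\int[leb]_(x in D) ((2 * (s N x - f x) ^+ 2)%:E + (2 * s N x ^+ 2)%:E))%E).
    apply: ge0_le_integral => //.
    - by move=> x _; rewrite lee_fin sqr_ge0.
    - by apply/measurable_EFinP; exact: measurable_funX.
    - apply: emeasurable_funD; apply/measurable_EFinP; apply: measurable_funM => //;
      apply: measurable_funX => //; exact: measurable_funB.
    - move=> x _; rewrite -EFinD lee_fin.
      have := sqr_ge0 (s N x + (s N x - f x)); move: (s N x) (f x) => a b; nra.
  rewrite ge0_integralD//; last 4 first.
  - by move=> x _; rewrite lee_fin mulr_ge0// sqr_ge0.
  - apply/measurable_EFinP; apply: measurable_funM => //;
      apply: measurable_funX => //; exact: measurable_funB.
  - by move=> x _; rewrite lee_fin mulr_ge0// sqr_ge0.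
  - apply/measurable_EFinP; apply: measurable_funM => //;
      apply: measurable_funX => //; exact: measurable_funB.
  apply: lte_add_pinfty.
    under eq_integral do rewrite EFinM.
    rewrite ge0_integralZl//; last 2 first.
    - apply/measurable_EFinP; apply: measurable_funX => //; exact: measurable_funB.
    - by move=> x _; rewrite lee_fin sqr_ge0.
    apply: lte_mul_pinfty => //; exact: le_lt_trans HN (ltry _).
  have := integrableZl mdom 2 (L2_integrableM (s N) (s N)).
  move/integrable_lty => /(_ mdom); congr (_ < _)%E; apply: eq_integral => x _.
exists g => // e e0; have [|N HN] := fP (e / 2); first by rewrite divr_gt0.
exists N => k /HN h; rewrite -lte_fin l2_dotE; apply: le_lt_trans (_ : ((e / 2)%:E < _)%E).
  apply: le_trans h; rewrite le_eqVlt; apply/orP; left; apply/eqP.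
  by apply: eq_integral => x /set_mem Dx; rewrite L2_subE gf// -expr2.
by rewrite lte_fin ltr_pdivrMr// ltr_pMr// ltr1n.
Qed.

Lemma l2n_complete : ip_complete (@l2n_dot R n D) setT setT.
Proof.
move=> s _ cs.
have le i (p : L2n D) : l2_dot (p i) (p i) <= l2n_dot p p.
  rewrite l2n_dotE (bigD1 i)//= lerDl sumr_ge0// => k _.
  exact: ip_ge0 l2_dot_semi_inner _.
have subE (p q : L2n D) i : (p - q) i = p i - q i by rewrite !ffunE.
have /choice[u uP] : forall i : 'I_n.+1, exists u, ip_cvg (@l2_dot R n D) (fun k => s k i) u.
  move=> i; have [||u _ su] := @l2_complete (fun k => s k i) => //.
    move=> e /cs[N HN]; exists N => k l Nk Nl; rewrite -subE.
    exact: le_lt_trans (le _ _) (HN k l Nk Nl).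
  by exists u.
exists [ffun i => u i] => // e e0.
have e1 : 0 < e / n.+1%:R by rewrite divr_gt0.
have /choice[N NP] : forall i : 'I_n.+1, exists N, forall k, (N <= k)%N ->
    l2_dot (s k i - u i) (s k i - u i) < e / n.+1%:R.
  by move=> i; exact: uP.
exists (\max_i N i) => k Nk; rewrite l2n_dotE.
apply: (@lt_le_trans _ _ (\sum_(i < n.+1) (e / n.+1%:R))); last first.
  by rewrite sumr_const card_ord -[X in X <= _]mulr_natr divfK.
rewrite -subr_gt0 -sumrB big_ord_recl ltr_pwDl//.
  rewrite subr_gt0 subE ffunE; apply: NP; apply: leq_trans Nk; exact: leq_bigmax.
apply: sumr_ge0 => i _; rewrite subr_ge0 subE ffunE ltW//.
by apply: NP; apply: leq_trans Nk; exact: leq_bigmax.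
Qed.

Lemma L2_mul (g : E -> R) (M : R) (f : L2 D) : measurable_fun D g ->
  {ae leb, forall x, dom D x -> `|g x| <= M} ->
  exists2 h : L2 D, (forall x, dom D x -> h x = g x * f x) &
    l2_dot h h <= M ^+ 2 * l2_dot f f.
Proof.
move=> mg gM.
have le : (\int[leb]_(x in D) ((g x * f x) ^+ 2)%:E <= (M ^+ 2 * l2_dot f f)%:E)%E.
  rewrite EFinM l2_dotE -ge0_integralZl//; last 3 first.
  - by apply/measurable_EFinP; apply: measurable_funM.
  - by move=> x _; rewrite lee_fin -expr2 sqr_ge0.
  - by rewrite lee_fin sqr_ge0.
  apply: ae_ge0_le_integral => //.
  - by move=> x _; rewrite lee_fin sqr_ge0.
  - by apply/measurable_EFinP; apply: measurable_funX; apply: measurable_funM.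
  - by move=> x _; rewrite -EFinM lee_fin mulr_ge0 ?sqr_ge0// -expr2 sqr_ge0.
  - by apply: emeasurable_funM => //; apply/measurable_EFinP; apply: measurable_funM.
  - apply: filterS gM => x gM Dx; rewrite -EFinM lee_fin exprMn -expr2 ler_wpM2r ?sqr_ge0//.
    rewrite -[X in X <= _]real_normK ?num_real// ler_pXn2r ?nnegrE ?gM//.
    by apply: le_trans (gM Dx).
have [h hE] : exists h : L2 D, forall x, dom D x -> h x = g x * f x.
  by apply: L2_of; [exact: measurable_funM|exact: le_lt_trans le (ltry _)].
exists h => //; rewrite -lee_fin; apply: le_trans le; rewrite l2_dotE.
rewrite le_eqVlt; apply/orP; left; apply/eqP.
by apply: eq_integral => x /set_mem Dx; rewrite hE// expr2.
Qed.

End L2_space.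
#[global] Hint Extern 0 (measurable (dom _)) => exact: mdom : core.
#[global] Hint Extern 0 (measurable_fun _ _) => exact: L2_measurable : core.

(** * Test functions *)

Section smooth_functions.
Variables (R : realType) (n : nat).
Notation E := 'rV[R]_n.+1.

Lemma Ck_continuous k (f : E -> R) : Ck k f -> continuous f.
Proof. by case: k => [|k] []. Qed.

Lemma CkW k (f : E -> R) : Ck k.+1 f -> Ck k f.
Proof.
elim: k f => [|k IH] f [cf H]; split=> // i.
by have [df /IH] := H i.
Qed.

Lemma eq_Ck k (f g : E -> R) : f =1 g -> Ck k f -> Ck k g.
Proof. by move=> /funext ->. Qed.

Lemma Ck_cst k (a : R) : Ck k (fun _ : E => a).
Proof.
elim: k a => [|k IH] a; split=> //; try exact: cst_continuous.
move=> i; split; first by move=> x; exact: derivable_cst.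
rewrite (_ : partial i _ = fun=> 0)//.
by apply/funext => x; rewrite /partial derive_cst.
Qed.

Lemma Ck_linear k (a : R) (f g : E -> R) :
  Ck k f -> Ck k g -> Ck k (fun x => a * f x + g x).
Proof.
elim: k f g => [|k IH] f g [cf Hf] [cg Hg]; split=> //.
- by move=> x; exact: (cvgD (cvgM (cvg_cst a) (cf x)) (cg x)).
- by move=> x; exact: (cvgD (cvgM (cvg_cst a) (cf x)) (cg x)).
move=> i; have [df Cf] := Hf i; have [dg Cg] := Hg i.
have e : (fun x => a * f x + g x) = a *: f + g by [].
split=> [x|].
  by rewrite e; apply: derivableD => //; exact: derivableZ.
rewrite (_ : partial i _ = fun x => a * partial i f x + partial i g x).
  exact: IH.
apply/funext => x; rewrite /partial e deriveD//; last exact: derivableZ.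
by rewrite deriveZ.
Qed.

Lemma Ck_mul k (f g : E -> R) : Ck k f -> Ck k g -> Ck k (fun x => f x * g x).
Proof.
elim: k f g => [|k IH] f g Cf Cg.
  by split=> // x; exact: (cvgM (proj1 Cf x) (proj1 Cg x)).
have Cf' := CkW Cf; have Cg' := CkW Cg.
have [cf Hf] := Cf; have [cg Hg] := Cg.
split=> [x|i]; first by exact: (cvgM (cf x) (cg x)).
have [df Cdf] := Hf i; have [dg Cdg] := Hg i.
split=> [x|]; first exact: derivableM.
rewrite (_ : partial i _ =
    fun x => 1 * (f x * partial i g x) + g x * partial i f x).
  by apply: Ck_linear; exact: IH.
by apply/funext => x; rewrite /partial deriveM// mul1r.
Qed.

Lemma Ck_prod k (I : Type) (r : seq I) (F : I -> E -> R) :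
  (forall i, Ck k (F i)) -> Ck k (fun x => \prod_(i <- r) F i x).
Proof.
move=> CF; elim: r => [|i r IH].
  by apply: (@eq_Ck k (fun=> 1)) (Ck_cst _ _) => x; rewrite big_nil.
apply: (@eq_Ck k (fun x => F i x * \prod_(j <- r) F j x)) (Ck_mul (CF i) IH).
by move=> x; rewrite big_cons.
Qed.

(** The one-variable counterpart of [Ck]. The derivative is carried as an explicit function, since
    the smooth step comes with a closed formula for it. *)
Fixpoint C1k (k : nat) (phi : R -> R) : Prop :=
  continuous phi /\
  if k is k'.+1 then
    exists2 phi' : R -> R, forall t : R, is_derive t (1 : R) phi (phi' t) & C1k k' phi'
  else True.

Lemma is_derive_dir (phi : R -> R) (t a c : R) :
  is_derive t 1 phi a -> is_derive t c phi (c * a).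
Proof.
move=> h; have dphi : differentiable phi t by apply/derivable1_diffP; apply: ex_derive.
apply: DeriveDef; first exact: diff_derivable.
rewrite deriveE// -[in LHS](mulr1 c) -[X in 'd phi t X]/(c *: (1 : R)).
rewrite linearZ/= -deriveE//; congr (_ * _); exact: derive_val.
Qed.

(** Along the [j]-th basis vector the difference quotient is literally that of [phi] in the
    direction [s * (i == j)%:R]. *)
Lemma is_derive_coord (phi : R -> R) (s b a : R) (i j : 'I_n.+1) (x : E) :
  is_derive (s * x 0 i + b) 1 phi a ->
  is_derive x (delta_mx 0 j) (fun y : E => phi (s * y 0 i + b)) (s * (i == j)%:R * a).
Proof.
move=> /(@is_derive_dir _ _ _ (s * (i == j)%:R)) h.
have e : (fun h => h^-1 *: (((fun y : E => phi (s * y 0 i + b)) \o shift x)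
        (h *: delta_mx 0 j) - phi (s * x 0 i + b))) =
    (fun h => h^-1 *: ((phi \o shift (s * x 0 i + b))
        (h *: (s * (i == j)%:R : R)) - phi (s * x 0 i + b))).
  apply/funext => h' /=; congr (_ *: (phi _ - _)).
  rewrite !mxE eqxx/= /GRing.scale/=; ring.
apply: DeriveDef.
  by rewrite /derivable e; exact: ex_derive.
by rewrite /derive e; exact: derive_val.
Qed.

Lemma Ck_coord k (phi : R -> R) (s b : R) (i : 'I_n.+1) :
  C1k k phi -> Ck k (fun x : E => phi (s * x 0 i + b)).
Proof.
have cc : continuous (fun x : E => s * x 0 i + b).
  move=> x; have ci := @coord_continuous R 1 n.+1 0 i x.
  exact: (cvgD (cvgM (cvg_cst s) ci) (cvg_cst b)).
elim: k phi => [|k IH] phi [cphi H]; split=> //.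
- by move=> x; apply: continuous_comp; [exact: cc|exact: cphi].
- by move=> x; apply: continuous_comp; [exact: cc|exact: cphi].
have [phi' dphi Cphi] := H.
move=> j; split=> [x|].
  by have := @is_derive_coord phi s b _ i j x (dphi _); case.
rewrite (_ : partial j _ =
    fun x => s * (i == j)%:R * phi' (s * x 0 i + b) + 0).
  by apply: Ck_linear; [exact: IH|exact: Ck_cst].
apply/funext => x; rewrite addr0.
by have := @is_derive_coord phi s b _ i j x (dphi _); case.
Qed.

End smooth_functions.

(** * A smooth function vanishing on the negative half-line *)

Section smooth_step.
Variable R : realType.

(** The polynomial factor in 1/t makes this family closed under differentiation, so smoothness to
    every order is a plain induction on the order. *)
Definition step (p : {poly R}) (t : R) : R :=
  if 0 < t then p.[t^-1] * expR (- t^-1) else 0.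

(** With y = 1/t this is exp(y) >= y^(k+1) / (k+1)!. One power more than [k] is taken so that a
    factor [t] remains, which yields the limit 0 at the origin. *)
Lemma monomial_step_bound k (t : R) : 0 < t ->
  t^-1 ^+ k * expR (- t^-1) <= k.+1`!%:R * t.
Proof.
move=> t0; rewrite expRN ler_pdivrMr ?expR_gt0//.
have y0 : 0 < t^-1 by rewrite invr_gt0.
have := expR_ge1Dxn k (ltW y0) => h.
have {}h : t^-1 ^+ k.+1 / k.+1`!%:R <= expR t^-1 by apply: le_trans h; rewrite lerDr.
apply: (@le_trans _ _ (k.+1`!%:R * t * (t^-1 ^+ k.+1 / k.+1`!%:R))).
  have : k.+1`!%:R != 0 :> R by rewrite pnatr_eq0 -lt0n fact_gt0.
  rewrite exprS le_eqVlt; move: k.+1`!%:R (t^-1 ^+ k) => c a c0.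
  have tn0 : t != 0 by rewrite gt_eqF.
  apply/orP; left; apply/eqP; field.
  by rewrite ?tn0 ?c0.
by rewrite ler_wpM2l// mulr_ge0 ?ltW.
Qed.

Lemma step_bound (p : {poly R}) : exists C, forall t, `|step p t| <= C * `|t|.
Proof.
exists (\sum_(i < size p) `|p`_i| * i.+1`!%:R) => t; rewrite /step.
case: ifPn => t0; last first.
  by rewrite normr0 mulr_ge0// sumr_ge0// => i _; rewrite mulr_ge0.
rewrite normrM (gtr0_norm (expR_gt0 _)) horner_coef (gtr0_norm t0) mulr_suml.
apply: (@le_trans _ _ ((\sum_(i < size p) `|p`_i| * t^-1 ^+ i) * expR (- t^-1))).
  rewrite ler_wpM2r ?expR_ge0//; apply: le_trans (ler_norm_sum _ _ _) _.
  by apply: ler_sum => i _; rewrite normrM normrX [ `|t^-1|]gtr0_norm ?invr_gt0.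
rewrite mulr_suml; apply: ler_sum => i _; rewrite -!mulrA ler_wpM2l//.
exact: monomial_step_bound.
Qed.

(* [d/dt (p(1/t) exp(-1/t)) = q(1/t) exp(-1/t)] with [q = X^2 (p - p')]. *)
Definition dstep (p : {poly R}) : {poly R} := 'X^2 * (p - p^`()).

Lemma step_cvg0 (p : {poly R}) : step p h @[h --> 0^'] --> 0.
Proof.
have [C HC] := step_bound p.
apply/norm_cvg0P.
apply: (@squeeze_cvgr _ _ _ _ (fun=> 0) (fun h : R => C * `|h|)).
- by apply: nearW => h; rewrite normr_ge0 HC.
- exact: cvg_cst.
- apply: (@cvg_trans _ ((fun h : R => C * `|h|) x @[x --> nbhs 0])).
    by apply: cvg_app; exact: cvg_within.
  have := cvgM (cvg_cst C) (cvg_norm (@cvg_id _ (nbhs (0 : R)))).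
  by rewrite normr0 mulr0; apply.
Qed.

Lemma is_derive_step (p : {poly R}) (t : R) :
  is_derive t (1 : R) (step p) (step (dstep p) t).
Proof.
have [t0|t0|->] := ltgtP t 0.
- rewrite {2}/step ltNge (ltW t0)/=.
  apply: (@near_eq_is_derive _ _ _ (cst 0)).
  near=> s; rewrite /step ltNge ifF//; apply/negbF/ltW; near: s.
  exact: lt_nbhsl.
- suff : is_derive t 1 (fun s => p.[s^-1] * expR (- s^-1)) (step (dstep p) t).
    apply: near_eq_is_derive; near=> s; rewrite /step ifT//; near: s.
    exact: lt_nbhsr.
  have tn0 : t != 0 by rewrite gt_eqF.
  have d1 : is_derive t 1 (fun s : R => s^-1) (- t ^- 2).
    have := @is_deriveV R id t 1 1 tn0 (is_derive_id _ _).
    by rewrite /GRing.scale/= mulr1.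
  have d2 : is_derive t 1 (fun s => p.[s^-1]) (p^`().[t^-1] * - t ^- 2).
    exact: (is_derive1_comp (is_derive_poly p t^-1) d1).
  have d3 : is_derive t 1 (fun s => expR (- s^-1)) (expR (- t^-1) * - (- t ^- 2)).
    have dN : is_derive t 1 (fun s : R => - s^-1) (- (- t ^- 2)) by exact: is_deriveN.
    have de : is_derive (- t^-1) 1 expR (expR (- t^-1)) by exact: is_derive_expR.
    exact: (@is_derive1_comp _ expR (fun s : R => - s^-1)).
  have := is_deriveM d2 d3; congr (is_derive _ _ _ _).
  rewrite /step t0 /dstep !hornerE /GRing.scale/= opprK -exprVn.
  ring.
(* At the origin the difference quotient of [step p] is again a member of the family,
   [step ('X * p)], and tends to 0 by the linear bound. *)
- have e : (fun h : R => h^-1 *: ((step p \o shift 0) (h *: (1 : R)) - step p 0)) =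
      step ('X * p).
    apply/funext => h; rewrite /step ltxx subr0 /= /GRing.scale/= mulr1 addr0.
    case: ifPn => h0; last by rewrite mulr0.
    by rewrite hornerM hornerX mulrA.
  rewrite [X in is_derive _ _ _ X]/step ltxx.
  by apply: DeriveDef; rewrite /derivable /derive e;
    [apply/cvg_ex; exists 0|apply/cvg_lim => //]; exact: step_cvg0.
Unshelve. all: by end_near.
Qed.

Lemma C1k_step k p : C1k k (step p).
Proof.
have c q : continuous (step q).
  move=> t; apply: differentiable_continuous; apply/derivable1_diffP.
  by have := is_derive_step q t; case.
elim: k p => [|k IH] p; split=> //.
by exists (step (dstep p)) => // t; exact: is_derive_step.
Qed.

End smooth_step.

(** * Boxes as a generating system stable under intersection *)

Section boxes.
Variables (R : realType) (n : nat).
Notation E := 'rV[R]_n.+1.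

Definition obox (a b : E) : set E := [set x | forall i, a 0 i < x 0 i < b 0 i].
Definition cbox (a b : E) : set E := [set x | forall i, a 0 i <= x 0 i <= b 0 i].

Lemma measurable_obox a b : measurable (obox a b).
Proof.
have -> : obox a b = \bigcap_(i in [set: 'I_n.+1])
    ((fun x : E => x 0 i) @^-1` `]a 0 i, b 0 i[%classic).
  by apply/seteqP; split => [x xq i _|x xq i];
    [rewrite /= in_itv/=; exact: xq|have := xq i I; rewrite /= in_itv].
apply: fin_bigcap_measurable => [|i _]; first exact: finite_finset.
by rewrite -[X in measurable X]setTI; exact: measurable_coord.
Qed.

Lemma obox_cbox a b : obox a b `<=` cbox a b.
Proof. by move=> x H i; have /andP[/ltW -> /ltW ->] := H i. Qed.

Lemma compact_cbox a b : compact (cbox a b).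
Proof.
have -> : cbox a b = [set v | forall i, `[a 0 i, b 0 i]%classic (v ord0 i)].
  by apply/seteqP; split => [x H i|x H i]; have := H i; rewrite /= in_itv.
apply: (@rV_compact R n.+1 (fun i => `[a 0 i, b 0 i]%classic)) => i.
exact: segment_compact.
Qed.

Lemma closed_cbox a b : closed (cbox a b).
Proof. by apply: compact_closed; [exact: norm_hausdorff|exact: compact_cbox]. Qed.

Let G : set (set E) := [set obox a b | a in setT & b in setT].

Lemma setI_obox (a b a' b' : E) : obox a b `&` obox a' b' =
  obox (\row_i Num.max (a 0 i) (a' 0 i)) (\row_i Num.min (b 0 i) (b' 0 i)).
Proof.
apply/seteqP; split => [x [H H'] i|x H].
  have /andP[h1 h2] := H i; have /andP[h3 h4] := H' i.
  by rewrite !mxE gt_max lt_min h1 h2 h3 h4.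
split=> i; have := H i; rewrite !mxE gt_max lt_min;
  by move=> /andP[/andP[h1 h2] /andP[h3 h4]]; rewrite ?h1 ?h2 ?h3 ?h4.
Qed.

(** The coordinate half-spaces generate the sigma-algebra, and each of them is a countable union of
    open boxes. Together with [setI_obox] this prepares a Dynkin class argument. *)
Lemma sigma_obox : @measurable _ E `<=` <<s [set obox a b | a in setT & b in setT] >>.
Proof.
have : measurable_fun [set: g_sigma_algebraType G] (id : g_sigma_algebraType G -> E).
  apply/measurable_rVP => i.
  apply: (@measurability _ _ _ _ _ _ (@RGenOInfty.G R)).
    exact: RGenOInfty.measurableE.
  move=> _ [_ [r ->] <-]; rewrite setTI.
  (* Only the lower side in coordinate [i] stays at [r]; all other sides recede to infinity with
     [k]. *)
  pose B k : set E := obox (\row_j (if j == i then r else - k%:R)) (const_mx k%:R).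
  rewrite (_ : _ @^-1` _ = \bigcup_k B k).
    apply: bigcup_measurable => k _; apply: sub_sigma_algebra.
    by exists (\row_j (if j == i then r else - k%:R)) => //; exists (const_mx k%:R).
  apply/seteqP; split => [x /=|x [k _]]; last first.
    by move=> /(_ i); rewrite !mxE eqxx /= in_itv/= andbT => /andP[].
  rewrite in_itv/= andbT => rx.
  pose M := \big[Num.max/0]_(j < n.+1) `|x 0 j|.
  have [k Mk] : exists k : nat, M < k%:R.
    exists (Num.truncn M).+1; exact: truncnS_gt.
  have xk j : `|x 0 j| < k%:R by apply: le_lt_trans Mk; exact: le_bigmax.
  exists k => // j; rewrite !mxE; have := xk j; rewrite ltr_norml => /andP[h1 ->].
  by case: eqP => [->|_]; rewrite ?rx ?h1.
by move=> H A mA; have := H measurableT A mA; rewrite setTI.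
Qed.

End boxes.

(** * The fundamental lemma of the calculus of variations *)

Section test_functions.
Variables (R : realType) (n : nat) (D : lipschitz_domain R n).
Notation E := 'rV[R]_n.+1.
Notation leb := (lebesgue_rV R n.+1).

Let mD : measurable (dom D) := mdom D.
Hint Resolve mD : core.

Lemma continuous_measurable (f : E -> R) : continuous f -> measurable_fun setT f.
Proof.
move=> cf; apply: (@measurability _ _ _ _ _ _ (@RGenOInfty.G R)).
  exact: RGenOInfty.measurableE.
move=> _ [_ [r ->] <-]; rewrite setTI; apply: open_measurable_rV.
apply: open_comp; first by move=> x _; exact: cf.
exact: interval_open.
Qed.

Lemma dom_coord_bounded : exists2 M : R, 0 < M &
  forall x, dom D x -> forall i, `|x 0 i| <= M.
Proof.
have [M [Mr HM]] := @dom_bounded _ _ D.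
have M1 : M < `|M| + 1 by apply: le_lt_trans (ler_norm M) _; rewrite ltrDl.
exists (`|M| + 1); first by rewrite ltr_wpDl.
move=> x Dx i; apply: le_trans (HM _ M1 x Dx).
rewrite [leRHS]mx_normrE; exact: (@le_bigmax _ _ _ 0 (fun ij => `|x ij.1 ij.2|) (0, i)).
Qed.

Lemma dom_finite : (leb D < +oo)%E.
Proof.
have [M M0 HM] := dom_coord_bounded.
pose a : E := const_mx (- M); pose b : E := const_mx M.
have := @lebesgue_rV_box R n.+1 a b; rewrite -/(cbox a b) => h.
apply: (@le_lt_trans _ _ (leb (cbox a b))).
  apply: le_measure; rewrite ?inE//.
  - rewrite -[cbox a b]setCK; apply: measurableC; apply: open_measurable_rV.
    by apply: closed_openC; exact: closed_cbox.
  - by move=> x Dx i; rewrite !mxE -ler_norml; exact: HM.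
rewrite h ?ltry// => i; rewrite !mxE; lra.
Qed.

Lemma bounded_L2 (f : E -> R) (M : R) : measurable_fun D f ->
  (forall x, dom D x -> `|f x| <= M) ->
  exists g : L2 D, forall x, dom D x -> g x = f x.
Proof.
move=> mf fM; apply: L2_of => //.
apply: (@le_lt_trans _ _ (\int[leb]_(x in D) (M ^+ 2)%:E)%E).
  apply: ge0_le_integral => //.
  - by move=> x _; rewrite lee_fin sqr_ge0.
  - by apply/measurable_EFinP; exact: measurable_funX.
  - move=> x Dx; rewrite lee_fin -[X in X <= _]real_normK ?num_real//.
    by rewrite ler_pXn2r ?nnegrE ?fM//; apply: le_trans (fM _ Dx).
by rewrite integral_cst//; apply: lte_mul_pinfty => //; [by rewrite lee_fin sqr_ge0|exact: dom_finite].
Qed.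

Lemma test_bounded (f : E -> R) : test_function D f -> exists M, forall x, `|f x| <= M.
Proof.
move=> [Cf cf _]; have fc : continuous f := Ck_continuous (Cf 0%N).
have : compact (f @` closure [set x | f x != 0]).
  by apply: continuous_compact => //; exact: continuous_subspaceT.
move/compact_bounded => [M [Mr HM]]; exists (`|M| + 1) => x.
have [->|fx] := eqVneq (f x) 0; first by rewrite normr0 addr_ge0.
apply: (HM (`|M| + 1)); first by apply: le_lt_trans (ler_norm M) _; rewrite ltrDl.
by exists x => //; exact: subset_closure.
Qed.

Lemma test_L2 (f : E -> R) : test_function D f ->
  exists g : L2 D, forall x, dom D x -> g x = f x.
Proof.
move=> tf; have [M HM] := test_bounded tf; apply: (@bounded_L2 _ M) => //.
by apply: measurable_funTS; apply: continuous_measurable; case: tf => /(_ 0%N) [].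
Qed.

Lemma test_eq0 (f : E -> R) x : test_function D f -> ~ dom D x -> f x = 0.
Proof.
move=> [_ _ sf] nDx; apply/eqP/negPn/negP => fx; apply: nDx; apply: sf.
exact: subset_closure.
Qed.

Lemma partial_support i (f : E -> R) :
  [set x | partial i f x != 0] `<=` closure [set x | f x != 0].
Proof.
move=> x /= dfx; apply: contrapT => ncx; move/eqP: dfx; apply.
have : \forall y \near x, f y = 0.
  have oc : open (~` closure [set x | f x != 0]).
    exact/closed_openC/closed_closure.
  have := open_nbhs_nbhs (conj oc ncx); apply: filterS => y ncy.
  by apply: contrapT => /eqP fy; apply: ncy; exact: subset_closure.
move=> near0; have h : is_derive x (delta_mx 0 i) f 0.
  apply: (@near_eq_is_derive _ _ _ (cst 0)).
  by apply: filterS near0 => y ->.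
by case: h.
Qed.

Lemma test_partial i (f : E -> R) : test_function D f -> test_function D (partial i f).
Proof.
move=> [Cf cf sf].
have cs : closure [set x | partial i f x != 0] `<=` closure [set x | f x != 0].
  rewrite [X in _ `<=` X](closure_id _).1; last exact: closed_closure.
  by apply: closureS; exact: partial_support.
split.
- by move=> k; have [_ /(_ i) []] := Cf k.+1.
- by apply: subclosed_compact cs => //; exact: closed_closure.
- exact: subset_trans cs sf.
Qed.

Lemma test_linear (a : R) (f g : E -> R) : test_function D f -> test_function D g ->
  test_function D (fun x => a * f x + g x).
Proof.
move=> [Cf cf sf] [Cg cg sg].
have cs : closure [set x | a * f x + g x != 0] `<=`
    closure [set x | f x != 0] `|` closure [set x | g x != 0].
  rewrite -closureU; apply: closureS => x /= h.
  have [fx|] := eqVneq (f x) 0; [right|by left].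
  by move: h; rewrite fx mulr0 add0r.
split.
- by move=> k; exact: Ck_linear.
- apply: subclosed_compact cs; [exact: closed_closure|exact: compactU].
- by move=> x /cs[/sf|/sg].
Qed.

Lemma partial_linear i (a : R) (f g : E -> R) x : test_function D f -> test_function D g ->
  partial i (fun x => a * f x + g x) x = a * partial i f x + partial i g x.
Proof.
move=> [Cf _ _] [Cg _ _]; have [_ /(_ i) [df _]] := Cf 1%N.
have [_ /(_ i) [dg _]] := Cg 1%N.
have e : (fun x => a * f x + g x) = a *: f + g by [].
by rewrite /partial e deriveD//; [rewrite deriveZ|exact: derivableZ].
Qed.

Lemma test0 : test_function D (fun=> 0).
Proof.
have e : [set x : E | 0 != 0 :> R] = set0.
  by apply/seteqP; split => x //=; rewrite eqxx.
split=> [k||]; first exact: Ck_cst.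
  rewrite e closure0; exact: compact0.
by rewrite e closure0.
Qed.

(** As [e] grows, each factor tends to the indicator of a half-line, so the product tends to the
    indicator of the open box from [a] to [b] while keeping its support in the closed box. The
    arguments are written as [s * x 0 i + b] to fit [Ck_coord]. *)
Definition bump (e : R) (a b : E) (x : E) : R :=
  \prod_(i < n.+1) (step 1 (e * x 0 i + - (e * a 0 i)) *
                    step 1 (- e * x 0 i + e * b 0 i)).

Lemma bump_out (e : R) (a b x : E) : 0 < e -> ~ obox a b x -> bump e a b x = 0.
Proof.
move=> e0 /existsNP[i nab]; rewrite /bump (bigD1 i)//= /step.
case: ltP => h1; last by rewrite !mul0r.
case: ltP => h2; last by rewrite mulr0 mul0r.
exfalso; apply: nab; apply/andP; split.
- by rewrite -subr_gt0 -(pmulr_rgt0 _ e0) mulrBr.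
- by rewrite -subr_gt0 -(pmulr_rgt0 _ e0) mulrBr addrC -mulNr.
Qed.

Lemma test_bump (e : R) (a b : E) : 0 < e -> cbox a b `<=` D ->
  test_function D (bump e a b).
Proof.
move=> e0 abD.
have cs : closure [set x | bump e a b x != 0] `<=` cbox a b.
  rewrite [X in _ `<=` X](closure_id _).1; last exact: closed_cbox.
  apply: closureS => x /= bx; apply: obox_cbox; apply: contrapT => nx.
  by move: bx; rewrite bump_out// eqxx.
split.
- move=> k; apply: (@Ck_prod _ _ k _ _ (fun i (x : E) =>
    step 1 (e * x 0 i + - (e * a 0 i)) * step 1 (- e * x 0 i + e * b 0 i))) => i.
  by apply: Ck_mul; apply: (@Ck_coord _ _ k (step 1)); exact: C1k_step.
- by apply: subclosed_compact cs; [exact: closed_closure|exact: compact_cbox].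
- exact: subset_trans cs abD.
Qed.

Lemma step1_le1 (t : R) : 0 <= step 1 t <= 1.
Proof.
rewrite /step; case: ifPn => t0; last by rewrite lexx ler01.
rewrite hornerC mul1r expR_ge0/= -expR0 ler_expR oppr_le0 invr_ge0 ltW//.
Qed.

Lemma step1_cvg (t : R) : 0 < t -> step 1 (k.+1%:R * t) @[k --> \oo] --> (1 : R).
Proof.
move=> t0; have e k : step 1 (k.+1%:R * t) = expR (- t^-1 * k.+1%:R^-1).
  by rewrite /step mulr_gt0// hornerC mul1r invfM mulrC mulNr.
under eq_fun do rewrite e.
have h0 : - t^-1 * k.+1%:R^-1 @[k --> \oo] --> - t^-1 * 0.
  by apply: cvgM; [exact: cvg_cst|exact: cvg_harmonic].
have := continuous_cvg _ (@continuous_expR R (- t^-1 * 0)) h0.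
by rewrite mulr0 expR0; apply.
Qed.

Lemma bump_le1 (e : R) (a b x : E) : 0 <= bump e a b x <= 1.
Proof.
have h i : 0 <= step 1 (e * x 0 i + - (e * a 0 i)) *
                step 1 (- e * x 0 i + e * b 0 i) <= 1.
  have /andP[h1 h2] := step1_le1 (e * x 0 i + - (e * a 0 i)).
  have /andP[h3 h4] := step1_le1 (- e * x 0 i + e * b 0 i).
  by rewrite mulr_ge0// mulr_ile1.
rewrite /bump prodr_ile1// andbT; apply: prodr_ge0 => i _.
by have /andP[] := h i.
Qed.

Lemma cvg_prod1 (I : Type) (r : seq I) (F : I -> nat -> R) :
  (forall i, F i k @[k --> \oo] --> (1 : R)) ->
  (\prod_(i <- r) F i k) @[k --> \oo] --> (1 : R).
Proof.
move=> F1; elim: r => [|i r IH].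
  by under eq_fun do rewrite big_nil; exact: cvg_cst.
under eq_fun do rewrite big_cons.
have := cvgM (F1 i) IH; rewrite mulr1; exact.
Qed.

Lemma bump_cvg (a b x : E) :
  bump k.+1%:R a b x @[k --> \oo] --> (\1_(obox a b) x : R).
Proof.
have [xab|nx] := pselect (obox a b x); last first.
  rewrite indicE memNset//; under eq_fun do rewrite bump_out//.
  exact: cvg_cst.
rewrite indicE mem_set//; apply: cvg_prod1 => i.
have /andP[ax xb] := xab i.
have h1 : step 1 (k.+1%:R * (x 0 i - a 0 i)) @[k --> \oo] --> (1 : R).
  by apply: step1_cvg; rewrite subr_gt0.
have h2 : step 1 (k.+1%:R * (b 0 i - x 0 i)) @[k --> \oo] --> (1 : R).
  by apply: step1_cvg; rewrite subr_gt0.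
have h3 : step 1 (k.+1%:R * (x 0 i - a 0 i)) * step 1 (k.+1%:R * (b 0 i - x 0 i))
    @[k --> \oo] --> (1 * 1 : R) by exact: cvgM h1 h2.
rewrite mulr1 in h3; apply: cvg_trans h3.
apply: near_eq_cvg; apply: nearW => k /=.
by congr (step 1 _ * step 1 _); ring.
Qed.

Lemma L2_integrable (f : L2 D) : leb.-integrable D (EFin \o f).
Proof.
have [g gE] : exists g : L2 D, forall x, dom D x -> g x = (cst 1 : E -> R) x.
  by apply: (@bounded_L2 _ 1) => // x _; rewrite normr1.
apply: eq_integrable (L2_integrableM f g) => // x /set_mem Dx /=.
by rewrite gE// mulr1.
Qed.

(** Bumps of growing steepness are test functions between 0 and 1 that converge to the indicator of
    the box; dominated convergence applies because [D] has finite measure, hence [f] is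
    integrable. *)
Lemma integral_obox0 (f : L2 D) (a b : E) :
  (forall t, test_function D t -> \int[leb]_(x in D) (f x * t x) = 0) ->
  cbox a b `<=` D -> (\int[leb]_(x in obox a b) (f x)%:E = 0)%E.
Proof.
move=> f0 abD.
have /(_ _) e : forall k : nat, (\int[leb]_(x in D) (f x * bump k.+1%:R a b x)%:E = 0)%E.
  move=> k; have tb := @test_bump k.+1%:R a b (ltr0Sn _ _) abD.
  have [g gE] := test_L2 tb; have := f0 _ tb.
  rewrite (@eq_Rintegral _ _ _ leb D (fun x => f x * g x)); last first.
    by move=> x /set_mem Dx; rewrite gE.
  rewrite -/(l2_dot f g) => fg.
  have <- : (\int[leb]_(x in D) (f x * g x)%:E = 0)%E by rewrite -l2_dotE fg.
  by apply: eq_integral => x /set_mem Dx; rewrite gE.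
have [||||| _ _] := @dominated_convergence _ _ _ leb D mD
  (fun k x => (f x * bump k.+1%:R a b x)%:E) (fun x => (f x * \1_(obox a b) x)%:E)
  (EFin \o (fun x => `|f x|)).
- move=> k; apply/measurable_EFinP; apply: measurable_funM => //.
  apply: measurable_funTS; apply: continuous_measurable.
  by have [/(_ 0%N) []] := @test_bump k.+1%:R a b (ltr0Sn _ _) abD.
- apply/measurable_EFinP; apply: measurable_funM => //.
  by apply: measurable_funTS; apply: measurable_indic; exact: measurable_obox.
- apply: aeW => x _; apply: cvg_EFin; first exact: nearW.
  exact: (cvgM (cvg_cst (f x)) (@bump_cvg a b x)).
- exact: integrable_abse (L2_integrable f).
- apply: aeW => x k _; rewrite lee_fin normrM ler_piMr//.
  by have /andP[h1 h2] := bump_le1 k.+1%:R a b x; rewrite ger0_norm.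
under eq_fun do rewrite e.
move=> /cvg_lim; rewrite lim_cst// => /(_ _)/esym h.
have abD' : obox a b `<=` D by apply: subset_trans abD; exact: obox_cbox.
rewrite -[RHS]h// [in LHS](integral_mkcond) [in RHS](integral_mkcond).
apply: eq_integral => x _; rewrite /patch indicE.
case: (boolP (x \in obox a b)) => xab; last by rewrite mulr0 if_same.
by rewrite (mem_set (abD' _ (set_mem xab))) mulr1.
Qed.

(** The measurable sets [S] for which [f] integrates to 0 over the intersection of [S] with the box
    form a Dynkin class. It contains all open boxes, hence all measurable sets, and a function with
    vanishing integrals over all measurable subsets is null. *)
Lemma ae0_obox (f : L2 D) (a b : E) :
  (forall t, test_function D t -> \int[leb]_(x in D) (f x * t x) = 0) ->
  cbox a b `<=` D -> {ae leb, forall x, obox a b x -> f x = 0}.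
Proof.
move=> f0 abD; set B := obox a b.
have BD : B `<=` D by apply: subset_trans abD; exact: obox_cbox.
have mB : measurable B by exact: measurable_obox.
have iB (S : set E) : measurable S -> S `<=` B -> leb.-integrable S (EFin \o f).
  by move=> mS SB; apply: integrableS (L2_integrable f) => //; exact: subset_trans BD.
pose H : set (set E) := [set S | measurable S /\
  (\int[leb]_(x in B `&` S) (f x)%:E = 0)%E].
have HG : [set obox a b | a in setT & b in setT] `<=` H.
  move=> _ [a' _ [b' _ <-]]; split; first exact: measurable_obox.
  rewrite /B setI_obox; apply: integral_obox0 => // x abx; apply: abD => i.
  have := abx i; rewrite !mxE ge_max le_min.
  by move=> /andP[/andP[-> _] /andP[-> _]].
have HB S : measurable S -> (\int[leb]_(x in B `&` S) (f x)%:E = 0)%E.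
  move=> /sigma_obox; rewrite -setI_closed_g_dynkin_g_sigma_algebra; last first.
    move=> _ _ [a1 _ [b1 _ <-]] [a2 _ [b2 _ <-]]; rewrite setI_obox.
    by eexists; [|eexists; [|reflexivity]].
  move=> dS; suff : H S by case.
  apply: dS; split=> //; split.
  - by split=> //; rewrite setIT; exact: integral_obox0.
  - move=> A [mA A0]; split; first exact: measurableC.
    have e : (B `&` A) `|` (B `&` ~` A) = B by rewrite -setIUr setUv setIT.
    have mBA : measurable (B `&` A) by exact: measurableI.
    have mBC : measurable (B `&` ~` A) by apply: measurableI => //; exact: measurableC.
    have : (\int[leb]_(x in (B `&` A) `|` (B `&` ~` A)) (f x)%:E = 0)%E.
      by rewrite e; exact: integral_obox0.
    rewrite integral_setU//; first by rewrite A0 add0e.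
    - by apply/measurable_EFinP.
    - by apply/disj_setPS => x [[_ Ax] [_]].
  - move=> F tF HF; split; first by apply: bigcup_measurable => k _; case: (HF k).
    rewrite setI_bigcupr integral_bigcup//=.
    + by rewrite eseries0// => k _ _; case: (HF k).
    + exact: trivIset_setIl.
    + by move=> k; apply: measurableI => //; case: (HF k).
    + apply: iB => //; first by apply: bigcup_measurable => k _; apply: measurableI => //; case: (HF k).
      by move=> x [k _ []].
have : ae_eq leb B (EFin \o f) (cst 0%E).
  apply: integral_ae_eq => //; first by apply: iB.
  move=> S SB mS; rewrite integral0.
  by have := HB S mS; rewrite setIidr.
by apply: filterS => x /[apply] -[].
Qed.

Lemma cover_obox (x : E) : dom D x ->
  exists p q : 'rV[rat]_n.+1,
    let a := map_mx (ratr : rat -> R) p in let b := map_mx (ratr : rat -> R) q in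
    obox a b x /\ cbox a b `<=` D.
Proof.
move=> Dx; have /nbhs_ballP[e /= e0 xeD] : nbhs x (dom D).
  by apply: open_nbhs_nbhs; split => //; exact: dom_open.
have e20 : 0 < e / 2 by rewrite divr_gt0.
have /choice[p pP] : forall i : 'I_n.+1, exists r : rat,
    x 0 i - e / 2 < ratr r < x 0 i.
  move=> i; have /rat_in_itvoo[r] : x 0 i - e / 2 < x 0 i by rewrite gtrBl.
  by rewrite in_itv/=; exists r.
have /choice[q qP] : forall i : 'I_n.+1, exists r : rat,
    x 0 i < ratr r < x 0 i + e / 2.
  move=> i; have /rat_in_itvoo[r] : x 0 i < x 0 i + e / 2 by rewrite ltrDl.
  by rewrite in_itv/=; exists r.
exists (\row_i p i), (\row_i q i) => /=; split.
  by move=> i; rewrite !mxE; have /andP[_ ->] := pP i; have /andP[-> _] := qP i.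
move=> y yab; apply: xeD; split => // i j; rewrite (ord1 i) /ball/=.
have := yab j; rewrite !mxE => /andP[h1 h2].
have /andP[h3 h4] := pP j; have /andP[h5 h6] := qP j.
rewrite ltr_norml; lra.
Qed.

(** The boxes with rational corners whose closed version lies in [D] cover [D]. They are countably
    many, so the exceptional sets of [ae0_obox] have a negligible union. *)
Theorem fundamental_lemma (f : L2 D) :
  (forall t, test_function D t -> \int[leb]_(x in D) (f x * t x) = 0) ->
  semi_eq (@l2_dot R n D) f 0.
Proof.
move=> f0; apply: ae_semi_eq.
pose F (k : nat) : set E := if @unpickle ('rV[rat]_n.+1 * 'rV[rat]_n.+1)%type k is Some pq
  then let a := map_mx (ratr : rat -> R) pq.1 in let b := map_mx (ratr : rat -> R) pq.2 in
    if `[< cbox a b `<=` D >] then [set x | ~ (obox a b x -> f x = 0)] else set0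
  else set0.
have NF : leb.-negligible (\bigcup_k F k).
  apply: negligible_bigcup => k; rewrite /F; case: unpickle => [[p q]|]; last exact: negligible_set0.
  case: asboolP => [ab|_]; last exact: negligible_set0.
  by have := ae0_obox f0 ab.
apply: negligibleS NF => x /= /not_implyP[Dx fx].
have [p [q [xpq pqD]]] := cover_obox Dx.
exists (pickle (p, q)) => //; rewrite /F pickleK /=.
by case: asboolP => // _ /(_ xpq).
Qed.

(** This is what makes the chosen [wdiv] independent of the choice up to null elements. *)
Lemma weak_div_unique (q : L2n D) (d1 d2 : L2 D) : weak_div q d1 -> weak_div q d2 ->
  semi_eq (@l2_dot R n D) d1 d2.
Proof.
move=> q1 q2; suff : semi_eq (@l2_dot R n D) (d1 - d2) 0 by rewrite /semi_eq subr0.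
apply: fundamental_lemma => t tt; have [g gE] := test_L2 tt.
have e (d : L2 D) : \int[leb]_(x in D) (d x * t x) = l2_dot d g.
  by apply: eq_Rintegral => x /set_mem Dx; rewrite gE.
rewrite e (ipBl (@l2_dot_semi_inner R n D)) -!e; apply/eqP; rewrite subr_eq0 -eqr_opp.
by rewrite -(q1 t tt) -(q2 t tt).
Qed.

End test_functions.

(** * The Poincare inequality for test functions *)

Section poincare.
Variables (R : realType) (n : nat) (D : lipschitz_domain R n).
Notation E := 'rV[R]_n.+1.
Notation leb := (lebesgue_rV R n.+1).
Let mD : measurable (dom D) := mdom D.
Hint Resolve mD : core.

Lemma rV_consD (t h : R) (y : 'rV[R]_n) :
  rV_cons (h + t, y) = h *: delta_mx 0 0 + rV_cons (t, y).
Proof.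
apply/rowP => i; rewrite !mxE eqxx/=.
case: (unliftP ord0 i) => [j|] ->.
  by rewrite mulr0 add0r.
by rewrite mulr1.
Qed.

Lemma continuous_rV_cons (y : 'rV[R]_n) : continuous (fun t : R => rV_cons (t, y)).
Proof.
have -> : (fun t : R => rV_cons (t, y)) =
    (fun t => t *: delta_mx 0 0 + rV_cons (0, y)).
  by apply/funext => t; rewrite -rV_consD addr0.
move=> t; apply: cvgD; last exact: cvg_cst.
by apply: cvgZr_tmp; exact: cvg_id.
Qed.

Lemma is_derive_rV_cons (f : E -> R) (y : 'rV[R]_n) (t : R) :
  derivable f (rV_cons (t, y)) (delta_mx 0 0) ->
  is_derive t (1 : R) (fun s => f (rV_cons (s, y))) (partial 0 f (rV_cons (t, y))).
Proof.
move=> df; have e : (fun h : R => h^-1 *: (((fun s => f (rV_cons (s, y))) \o shift t)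
        (h *: (1 : R)) - f (rV_cons (t, y)))) =
    (fun h => h^-1 *: ((f \o shift (rV_cons (t, y)))
        (h *: delta_mx 0 0) - f (rV_cons (t, y)))).
  apply/funext => h /=; congr (_ *: (f _ - _)).
  by rewrite -rV_consD /GRing.scale/= mulr1.
by apply: DeriveDef; rewrite /derivable /partial /derive e.
Qed.

(** [lebesgue_rV] is by construction the image of a product measure under [rV_cons], so this is a
    change of variables followed by Fubini. *)
Lemma integral_lebesgue_rVS (F : E -> \bar R) : measurable_fun setT F ->
  leb.-integrable setT F ->
  (\int[leb]_x F x =
   \int[lebesgue_rV R n]_y \int[lebesgue_measure]_t F (rV_cons (t, y)))%E.
Proof.
move=> mF iF.
have mc : measurable_fun [set: (measurableTypeR R * 'rV[R]_n)%type] (@rV_cons R n).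
  exact: measurable_rV_cons.
pose m : {measure set (measurableTypeR R * 'rV[R]_n) -> \bar R} :=
  (@lebesgue_measure R \x lebesgue_rV R n)%E.
have iFc : m.-integrable setT (F \o @rV_cons R n).
  apply/integrableP; split; first exact: measurableT_comp.
  have /integrableP[_] := iF; apply: le_lt_trans.
  have := @ge0_integral_pushforward _ _ _ _ R _ mc m setT (fun x => `|F x|)%E.
  move=> /(_ measurableT) h; rewrite -[X in (_ <= X)%E]/(\int[pushforward m (@rV_cons R n)]_x `|F x|)%E h//.
  by apply: measurableT_comp.
have e1 := @integral_pushforward _ _ _ _ R _ mc m setT F mF iFc measurableT.
have e2 := @integral21_prod_meas1 _ _ _ _ R (@lebesgue_measure R) (lebesgue_rV R n)
  (F \o @rV_cons R n) iFc.
exact: etrans e1 (esym e2).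
Qed.

(** On each line parallel to the first axis [f] vanishes beyond the bound [M] of the domain, so the
    fundamental theorem of calculus makes the inner integral zero. *)
Lemma integral_partial0 (f : E -> R) : test_function D f ->
  \int[leb]_(x in D) partial 0 f x = 0.
Proof.
move=> tf; have tp := test_partial 0 tf.
have [M M0 HM] := dom_coord_bounded D.
have cp : continuous (partial 0 f) by case: tp => /(_ 0%N) [].
have cf : continuous f by case: tf => /(_ 0%N) [].
have [g gE] := test_L2 tp.
have e : partial 0 f = partial 0 f \_ D.
  apply/funext => x; rewrite /patch; case: ifPn => // xD.
  by rewrite (test_eq0 tp)// => Dx; rewrite (mem_set Dx) in xD.
have ip : leb.-integrable setT (EFin \o partial 0 f).
  rewrite e -restrict_EFin; apply/(integrable_mkcond (EFin \o partial 0 f) mD).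
  apply: eq_integrable (L2_integrable g) => // x /set_mem Dx /=.
  by rewrite gE.
have h0 (t : R) (y : 'rV[R]_n) : M < `|t| ->
    f (rV_cons (t, y)) = 0 /\ partial 0 f (rV_cons (t, y)) = 0.
  move=> Mt; have nD : ~ dom D (rV_cons (t, y)).
    by move=> /HM /(_ 0); rewrite rV_cons0 leNgt Mt.
  by split; [exact: (test_eq0 tf)|exact: (test_eq0 tp)].
pose k (y : 'rV[R]_n) (t : R) := partial 0 f (rV_cons (t, y)).
have ck y : continuous (k y).
  move=> t; apply: (@continuous_comp _ _ _ (fun t : R => rV_cons (t, y))).
    exact: continuous_rV_cons.
  exact: cp.
have ch y : continuous (fun t : R => f (rV_cons (t, y))).
  move=> t; apply: (@continuous_comp _ _ _ (fun t : R => rV_cons (t, y))).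
    exact: continuous_rV_cons.
  exact: cf.
have inner y : (\int[lebesgue_measure]_t (k y t)%:E = 0)%E.
  pose L := M + 1.
  have LL : - L < L by rewrite /L; lra.
  have -> : (\int[lebesgue_measure]_t (k y t)%:E =
      \int[lebesgue_measure]_(t in `[(- L)%R, L]) (k y t)%:E)%E.
    rewrite [RHS]integral_mkcond; apply: eq_integral => t _.
    rewrite /patch; case: ifPn => // tL; rewrite /k.
    rewrite (h0 t y _).2// ltNge; apply: contra tL => tM.
    rewrite inE/= in_itv/= -ler_norml (le_trans tM)// /L; lra.
  have dh (t : R) : is_derive t (1 : R) (fun s => f (rV_cons (s, y))) (k y t).
    apply: is_derive_rV_cons; case: tf => /(_ 1%N) [_ /(_ 0)[+ _]] _ _; exact.
  rewrite (@continuous_FTC2 R (k y) (fun t => f (rV_cons (t, y))))//.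
  - rewrite (h0 L y _).1; last by rewrite /L ger0_norm; lra.
    rewrite (h0 (- L) y _).1; last by rewrite /L normrN ger0_norm; lra.
    by rewrite subee.
  - exact: continuous_subspaceT.
  - split.
    + by move=> t _; case: (dh t).
    + by apply: cvg_at_right_filter; exact: ch.
    + by apply: cvg_at_left_filter; exact: ch.
  - by move=> t _; rewrite derive1E; case: (dh t).
rewrite /Rintegral.
have -> : (\int[leb]_(x in D) (partial 0 f x)%:E = \int[leb]_x (partial 0 f x)%:E)%E.
  rewrite integral_mkcond; apply: eq_integral => x _.
  rewrite [in RHS]e /patch; case: ifPn => //.
rewrite (@integral_lebesgue_rVS (EFin \o partial 0 f))//; last first.
  by apply/measurable_EFinP; exact: continuous_measurable.
by under eq_integral => y _ do rewrite /= inner; rewrite integral0.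
Qed.

Lemma C1k_cst k (a : R) : C1k k (fun=> a).
Proof.
elim: k a => [|k IH] a; split=> //; try exact: cst_continuous.
by exists (fun=> 0) => // t; exact: is_derive_cst.
Qed.

Lemma C1k_id k : C1k k (@id R).
Proof.
case: k => [|k]; split=> //; try by move=> x; exact: cvg_id.
by exists (fun=> 1) => [t|]; [exact: is_derive_id|exact: C1k_cst].
Qed.

(* Integrate the derivative of [x_0 t^2] along the first coordinate. *)
Lemma poincare : exists2 C : R, 0 <= C & forall (t : E -> R) (f g : L2 D),
  test_function D t -> (forall x, dom D x -> f x = t x) ->
  (forall x, dom D x -> g x = partial 0 t x) ->
  l2_dot f f <= C * l2_dot g g.
Proof.
have [M M0 HM] := dom_coord_bounded D.
(* With [m] standing for x_0 g, the integration yields [l2_dot f f + 2 * l2_dot m f = 0]. Squaring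
   and Cauchy-Schwarz give |f|^2 <= 4 |m|^2, and |x_0| <= M on the domain. *)
exists (4 * M ^+ 2); first by rewrite mulr_ge0// sqr_ge0.
move=> t f g tt ft gt.
have [m mE mM] : exists2 m : L2 D, (forall x, dom D x -> m x = x 0 0 * g x) &
    l2_dot m m <= M ^+ 2 * l2_dot g g.
  apply: L2_mul; first by apply: measurable_funTS; exact: measurable_coord.
  by apply: aeW => x Dx; exact: HM.
(* The factor [id (1 * x 0 0 + 0)] is the first coordinate in the shape that [Ck_coord] and
   [is_derive_coord] accept. *)
pose Phi (x : E) := id (1 * x 0 0 + 0) * (t x * t x).
have [Ct ct st] := tt.
have cs : closure [set x | Phi x != 0] `<=` closure [set x | t x != 0].
  apply: closureS => x /= h; apply: contra_neq h => tx.
  by rewrite /Phi tx !mulr0.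
have Cc k := @Ck_coord R n k id 1 0 0 (C1k_id k).
have tPhi : test_function D Phi.
  split.
  - move=> k; apply: Ck_mul; [exact: Cc|exact: Ck_mul].
  - by apply: subclosed_compact cs => //; exact: closed_closure.
  - exact: subset_trans cs st.
have dPhi x : partial 0 Phi x = t x * t x + 2 * (x 0 0 * partial 0 t x) * t x.
  have [_ /(_ 0) [dt _]] := Ct 1%N.
  have d1 := @is_derive_coord R n id 1 0 _ 0 0 x (is_derive_id _ _).
  have d2 : is_derive x (delta_mx 0 0) t (partial 0 t x) by exact/derivableP.
  have [_] := is_deriveM d1 (is_deriveM d2 d2); rewrite /partial => ->.
  rewrite /GRing.scale/= -[(t * t) x]/(t x * t x); ring.
have := integral_partial0 tPhi.
have -> : \int[leb]_(x in D) partial 0 Phi x = l2_dot f f + 2 * l2_dot m f.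
  rewrite /l2_dot -RintegralZl//; last exact: L2_integrableM.
  rewrite -RintegralD//; first last.
  - exact: integrableZl (L2_integrableM m f).
  - exact: L2_integrableM.
  by apply: eq_Rintegral => x /set_mem Dx; rewrite dPhi ft// mE// gt// -!mulrA.
move=> h; have := ip_CS (@l2_dot_semi_inner R n D) m f.
have := ip_ge0 (@l2_dot_semi_inner R n D) f.
have := ip_ge0 (@l2_dot_semi_inner R n D) m.
move: (l2_dot f f) (l2_dot m f) (l2_dot m m) (l2_dot g g) mM h => F X Y Z h1 h2 h3 h4 h5.
have [->|F0] := eqVneq F 0.
  by rewrite -mulrA mulr_ge0// (le_trans _ h1).
have Fp : 0 < F by rewrite lt_neqAle eq_sym F0.
rewrite -mulrA; apply: (@le_trans _ _ (4 * Y)); last by rewrite ler_wpM2l.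
rewrite -(ler_pM2r Fp) -mulrA; apply: le_trans (_ : 4 * X ^+ 2 <= _); last by rewrite ler_wpM2l.
have -> : X = - F / 2 by lra.
by rewrite le_eqVlt; apply/orP; left; apply/eqP; field.
Qed.

End poincare.

(** * Divergence and the mixed problem *)

Section product_ip.
Variables (R : realType) (V W : lmodType R).
Variables (ipV : V -> V -> R) (ipW : W -> W -> R).

Definition prod_ip (x y : V * W) : R := ipV x.1 y.1 + ipW x.2 y.2.

Hypotheses (hV : semi_inner ipV) (hW : semi_inner ipW).

Lemma prod_ip_semi_inner : semi_inner prod_ip.
Proof.
split.
- move=> a x y z; rewrite /prod_ip /= (ip_linl hV) (ip_linl hW); ring.
- by move=> x y; rewrite /prod_ip (ipC hV) (ipC hW).
- by move=> x; rewrite addr_ge0// (ip_ge0 hV, ip_ge0 hW).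
Qed.

Lemma prod_ip_complete : ip_complete ipV setT setT -> ip_complete ipW setT setT ->
  ip_complete prod_ip setT setT.
Proof.
move=> cV cW s _ cs.
have leV x : ipV x.1 x.1 <= prod_ip x x by rewrite lerDl (ip_ge0 hW).
have leW x : ipW x.2 x.2 <= prod_ip x x by rewrite lerDr (ip_ge0 hV).
have [||v _ sv] := cV (fun k => (s k).1) => //.
  move=> e /cs[N HN]; exists N => k l Nk Nl.
  exact: le_lt_trans (leV (s k - s l)) (HN k l Nk Nl).
have [||w _ sw] := cW (fun k => (s k).2) => //.
  move=> e /cs[N HN]; exists N => k l Nk Nl.
  exact: le_lt_trans (leW (s k - s l)) (HN k l Nk Nl).
exists (v, w) => // e e0; have e2 : 0 < e / 2 by rewrite divr_gt0.
have [N1 H1] := sv _ e2; have [N2 H2] := sw _ e2.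
exists (maxn N1 N2) => k; rewrite geq_max => /andP[/H1 h1 /H2 h2].
by rewrite /prod_ip /= [X in _ < X](splitr e) ltrD.
Qed.

End product_ip.

Section divergence.
Variables (R : realType) (n : nat) (D : lipschitz_domain R n).
Notation E := 'rV[R]_n.+1.
Notation leb := (lebesgue_rV R n.+1).
Notation L2 := (L2 D).
Notation L2n := (L2n D).
Notation l2 := (@l2_dot R n D).
Notation l2n := (@l2n_dot R n D).
Let hl2 : semi_inner l2 := @l2_dot_semi_inner R n D.
Let hl2n : semi_inner l2n := @l2n_dot_semi_inner R n D.

(** A test function is not itself an element of [L2]; [tau] and [theta] represent it and its
    gradient, so that the weak divergence can be expressed by inner products alone. *)
Definition test_rep (t : E -> R) (tau : L2) (theta : L2n) : Prop :=
  [/\ test_function D t, forall x, dom D x -> tau x = t x &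
      forall i x, dom D x -> theta i x = partial i t x].

Lemma test_rep_ex (t : E -> R) : test_function D t ->
  exists tau theta, test_rep t tau theta.
Proof.
move=> tt; have [tau tauE] := test_L2 tt.
have /choice[theta thetaE] : forall i, exists g : L2, forall x, dom D x -> g x = partial i t x.
  by move=> i; apply: test_L2; exact: test_partial.
by exists tau, [ffun i => theta i]; split=> // i x Dx; rewrite ffunE thetaE.
Qed.

Lemma weak_divP (q : L2n) (d : L2) : weak_div q d <->
  forall t tau theta, test_rep t tau theta -> l2n q theta = - l2 d tau.
Proof.
have e t tau theta : test_rep t tau theta ->
    \int[leb]_(x in D) (\sum_(i < n.+1) q i x * partial i t x) = l2n q theta /\
    \int[leb]_(x in D) (d x * t x) = l2 d tau.
  move=> [tt tauE thetaE]; split; apply: eq_Rintegral => x /set_mem Dx.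
    by apply: eq_bigr => i _; rewrite thetaE.
  by rewrite tauE.
split=> [qd t tau theta r|H t tt].
  by have [<- <-] := e _ _ _ r; apply: qd; case: r.
have [tau [theta r]] := test_rep_ex tt.
by have [-> ->] := e _ _ _ r; exact: H r.
Qed.

Lemma weak_div_linear (a : R) (p q : L2n) (d e : L2) :
  weak_div p d -> weak_div q e -> weak_div (a *: p + q) (a *: d + e).
Proof.
move=> /weak_divP hp /weak_divP hq; apply/weak_divP => t tau theta r.
rewrite (ip_linl hl2n) (ip_linl hl2) (hp _ _ _ r) (hq _ _ _ r); ring.
Qed.

Lemma weak_div_eq (q q' : L2n) (d d' : L2) :
  semi_eq l2n q q' -> semi_eq l2 d d' -> weak_div q d -> weak_div q' d'.
Proof.
move=> qq dd /weak_divP h; apply/weak_divP => t tau theta r.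
by rewrite -(semi_eq_ipl hl2n _ qq) -(semi_eq_ipl hl2 _ dd) (h _ _ _ r).
Qed.

Lemma wdivP (q : L2n) : Hdiv q -> weak_div q (wdiv q).
Proof. by move=> [d qd]; apply: xgetPex; exists d. Qed.

Lemma wdiv_eq (q : L2n) (d : L2) : weak_div q d -> semi_eq l2 (wdiv q) d.
Proof.
by move=> qd; apply: (weak_div_unique _ qd); apply: wdivP; exists d.
Qed.

Lemma Hdiv_linear (a : R) (p q : L2n) : Hdiv p -> Hdiv q -> Hdiv (a *: p + q).
Proof.
by move=> [d pd] [e qe]; exists (a *: d + e); exact: weak_div_linear.
Qed.

Lemma wdiv_linear (a : R) (p q : L2n) : Hdiv p -> Hdiv q ->
  semi_eq l2 (wdiv (a *: p + q)) (a *: wdiv p + wdiv q).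
Proof.
by move=> hp hq; apply: wdiv_eq; apply: weak_div_linear; exact: wdivP.
Qed.

Let V : lmodType R := (L2 * L2n)%type.
Let ipV : V -> V -> R := prod_ip l2 l2n.

Let S0 : set V := [set x | exists t, test_rep t x.1 x.2].

Let S0_submodule : submodule S0.
Proof.
split.
  exists (fun=> 0); split=> [|x _|i x _] //=; first exact: test0.
  rewrite ffunE /partial derive_cst//.
move=> a [u p] [v q] [t [tt uE pE]] [s [ts vE qE]].
exists (fun x => a * t x + s x); split=> [|x Dx|i x Dx] /=.
- exact: test_linear.
- by rewrite -uE// -vE.
- by rewrite (partial_linear i a x tt ts) -pE// -qE// L2n_coordE.
Qed.

(* Riesz representation of [tau |-> \int d tau] in the gradient inner product;
   the degenerate form below only measures gradients. *)
Lemma div_surjective : exists2 C : R, 0 <= C & forall d : L2, exists q : L2n,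
  weak_div q d /\ l2n q q <= C * l2 d d.
Proof.
have [C C0 HC] := poincare D; exists C => // d.
pose ip (x y : V) : R := l2n x.2 y.2.
have hip : semi_inner ip.
  split.
  - by move=> a x y z; rewrite /ip /= (ip_linl hl2n).
  - by move=> x y; rewrite /ip (ipC hl2n).
  - by move=> x; exact: (ip_ge0 hl2n).
have comp : ip_complete ip S0 setT.
  move=> s _ cs; have [] := @l2n_complete R n D (fun k => (s k).2) => //.
  (* The form ignores the first component, so any value may accompany the limit of the gradients.
     The limit need not come from a test function, hence the target set is everything. *)
  by move=> g _ sg; exists (0, g).
have [||u _ [uE uK]] := @riesz_representation _ _ ip hip S0 setT
    (fun x => l2 d x.1) (C * l2 d d) S0_submodule comp.
- by move=> a x y /=; rewrite (ipDr hl2) (ipZr hl2).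
- move=> [tau theta] [t [tt tauE thetaE]] /=; apply: le_trans (ip_CS hl2 _ _) _.
  rewrite mulrAC mulrC ler_wpM2r ?(ip_ge0 hl2)//.
  apply: le_trans (HC t tau (theta 0) tt tauE (thetaE 0)) _.
  rewrite ler_wpM2l// /ip /= l2n_dotE (bigD1 0)//= lerDl sumr_ge0// => i _.
  exact: (ip_ge0 hl2).
exists (- u.2); split.
  apply/weak_divP => t tau theta r; rewrite (ipNl hl2n); congr (- _).
  by apply: (uE (tau, theta)); exists t.
rewrite (ipNl hl2n) (ipNr hl2n) opprK; apply: uK.
by rewrite mulr_ge0// (ip_ge0 hl2).
Qed.

(* The graph of the weak gradient on the closure of the test functions,
   described as the annihilator of the graph of the divergence. *)
Definition grad_graph : set V := [set x |
  forall q d, weak_div q d -> l2 x.1 d = - l2n x.2 q].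

Lemma grad_graph_submodule : submodule grad_graph.
Proof.
split; first by move=> q d _ /=; rewrite (ip0l hl2n) (ip0l hl2) oppr0.
move=> a x y hx hy q d qd /=.
rewrite (ip_linl hl2n) (ip_linl hl2) (hx _ _ qd) (hy _ _ qd); ring.
Qed.

Lemma grad_graph_test t tau theta : test_rep t tau theta -> grad_graph (tau, theta).
Proof.
move=> r q d /weak_divP /(_ _ _ _ r) h /=.
by rewrite (ipC hl2) (ipC hl2n) h opprK.
Qed.

(** An annihilator is closed: each of its defining equations is the vanishing of a continuous
    functional, and the surrounding product space is complete. *)
Lemma grad_graph_complete : ip_complete ipV grad_graph grad_graph.
Proof.
have hV : semi_inner ipV := prod_ip_semi_inner hl2 hl2n.
move=> s Ss cs.
have cV := prod_ip_complete hl2 hl2n (@l2_complete R n D) (@l2n_complete R n D).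
have [u _ su] := cV s (fun=> I) cs.
exists u => // q d qd.
have h x : l2 x.1 d + l2n x.2 q = ipV x (d, q) by [].
apply/eqP; rewrite -subr_eq0 opprK h; apply/negPn/negP => n0.
have p0 : 0 < `|ipV u (d, q)| by rewrite normr_gt0.
have [N HN] := ip_cvg_ip hV (d, q) su p0.
have := HN N (leqnn _); rewrite -[ipV (s N) _]h (Ss N q d qd) addNr sub0r normrN.
by rewrite ltxx.
Qed.

(** By duality with [div_surjective]: for [q] with divergence [v], the square of |v| is -(g, q), and
    |q| is bounded by |v|. Thus the inequality on test functions passes to the annihilator without
    any density argument. *)
Lemma grad_graph_poincare : exists2 C : R, 0 <= C &
  forall x, grad_graph x -> l2 x.1 x.1 <= C * l2n x.2 x.2.
Proof.
have [C C0 HC] := div_surjective; exists C => // -[v g] vg /=.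
have [q [qv qC]] := HC v; have /= e := vg _ _ qv.
have [->|v0] := eqVneq (l2 v v) 0; first by rewrite mulr_ge0// (ip_ge0 hl2n).
have vp : 0 < l2 v v by rewrite lt_neqAle eq_sym v0 (ip_ge0 hl2).
rewrite -(ler_pM2r vp) -expr2 {1}e sqrrN; apply: le_trans (ip_CS hl2n _ _) _.
by rewrite mulrC mulrAC ler_wpM2r ?(ip_ge0 hl2n).
Qed.

End divergence.

(** * Coercive matrices, their inverses and the multiplication operators *)

Section coefficients.
Variables (R : realType) (n : nat) (D : lipschitz_domain R n).
Notation E := 'rV[R]_n.+1.
Notation leb := (lebesgue_rV R n.+1).
Notation l2 := (@l2_dot R n D).
Notation l2n := (@l2n_dot R n D).
Let hl2 : semi_inner l2 := @l2_dot_semi_inner R n D.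
Let hl2n : semi_inner l2n := @l2n_dot_semi_inner R n D.

Lemma ip_sum_le (I : Type) (r : seq I) (f : I -> L2 D) :
  l2 (\sum_(i <- r) f i) (\sum_(i <- r) f i) <=
  2 ^+ size r * \sum_(i <- r) l2 (f i) (f i).
Proof.
elim: r => [|i r IH]; first by rewrite !big_nil (ip0l hl2) mulr0.
rewrite !big_cons; apply: le_trans (ip_sumsqr hl2 _ _) _.
rewrite /= exprS -mulrA ler_pM2l// mulrDr lerD//.
by rewrite ler_peMl ?(ip_ge0 hl2)// exprn_ege1// ler1n.
Qed.

Lemma L2_sumE (I : Type) (r : seq I) (f : I -> L2 D) x :
  (\sum_(i <- r) f i) x = \sum_(i <- r) f i x.
Proof.
elim: r => [|i r IH]; first by rewrite !big_nil.
by rewrite !big_cons -IH.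
Qed.

Lemma eqon_l2n (p q : L2n D) : (forall i x, dom D x -> p i x = q i x) ->
  semi_eq l2n p q.
Proof.
move=> pq; rewrite /semi_eq l2n_dotE big1// => i _.
have := @eqon_semi_eq R n D (p i) (q i) (pq i).
by rewrite /semi_eq; congr (l2 _ _ = _); rewrite !ffunE.
Qed.

Definition bounded_matrix (A : E -> 'M[R]_n.+1) : Prop :=
  forall i j, measurable_fun D (fun x => A x i j) /\
     exists M : R, {ae leb, forall x, dom D x -> `|A x i j| <= M}.

Lemma matrix_mult (A : E -> 'M[R]_n.+1) : bounded_matrix A ->
  exists (T : L2n D -> L2n D) (K : R), 0 <= K /\ forall g,
    (forall i x, dom D x -> T g i x = \sum_j A x i j * g j x) /\
    l2n (T g) (T g) <= K * l2n g g.
Proof.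
move=> bA.
have ex1 (i j : 'I_n.+1) : exists hM : (L2 D -> L2 D) * R, forall g : L2 D,
    (forall x, dom D x -> hM.1 g x = A x i j * g x) /\
    l2 (hM.1 g) (hM.1 g) <= hM.2 ^+ 2 * l2 g g.
  have [mA [M AM]] := bA i j.
  have ex2 (g : L2 D) : exists h : L2 D,
      (forall x, dom D x -> h x = A x i j * g x) /\ l2 h h <= M ^+ 2 * l2 g g.
    by have [h h1 h2] := L2_mul g mA AM; exists h.
  by have [h hP] := choice ex2; exists (h, M).
have ex3 (i : 'I_n.+1) := choice (ex1 i).
pose H i := projT1 (ex3 i).
have HP i : forall j, _ := projT2 (ex3 i).
exists (fun g => [ffun i => \sum_j (H i j).1 (g j)]).
exists (\sum_(i < n.+1) 2 ^+ size (index_enum 'I_n.+1) * \sum_j (H i j).2 ^+ 2).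
split.
  apply: sumr_ge0 => i _; rewrite mulr_ge0 ?exprn_ge0// sumr_ge0// => j _.
  exact: sqr_ge0.
move=> g; split=> [i x Dx|].
  by rewrite ffunE L2_sumE; apply: eq_bigr => j _; rewrite (HP i j (g j)).1.
rewrite l2n_dotE mulr_suml; apply: ler_sum => i _; rewrite ffunE.
apply: le_trans (ip_sum_le _ _) _; rewrite -mulrA ler_wpM2l ?exprn_ge0//.
rewrite mulr_suml; apply: ler_sum => j _; apply: le_trans (HP i j (g j)).2 _.
rewrite ler_wpM2l ?sqr_ge0// l2n_dotE (bigD1 j)//= lerDl sumr_ge0// => k _.
exact: (ip_ge0 hl2).
Qed.

Lemma measurable_inv : measurable_fun [set: R] (fun x : R => x^-1).
Proof.
rewrite -(setUv [set 0 : R]); apply/measurable_funU => //.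
  exact: measurableC.
split; first exact: measurable_fun_set1.
apply: open_continuous_measurable_fun.
  apply: closed_openC; apply: accessible_closed_set1.
  by apply: hausdorff_accessible; exact: norm_hausdorff.
by move=> x /set_mem /eqP x0; exact: inv_continuous.
Qed.

Lemma measurable_det (m : nat) (A : E -> 'M[R]_m) :
  (forall i j, measurable_fun D (fun x => A x i j)) ->
  measurable_fun D (fun x => \det (A x)).
Proof.
move=> mA; rewrite /determinant; apply: measurable_sum => s.
apply: measurable_funM; first exact: measurable_cst.
by apply: measurable_prod => i _; exact: mA.
Qed.

Lemma coercive_unitmx (B : 'M[R]_n.+1) (mu : R) : 0 < mu ->
  (forall xi : 'I_n.+1 -> R,
    mu * (\sum_i xi i ^+ 2) <= \sum_i \sum_j B i j * xi i * xi j) ->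
  B \in unitmx.
Proof.
move=> mu0 H; rewrite -row_free_unit -kermx_eq0; apply/rowV0P => v /sub_kermxP vB.
have := H (fun i => v 0 i); rewrite [X in _ <= X]exchange_big/= [X in _ <= X]big1; last first.
  move=> j _ /=; rewrite -mulr_suml.
  have : (v *m B) 0 j = 0 by rewrite vB mxE.
  by rewrite mxE; under eq_bigr do rewrite mulrC; move=> ->; rewrite mul0r.
rewrite pmulr_rle0// => h.
have /eqP : \sum_i v 0 i ^+ 2 = 0.
  by apply/eqP; rewrite eq_le h sumr_ge0// => i _; exact: sqr_ge0.
rewrite psumr_eq0 => [/allP h'|i _]; last exact: sqr_ge0.
by apply/rowP => i; have := h' i (mem_index_enum _); rewrite mxE sqrf_eq0 => /eqP.
Qed.

(* Apply coercivity to the columns of the inverse. *)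
Lemma coercive_invmx_le (B : 'M[R]_n.+1) (mu : R) i j : 0 < mu ->
  (forall xi : 'I_n.+1 -> R,
    mu * (\sum_i xi i ^+ 2) <= \sum_i \sum_j B i j * xi i * xi j) ->
  `|invmx B i j| <= mu^-1.
Proof.
move=> mu0 H; have uB := coercive_unitmx mu0 H.
pose eta k := invmx B k j; pose N := \sum_k eta k ^+ 2.
have leN k : eta k ^+ 2 <= N.
  by rewrite /N (bigD1 k)//= lerDl sumr_ge0// => l _; exact: sqr_ge0.
have h : mu * N <= eta j.
  apply: le_trans (H eta) _.
  have e k : \sum_l B k l * eta k * eta l = (k == j)%:R * eta k.
    have : (B *m invmx B) k j = (k == j)%:R by rewrite mulmxV// mxE.
    rewrite mxE => <-; rewrite mulr_suml; apply: eq_bigr => l _.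
    by rewrite /eta; ring.
  under eq_bigr do rewrite e.
  rewrite (bigD1 j)//= eqxx mul1r big1 ?addr0// => k /negbTE ->.
  by rewrite mul0r.
have N0 : 0 <= N by apply: le_trans (leN j); exact: sqr_ge0.
have h2 : mu ^+ 2 * N <= 1.
  have [->|Nn0] := eqVneq N 0; first by rewrite mulr0.
  have Np : 0 < N by rewrite lt_neqAle eq_sym Nn0.
  rewrite -(ler_pM2r Np) mul1r; apply: le_trans (leN j).
  rewrite -mulrA -expr2 -exprMn ler_pXn2r ?nnegrE ?mulr_ge0 ?(ltW mu0)//.
  by apply: le_trans h; rewrite mulr_ge0// ltW.
have : `|invmx B i j| ^+ 2 <= mu^-1 ^+ 2.
  rewrite real_normK ?num_real//; apply: le_trans (leN i) _.
  rewrite exprVn -[X in _ <= X]mul1r ler_pdivlMr ?exprn_gt0//.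
  by rewrite mulrC.
by rewrite ler_pXn2r ?nnegrE// invr_ge0 ltW.
Qed.

(** Measurability comes from the cofactor formula for the inverse, the bound from coercivity. *)
Lemma coercive_bounded_inv (A : E -> 'M[R]_n.+1) : coercive_coefficients D A ->
  bounded_matrix (fun x => invmx (A x)).
Proof.
move=> [bA [mu mu0 cA]] i j; split; last first.
  by exists mu^-1; apply: aeW => x Dx; apply: coercive_invmx_le (cA x Dx).
have mdet : measurable_fun D (fun x => \det (A x)).
  by apply: measurable_det => k l; case: (bA k l).
have mcof : measurable_fun D (fun x => cofactor (A x) j i).
  apply: measurable_funM; first exact: measurable_cst.
  apply: measurable_det => k l.
  have [m _] := bA (lift j k) (lift i l); apply: eq_measurable_fun m => x _.
  by rewrite !mxE.
have minv : measurable_fun D (fun x => (\det (A x))^-1).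
  exact: (measurableT_comp measurable_inv mdet).
apply: eq_measurable_fun (measurable_funM minv mcof) => x /set_mem Dx /=.
by rewrite /invmx (coercive_unitmx mu0 (cA x Dx)) !mxE.
Qed.

Lemma coercive_trmx (A : E -> 'M[R]_n.+1) : coercive_coefficients D A ->
  coercive_coefficients D (fun x => (A x)^T).
Proof.
move=> [bA [mu mu0 cA]]; split.
  move=> i j; have [m [M HM]] := bA j i; split.
    by apply: eq_measurable_fun m => x _; rewrite mxE.
  by exists M; apply: filterS HM => x h Dx; rewrite mxE; exact: h.
exists mu => // x Dx xi; apply: le_trans (cA x Dx xi) _.
rewrite exchange_big/= le_eqVlt; apply/orP; left; apply/eqP.
apply: eq_bigr => i _; apply: eq_bigr => j _; rewrite mxE; ring.
Qed.

End coefficients.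

(** * Well-posedness of the mixed problem *)

Section mixed_problem.
Variables (R : realType) (n : nat) (D : lipschitz_domain R n).
Notation E := 'rV[R]_n.+1.
Notation leb := (lebesgue_rV R n.+1).
Notation L2 := (L2 D).
Notation L2n := (L2n D).
Notation l2 := (@l2_dot R n D).
Notation l2n := (@l2n_dot R n D).
Let hl2 : semi_inner l2 := @l2_dot_semi_inner R n D.
Let hl2n : semi_inner l2n := @l2n_dot_semi_inner R n D.

(** A common form of the state equation, where [r1 = 0] and [r2 = - f], and of the adjoint equation,
    where [A] is transposed and both right-hand sides are present. *)
Definition mixed (A : E -> 'M[R]_n.+1) (c : E -> R) (r1 : L2n) (r2 : L2)
    (p : L2n) (v : L2) : Prop :=
  [/\ Hdiv p,
      forall q, Hdiv q -> form_a A p q + form_b q v = l2n r1 q &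
      forall w, form_b p w - form_m c v w = l2 r2 w].

Variables (A : E -> 'M[R]_n.+1) (hA : coercive_coefficients D A).
Variables (c : E -> R) (mc : measurable_fun D c).
Variables (c1 : R) (hc : forall x, dom D x -> 0 <= c x <= c1).

(* [T], [Ti] and [Cm] are the multiplications by [A], [A^-1] and [c], cut off
   outside [D]. *)
Record multipliers (T Ti : L2n -> L2n) (Cm : L2 -> L2) (K mu : R) : Prop := Multipliers {
  mul_K : 0 <= K;
  mul_mu : 0 < mu;
  mul_lin : forall a g h q, l2n (T (a *: g + h)) q = a * l2n (T g) q + l2n (T h) q;
  inv_lin : forall a g h q, l2n (Ti (a *: g + h)) q = a * l2n (Ti g) q + l2n (Ti h) q;
  pot_lin : forall a v w u, l2 (Cm (a *: v + w)) u = a * l2 (Cm v) u + l2 (Cm w) u;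
  mul_le : forall g, l2n (T g) (T g) <= K * l2n g g;
  pot_le : forall v, l2 (Cm v) (Cm v) <= K * l2 v v;
  mul_ge : forall g, mu * l2n g g <= l2n (T g) g;
  pot_ge : forall v, 0 <= l2 (Cm v) v;
  invK : forall g q, l2n (Ti (T g)) q = l2n g q;
  mulK : forall g q, l2n (T (Ti g)) q = l2n g q;
  form_aE : forall p q, form_a A p q = l2n (Ti p) q;
  form_mE : forall v w, form_m c v w = l2 (Cm v) w }.

Lemma l2n_integrable (p q : L2n) :
  leb.-integrable D (EFin \o (fun x => \sum_i p i x * q i x)).
Proof.
have := @integrable_sum _ _ _ leb D (mdom D) _ (index_enum 'I_n.+1) xpredT
  (fun i => EFin \o (fun x => p i x * q i x)) (fun i _ => L2_integrableM (p i) (q i)).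
by apply: eq_integrable => // x _ /=; rewrite sumEFin.
Qed.

Lemma multipliers_ex : exists T Ti Cm K mu, multipliers T Ti Cm K mu.
Proof.
have [bA [mu mu0 cA]] := hA.
have [T [K [K0 HT]]] := matrix_mult bA.
have [Ti [Ki [Ki0 HTi]]] := matrix_mult (coercive_bounded_inv hA).
have ex1 (v : L2) : exists w : L2, (forall x, dom D x -> w x = c x * v x) /\
    l2 w w <= c1 ^+ 2 * l2 v v.
  have [|w w1 w2] := @L2_mul R n D c c1 v mc; last by exists w.
  by apply: aeW => x Dx; have /andP[c0 cc1] := hc Dx; rewrite ger0_norm.
have [Cm HC] := choice ex1.
have TE g i x : dom D x -> T g i x = \sum_j A x i j * g j x := (HT g).1 i x.
have TiE g i x : dom D x -> Ti g i x = \sum_j invmx (A x) i j * g j x := (HTi g).1 i x.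
have CE v x : dom D x -> Cm v x = c x * v x := (HC v).1 x.
have unitA x : dom D x -> A x \in unitmx by move=> Dx; exact: coercive_unitmx (cA x Dx).
have matlin (B : E -> 'M[R]_n.+1) (S : L2n -> L2n) :
    (forall g i x, dom D x -> S g i x = \sum_j B x i j * g j x) ->
    forall a g h q, l2n (S (a *: g + h)) q = a * l2n (S g) q + l2n (S h) q.
  move=> SE a g h q; rewrite -(ip_linl hl2n); apply: (semi_eq_ipl hl2n).
  apply: eqon_l2n => i x Dx; rewrite L2n_coordE L2_coordE !SE// mulr_sumr -big_split/=.
  by apply: eq_bigr => j _; rewrite L2n_coordE L2_coordE; ring.
exists T, Ti, Cm, (K + c1 ^+ 2), mu; split=> //.
- by rewrite addr_ge0// sqr_ge0.
- exact: matlin TE.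
- exact: matlin TiE.
- move=> a v w u; rewrite -(ip_linl hl2); apply: (semi_eq_ipl hl2).
  by apply: eqon_semi_eq => x Dx; rewrite L2_coordE !CE// L2_coordE; ring.
- move=> g; apply: le_trans (HT g).2 _; rewrite ler_wpM2r ?(ip_ge0 hl2n)//.
  by rewrite lerDl sqr_ge0.
- move=> v; apply: le_trans (HC v).2 _; rewrite ler_wpM2r ?(ip_ge0 hl2)//.
  by rewrite lerDr.
- move=> g.
  have -> : mu * l2n g g = \int[leb]_(x in D) (mu * \sum_i g i x ^+ 2).
    rewrite /l2n_dot -RintegralZl//.
    exact: l2n_integrable.
  apply: le_Rintegral => //.
  - have := integrableZl (mdom D) mu (l2n_integrable g g).
    by apply: eq_integrable.
  - exact: l2n_integrable.
  - move=> x Dx; apply: le_trans (cA x Dx (fun i => g i x)) _.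
    rewrite le_eqVlt; apply/orP; left; apply/eqP; apply: eq_bigr => i _.
    rewrite TE// mulr_suml; apply: eq_bigr => j _; ring.
- move=> v; apply: Rintegral_ge0 => x Dx; rewrite CE// -mulrA -expr2.
  by rewrite mulr_ge0 ?sqr_ge0//; have /andP[] := hc Dx.
- move=> g q; apply: (semi_eq_ipl hl2n); apply: eqon_l2n => i x Dx.
  rewrite TiE//; under eq_bigr do rewrite TE//.
  have := congr1 (fun M : 'M[R]_n.+1 => (M *m (\col_j g j x)) i 0) (mulVmx (unitA x Dx)).
  rewrite /= mul1mx -mulmxA [in RHS]mxE [in LHS]mxE => <-; apply: eq_bigr => j _.
  by rewrite !mxE; congr (_ * _); apply: eq_bigr => k _; rewrite mxE.
- move=> g q; apply: (semi_eq_ipl hl2n); apply: eqon_l2n => i x Dx.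
  rewrite TE//; under eq_bigr do rewrite TiE//.
  have := congr1 (fun M : 'M[R]_n.+1 => (M *m (\col_j g j x)) i 0) (mulmxV (unitA x Dx)).
  rewrite /= mul1mx -mulmxA [in RHS]mxE [in LHS]mxE => <-; apply: eq_bigr => j _.
  by rewrite !mxE; congr (_ * _); apply: eq_bigr => k _; rewrite mxE.
- move=> p q; apply: eq_Rintegral => x /set_mem Dx; apply: eq_bigr => i _.
  by rewrite TiE.
- by move=> v w; apply: eq_Rintegral => x /set_mem Dx; rewrite CE.
Qed.

Lemma form_bE (q : L2n) (d v : L2) : weak_div q d -> form_b q v = - l2 v d.
Proof.
move=> qd; rewrite /form_b -/(l2 v (wdiv q)); congr (- _).
exact: (semi_eq_ipr hl2) (wdiv_eq qd).
Qed.

Lemma mixed_linear (a : R) r1 r2 p v r1' r2' p' v' :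
  mixed A c r1 r2 p v -> mixed A c r1' r2' p' v' ->
  mixed A c (a *: r1 + r1') (a *: r2 + r2') (a *: p + p') (a *: v + v').
Proof.
have [T [Ti [Cm [K [mu M]]]]] := multipliers_ex.
move=> [hp m1 m2] [hp' m1' m2']; split.
- exact: Hdiv_linear.
- move=> q hq; rewrite (ip_linl hl2n) -(m1 q hq) -(m1' q hq) !(form_aE M) (inv_lin M).
  rewrite !(form_bE _ (wdivP hq)) (ip_linl hl2); ring.
- move=> w; rewrite (ip_linl hl2) -(m2 w) -(m2' w) !(form_mE M) (pot_lin M).
  rewrite (form_bE _ (weak_div_linear a (wdivP hp) (wdivP hp'))).
  rewrite (form_bE w (wdivP hp)).
  rewrite (form_bE w (wdivP hp')).
  rewrite (ipDr hl2) (ipZr hl2).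
  move: (l2 w _) (l2 w _) (l2 (Cm v) w) (l2 (Cm v') w) => x y z t.
  ring.
Qed.

(** Testing with [p] and [v] gives a(p, p) + m(v, v) = 0. Coercivity of [A], applied to A^-1 p,
    makes A^-1 p and hence [p] null. Then [v] is null by the first equation tested with a field of
    divergence [v], and the divergence of [p] by the second one tested with that divergence. *)
Lemma mixed_kernel p v : mixed A c 0 0 p v -> hdiv_dot p p + l2 v v = 0.
Proof.
have [T [Ti [Cm [K [mu M]]]]] := multipliers_ex.
move=> [hp m1 m2].
have := m1 _ hp; rewrite (ip0l hl2n) (form_aE M).
have := m2 v; rewrite (ip0l hl2) (form_mE M) => /eqP; rewrite subr_eq0 => /eqP ->.
have Tip : l2n (Ti p) p = l2n (T (Ti p)) (Ti p).
  by rewrite (mulK M) (ipC hl2n).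
rewrite Tip => h.
have Ti0 : l2n (Ti p) (Ti p) = 0.
  have := mul_ge M (Ti p); have := pot_ge M v; have := mul_mu M.
  have := ip_ge0 hl2n (Ti p).
  move: (l2n (Ti p) (Ti p)) => x x0 mu0 h1 h2.
  apply/eqP; rewrite eq_le x0 andbT.
  by rewrite -(pmulr_rle0 _ mu0); lra.
have p0 : l2n p p = 0.
  rewrite -(mulK M) (ip_null hl2n)//; apply/eqP; rewrite eq_le (ip_ge0 hl2n) andbT.
  by have := mul_le M (Ti p); rewrite Ti0 mulr0.
have v0 : l2 v v = 0.
  have [C C0 HC] := div_surjective D; have [q [qv _]] := HC v.
  have hq : Hdiv q by exists v.
  have := m1 _ hq; rewrite (ip0l hl2n) (form_aE M) (ip_null hl2n _ Ti0) add0r.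
  by rewrite (form_bE _ qv) => /eqP; rewrite oppr_eq0 => /eqP.
have d0 : l2 (wdiv p) (wdiv p) = 0.
  have := m2 (wdiv p); rewrite (ip0l hl2) (form_mE M) (form_bE _ (wdivP hp)).
  have c0 : l2 (Cm v) (Cm v) = 0.
    apply/eqP; rewrite eq_le (ip_ge0 hl2) andbT.
    by have := pot_le M v; rewrite v0 mulr0.
  rewrite (ip_null hl2 _ c0) subr0.
  by move=> /eqP; rewrite oppr_eq0 => /eqP.
by rewrite /hdiv_dot p0 d0 v0 !addr0.
Qed.

(* With [p = T (r1 - g)], the first equation says that [(v, g)] lies in
   [grad_graph], and the second becomes a coercive problem there. *)
Lemma mixed_exists : exists2 K : R, 0 <= K & forall r1 r2, exists p v,
  mixed A c r1 r2 p v /\ hdiv_dot p p + l2 v v <= K * (l2n r1 r1 + l2 r2 r2).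
Proof.
have [T [Ti [Cm [K [mu M]]]]] := multipliers_ex.
have [C C0 HC] := grad_graph_poincare D.
have K0 := mul_K M; have mu0 := mul_mu M.
pose V : lmodType R := (L2 * L2n)%type.
pose ip : V -> V -> R := prod_ip l2 l2n.
have hip : semi_inner ip := prod_ip_semi_inner hl2 hl2n.
pose B (x y : V) : R := l2n (T x.2) y.2 + l2 (Cm x.1) y.1.
pose S : set V := @grad_graph R n D.
(* On [grad_graph] the Poincare inequality bounds the whole norm |v|^2 + |g|^2 by (C + 1)|g|^2, and
   [mu] is the coercivity constant in [g] alone. *)
pose alpha := mu / (C + 1).
have C1 : 0 < C + 1 by rewrite ltr_wpDl.
have alpha0 : 0 < alpha by rewrite divr_gt0.
pose K1 := alpha ^- 2 * (K + 1).
have K10 : 0 <= K1 by rewrite mulr_ge0// ?invr_ge0 ?exprn_ge0 ?(ltW alpha0)// addr_ge0.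
(* The three summands bound the flux, its divergence and the potential; [K1] is the Lax-Milgram
   bound for [(v, g)]. *)
exists (2 * K * (1 + K1) + 2 * (1 + K * K1) + K1).
  by rewrite !addr_ge0// ?mulr_ge0// ?addr_ge0// mulr_ge0.
move=> r1 r2.
pose F (x : V) : R := ip (- r2, T r1) x.
have [] := @lax_milgram R V ip hip S B F K alpha (l2 r2 r2 + K * l2n r1 r1).
- exact: grad_graph_submodule.
- exact: grad_graph_complete.
- by move=> a x y z; rewrite /B /= (mul_lin M) (pot_lin M); ring.
- by move=> a x y z; rewrite /B /= !(ipDr hl2n, ipDr hl2, ipZr hl2n, ipZr hl2); ring.
- move=> x y; pose z : V := (Cm x.1, T x.2).
  have -> : B x y = ip z y by rewrite /B /ip /prod_ip addrC.
  apply: le_trans (ip_CS hip _ _) _; rewrite ler_wpM2r ?(ip_ge0 hip)//.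
  by rewrite /ip /prod_ip mulrDr lerD// (mul_le M, pot_le M).
- exact: alpha0.
- move=> x Sx; rewrite /alpha mulrAC ler_pdivrMr// /B /ip /prod_ip.
  have := HC x Sx; have := mul_ge M x.2; have := pot_ge M x.1.
  have := ip_ge0 hl2n x.2.
  move: (l2 x.1 x.1) (l2n x.2 x.2) (l2n (T x.2) x.2) (l2 (Cm x.1) x.1) => a b t s h1 h2 h3 h4.
  apply: (@le_trans _ _ (mu * ((C + 1) * b))).
    by rewrite ler_wpM2l ?(ltW mu0)//; lra.
  rewrite mulrCA mulrC ler_wpM2r ?(ltW C1)//; lra.
- by move=> a x y; rewrite /F (ipDr hip) (ipZr hip).
- by rewrite addr_ge0 ?mulr_ge0 ?(ip_ge0 hl2) ?(ip_ge0 hl2n).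
- move=> x _; apply: le_trans (ip_CS hip _ _) _.
  rewrite ler_wpM2r ?(ip_ge0 hip)// /ip /prod_ip /= (ipNl hl2) (ipNr hl2) opprK.
  by rewrite lerD2l (mul_le M).
move=> [v g] Svg [uE uK].
pose p := T (r1 - g).
have TB h q : l2n (T (h - g)) q = l2n (T h) q - l2n (T g) q.
  by rewrite addrC -scaleN1r (mul_lin M) mulN1r addrC.
(* The variational equation, tested only with pairs that represent test functions, is exactly the
   statement that [p] has this weak divergence. *)
have pd : weak_div p (- (r2 + Cm v)).
  apply/weak_divP => t tau theta r.
  have /= := uE _ (grad_graph_test r); rewrite /B /F /ip /prod_ip /= (ipNl hl2) => e.
  rewrite TB (ipNl hl2) (ipDl hl2); lra.
have hp : Hdiv p by eexists; exact: pd.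
exists p, v; split; first split.
- exact: hp.
- move=> q hq; rewrite (form_aE M) (invK M) (form_bE _ (wdivP hq)).
  by have /= -> := Svg _ _ (wdivP hq); rewrite (ipBl hl2n); ring.
- move=> w; rewrite (form_bE _ pd) (form_mE M) (ipNr hl2) (ipDr hl2).
  rewrite (ipC hl2 w r2) (ipC hl2 w (Cm v)); ring.
have uK' : l2 v v + l2n g g <= K1 * (l2n r1 r1 + l2 r2 r2).
  have : ip (v, g) (v, g) <= alpha ^- 2 * (l2 r2 r2 + K * l2n r1 r1).
    by rewrite -ler_pdivrMl ?invr_gt0 ?exprn_gt0// invrK.
  move=> h; apply: le_trans h _; rewrite /K1 -mulrA ler_wpM2l//.
    by rewrite invr_ge0 exprn_ge0 ?(ltW alpha0).
  have := ip_ge0 hl2n r1; have := ip_ge0 hl2 r2.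
  move: (l2n r1 r1) (l2 r2 r2) => a b a0 b0; nra.
have p1 : l2n p p <= K * (2 * (l2n r1 r1 + l2n g g)).
  apply: le_trans (mul_le M _) _; rewrite ler_wpM2l//.
  exact: (ip_diffsqr hl2n).
have d1 : l2 (wdiv p) (wdiv p) <= 2 * (l2 r2 r2 + K * l2 v v).
  have e := wdiv_eq pd; rewrite (semi_eq_ipl hl2 _ e) (semi_eq_ipr hl2 _ e).
  rewrite (ipNl hl2) (ipNr hl2) opprK; apply: le_trans (ip_sumsqr hl2 _ _) _.
  by rewrite ler_pM2l// lerD2l (pot_le M).
rewrite /hdiv_dot; have := ip_ge0 hl2n r1; have := ip_ge0 hl2 r2.
have := ip_ge0 hl2n g; have := ip_ge0 hl2 v; move: uK' p1 d1.
move: (l2n p p) (l2 (wdiv p) (wdiv p)) (l2 v v) (l2n g g) (l2n r1 r1) (l2 r2 r2).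
move=> P W vv gg a b h1 h2 h3 v0 g0 b0 a0.
have h4 : vv <= K1 * (a + b) by lra.
have h5 : gg <= K1 * (a + b) by lra.
have h6 := ler_wpM2l K0 h4; have h7 := ler_wpM2l K0 h5.
have h8 : 0 <= K * b by rewrite mulr_ge0.
rewrite !mulrDr in h1 h2 h3 h4 h5 h6 h7 *; rewrite !mulrDl; lra.
Qed.

Lemma mixed_unique r1 r2 p v p' v' : mixed A c r1 r2 p v -> mixed A c r1 r2 p' v' ->
  [/\ semi_eq l2n p p', semi_eq l2 v v' & hdiv_dot (p - p') (p - p') = 0].
Proof.
move=> m m'; have := mixed_linear (-1) m' m.
rewrite !scaleN1r ![- _ + _]addrC !subrr => /mixed_kernel.
have := ip_ge0 hl2n (p - p'); have := ip_ge0 hl2 (v - v').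
have := ip_ge0 hl2 (wdiv (p - p')).
rewrite /semi_eq /hdiv_dot => h1 h2 h3 h4; split; lra.
Qed.

End mixed_problem.

(** * Random elements of Hilbert spaces *)

Section hilbert_space.
Variables (R : realType) (H : hilbert R).

Lemma hdot_semi_inner : semi_inner (@hdot R H).
Proof.
split.
- by move=> a x y z; rewrite linearDl linearZl_LR.
- by move=> x y; rewrite hermC expr0 mul1r.
- by move=> x; rewrite -hnormE sqr_ge0.
Qed.

Lemma hdot_eq0 (x : H) : hdot x x = 0 -> x = 0.
Proof. by rewrite -hnormE => /eqP; rewrite sqrf_eq0 normr_eq0 => /eqP. Qed.

Lemma semi_eq_hdot (x y : H) : semi_eq hdot x y -> x = y.
Proof. by move=> /hdot_eq0/eqP; rewrite subr_eq0 => /eqP. Qed.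

Lemma hdot_inj (x y : H) : (forall u, hdot x u = hdot y u) -> x = y.
Proof.
move=> xy; apply: semi_eq_hdot.
by rewrite /semi_eq (ipBl hdot_semi_inner) xy subrr.
Qed.

Lemma hdot_norm (x u : H) : `|hdot x u| <= `|x| * `|u|.
Proof.
rewrite -(@ler_pXn2r _ 2)// ?nnegrE ?mulr_ge0//.
rewrite real_normK ?num_real// exprMn !hnormE.
exact: (ip_CS hdot_semi_inner).
Qed.

(** [transpose] constrains [Ct] on continuous linear functionals only, so this is needed before it
    can be applied to [riesz u]. *)
Lemma riesz_dual (u : H) : dual (riesz u).
Proof.
split.
  by move=> a x y; rewrite /riesz linearDl linearZl_LR.
move=> x; apply/cvgrPdist_lt => e e0; near=> y.
rewrite /riesz -(ipBl hdot_semi_inner); apply: le_lt_trans (hdot_norm _ _) _.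
have u1 : 0 < `|u| + 1 by rewrite ltr_wpDl.
apply: (@le_lt_trans _ _ (`|x - y| * (`|u| + 1))).
  by rewrite ler_wpM2l// lerDl.
rewrite -ltr_pdivlMr//; near: y.
by apply: (@cvgr_dist_lt _ _ _ _ _ id x _) => //; rewrite divr_gt0.
Unshelve. all: by end_near. Qed.

End hilbert_space.

Section simple_random.
Variables (R : realType) (d : measure_display) (Omega : measurableType d).
Variable P : probability Omega R.

Lemma simple_preimage (V : Type) (s : Omega -> V) (A : set V) :
  simple_rv s -> measurable (s @^-1` A).
Proof.
move=> [fs ms].
have -> : s @^-1` A = \bigcup_(v in range s `&` A) (s @^-1` [set v]).
  apply/seteqP; split=> [w Aw|w [v [_ Av] /= sw]]; last by rewrite sw.
  by exists (s w) => //; split=> //; exists w.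
apply: fin_bigcup_measurable => // ; exact: finite_setIl.
Qed.

Lemma simple_comp (V W : Type) (s : Omega -> V) (h : V -> W) :
  simple_rv s -> simple_rv (h \o s).
Proof.
move=> hs; split; last first.
  by move=> w; rewrite comp_preimage; exact: simple_preimage.
have -> : range (h \o s) = h @` range s by rewrite image_comp.
by apply: finite_image; case: hs.
Qed.

Lemma simple_pair (V W : Type) (s : Omega -> V) (t : Omega -> W) :
  simple_rv s -> simple_rv t -> simple_rv (fun w => (s w, t w)).
Proof.
move=> [fs ms] [ft mt]; split.
  apply: (@sub_finite_set _ _ (range s `*` range t)).
    by move=> _ [w _ <-]; split; exists w.
  exact: finite_setX.
move=> [v u]; rewrite (_ : _ @^-1` _ = (s @^-1` [set v]) `&` (t @^-1` [set u])).
  exact: measurableI.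
by apply/seteqP; split=> [w [<- <-]//|w [/= -> ->]].
Qed.

Lemma simple_measurable (s : Omega -> R) : simple_rv s -> measurable_fun setT s.
Proof. by move=> hs _ A mA; rewrite setTI; exact: simple_preimage. Qed.

Definition strongly_measurable (H : hilbert R) (X : Omega -> H) : Prop :=
  exists s : nat -> Omega -> H, (forall k, simple_rv (s k)) /\
    forall w, `|s k w - X w| @[k --> \oo] --> (0 : R).

Lemma sqr_cvg0 (u : nat -> R) : (u k) ^+ 2 @[k --> \oo] --> (0 : R) ->
  u k @[k --> \oo] --> (0 : R).
Proof.
move=> h; apply/cvgrPdist_lt => e e0.
have e2 : 0 < e ^+ 2 by rewrite exprn_gt0.
have /cvgrPdist_lt /(_ _ e2) := h; apply: filterS => k.
rewrite !sub0r !normrN normrX ltr_pXn2r ?nnegrE// ltW//.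
Qed.

Lemma L2_rv_strongly (H : hilbert R) (X : Omega -> H) :
  L2_rv P setT hdot X -> strongly_measurable X.
Proof.
move=> [_ [s [ss sX]] _]; exists s; split=> [k|w]; first by case: (ss k).
by apply: sqr_cvg0; under eq_fun do rewrite hnormE; exact: sX.
Qed.

Lemma strongly_measurable_comp (H : hilbert R) (X : Omega -> H) (phi : H -> R) (K : R) :
  strongly_measurable X -> (forall x y, `|phi x - phi y| <= K * `|x - y|) ->
  measurable_fun setT (fun w => phi (X w)).
Proof.
move=> [s [ss sX]] hphi.
apply: (@measurable_fun_cvg _ _ _ _ (fun k w => phi (s k w))).
  by move=> k; apply: simple_measurable; exact: (simple_comp phi (ss k)).
move=> w _; apply/cvgrPdist_le => e e0.
have K1 : 0 < `|K| + 1 by rewrite ltr_wpDl.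
have /cvgrPdist_lt /(_ (e / (`|K| + 1))) := sX w.
rewrite divr_gt0// => /(_ isT); apply: filterS => k.
rewrite sub0r normrN normr_id ltr_pdivlMr// => h.
rewrite distrC; apply: le_trans (hphi _ _) _; apply: le_trans (ltW h).
by rewrite mulrC ler_wpM2l// (le_trans (ler_norm K))// lerDl.
Qed.

Lemma measurable_hdot (H : hilbert R) (X : Omega -> H) (u : H) :
  strongly_measurable X -> measurable_fun setT (fun w => hdot (X w) u).
Proof.
move=> mX; apply: (@strongly_measurable_comp H X (fun x => hdot x u) `|u|) => // x y.
by rewrite -(ipBl (@hdot_semi_inner R H)) mulrC hdot_norm.
Qed.

Lemma measurable_hnorm (H : hilbert R) (X : Omega -> H) :
  strongly_measurable X -> measurable_fun setT (fun w => `|X w|).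
Proof.
move=> mX; apply: (@strongly_measurable_comp H X (fun x => `|x|) 1) => // x y.
by rewrite mul1r; exact: ler_dist_dist.
Qed.

Lemma strongly_measurable_sub (H : hilbert R) (X s : Omega -> H) :
  strongly_measurable X -> simple_rv s -> strongly_measurable (fun w => X w - s w).
Proof.
move=> [t [tt tX]] hs; exists (fun k w => t k w - s w); split.
  by move=> k; exact: (simple_comp (fun xy : H * H => xy.1 - xy.2) (simple_pair (tt k) hs)).
move=> w; under eq_fun do rewrite opprB addrA subrK.
exact: tX.
Qed.

Definition sqint (f : Omega -> R) : Prop :=
  measurable_fun setT f /\ (\int[P]_w (f w ^+ 2)%:E < +oo)%E.

Lemma sqint_mul (f g : Omega -> R) : sqint f -> sqint g ->
  P.-integrable setT (EFin \o (fun w => f w * g w)).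
Proof.
move=> [mf If] [mg Ig].
have i2 (h : Omega -> R) : measurable_fun setT h -> (\int[P]_w (h w ^+ 2)%:E < +oo)%E ->
    P.-integrable setT (EFin \o (fun w => h w ^+ 2)).
  move=> mh Ih; apply/integrableP; split.
    by apply/measurable_EFinP; exact: measurable_funX.
  by under eq_integral do rewrite /= ger0_norm ?sqr_ge0//.
apply: (@le_integrable _ _ _ P _ measurableT _
  (EFin \o (fun w => f w ^+ 2 + g w ^+ 2))).
- by apply/measurable_EFinP; exact: measurable_funM.
- move=> w _ /=; rewrite lee_fin normrM [leRHS]ger0_norm ?addr_ge0 ?sqr_ge0//.
  rewrite -[f w ^+ 2]real_normK ?num_real// -[g w ^+ 2]real_normK ?num_real//.
  have := sqr_ge0 (`|f w| - `|g w|); have := normr_ge0 (f w); have := normr_ge0 (g w).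
  by move: `|f w| `|g w| => a b; nra.
- exact: (integrableD measurableT (i2 f mf If) (i2 g mg Ig)).
Qed.

Lemma sqint_cst (a : R) : sqint (fun=> a).
Proof.
split; first exact: measurable_cst.
rewrite integral_cst//; apply: lte_mul_pinfty => //; first by rewrite lee_fin sqr_ge0.
by apply: le_lt_trans (probability_le1 P measurableT) (ltry _).
Qed.

Lemma sqint_int (f : Omega -> R) : sqint f -> P.-integrable setT (EFin \o f).
Proof.
move=> hf; apply: eq_integrable (sqint_mul hf (sqint_cst 1)) => // w _ /=.
by rewrite mulr1.
Qed.

Lemma sqint_hdot (H : hilbert R) (X : Omega -> H) (u : H) :
  L2_rv P setT hdot X -> sqint (fun w => hdot (X w) u).
Proof.
move=> hX; have sX := L2_rv_strongly hX; split; first exact: measurable_hdot.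
have [_ _ foo] := hX.
have mX : measurable_fun setT (fun w => (hdot (X w) (X w))%:E : \bar R).
  apply/measurable_EFinP; under eq_fun do rewrite -hnormE.
  by apply: measurable_funX; exact: measurable_hnorm.
apply: (@le_lt_trans _ _ (\int[P]_w ((hdot u u)%:E * (hdot (X w) (X w))%:E))%E).
  apply: ge0_le_integral => //.
  - by move=> w _; rewrite lee_fin sqr_ge0.
  - apply/measurable_EFinP; apply: measurable_funX; exact: measurable_hdot.
  - by apply: emeasurable_funM.
  - by move=> w _; rewrite -EFinM lee_fin mulrC; exact: (ip_CS (@hdot_semi_inner R H)).
rewrite ge0_integralZl//.
- by apply: lte_mul_pinfty => //; rewrite lee_fin (ip_ge0 (@hdot_semi_inner R H)).
- by move=> w _; rewrite lee_fin (ip_ge0 (@hdot_semi_inner R H)).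
- by rewrite lee_fin (ip_ge0 (@hdot_semi_inner R H)).
Qed.

Lemma simple_integral (H : hilbert R) (s : Omega -> H) (u : H) : simple_rv s ->
  P.-integrable setT (EFin \o (fun w => hdot (s w) u)) /\
  (\int[P]_w (hdot (s w) u)%:E = (hdot (simple_mean P s) u)%:E)%E.
Proof.
move=> [fs ms].
have e w : (hdot (s w) u)%:E = (\sum_(v <- finmap.enum_fset (fset_set (range s)))
    (hdot v u)%:E * (\1_(s @^-1` [set v]) w)%:E)%E.
  rewrite (bigD1_seq (s w)) ?finmap.fset_uniq//=; last first.
    by rewrite in_fset_set//; apply/mem_set; exists w.
  rewrite indicE mem_set//= mule1 big1 ?adde0// => v vs.
  by rewrite indicE memNset ?mule0//= => /eqP; rewrite eq_sym (negbTE vs).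
have ii v : P.-integrable setT (fun w => (hdot v u)%:E * (\1_(s @^-1` [set v]) w)%:E)%E.
  by apply: integrableZl => //; exact: integrable_indic.
split.
  have := integrable_sum measurableT (finmap.enum_fset (fset_set (range s))) (P := xpredT) (fun v _ => ii v).
  by apply: eq_integrable => // w _ /=; rewrite e.
under eq_integral do rewrite e.
rewrite integral_sum// /simple_mean fsbig_finite//=.
have -> : hdot (\sum_(v <- finmap.enum_fset (fset_set (range s))) fine (P (s @^-1` [set v])) *: v) u =
    \sum_(v <- finmap.enum_fset (fset_set (range s))) fine (P (s @^-1` [set v])) * hdot v u.
  elim/big_ind2: _ => [|x1 x2 y1 y2 <- <-|v _].
  - by rewrite (ip0l (@hdot_semi_inner R H)).
  - by rewrite (ipDl (@hdot_semi_inner R H)).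
  - by rewrite (ipZl (@hdot_semi_inner R H)).
rewrite -sumEFin; apply: eq_bigr => v _.
rewrite integralZl//; last exact: integrable_indic.
rewrite integral_indic// setIT mulrC EFinM fineK//.
by rewrite fin_num_measure.
Qed.

End simple_random.

(** * Weighted forms of positive selfadjoint operators *)

Section positive_operators.
Variables (R : realType) (V : lmodType R) (ip : V -> V -> R).
Hypothesis hip : semi_inner ip.
Variables (Q Qi : V -> V) (hQ : positive_selfadjoint ip Q Qi).

Definition op_form (x y : V) : R := ip (Q x) y.

Lemma op_form_semi_inner : semi_inner op_form.
Proof.
have [[Ql _] Qs Qp _ _] := hQ.
split.
- by move=> a x y z; rewrite /op_form (semi_eq_ipl hip _ (Ql a x y)) (ip_linl hip).
- by move=> x y; rewrite /op_form Qs (ipC hip).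
- move=> x; have [x0|/Qp/ltW//] := pselect (semi_eq ip x 0).
  by rewrite /op_form (semi_eq_ipr hip _ x0) (ip0r hip).
Qed.

Lemma op_invr x y : ip (Q (Qi x)) y = ip x y.
Proof. by have [_ _ _ _ /(_ x)[h _]] := hQ; exact: (semi_eq_ipl hip _ h). Qed.

Lemma op_invl x y : ip (Qi (Q x)) y = ip x y.
Proof. by have [_ _ _ _ /(_ x)[_ h]] := hQ; exact: (semi_eq_ipl hip _ h). Qed.

Lemma op_inv_sym x y : ip (Qi x) y = ip x (Qi y).
Proof.
have [_ Qs _ _ _] := hQ.
by rewrite -[RHS]op_invr Qs [in RHS](ipC hip) op_invr (ipC hip).
Qed.

(** Cauchy-Schwarz for the weighted form at [x] and [Qi y]. It bounds a linear functional on the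
    ellipsoid of [Q] by the dual form of [Qi], which is how the noise enters the worst case
    error. *)
Lemma op_inv_CS x y : ip x y ^+ 2 <= op_form x x * ip (Qi y) y.
Proof.
have [_ Qs _ _ _] := hQ.
have -> : ip x y = op_form x (Qi y) by rewrite /op_form Qs [RHS](ipC hip) op_invr (ipC hip).
apply: le_trans (ip_CS op_form_semi_inner _ _) _.
by rewrite /op_form op_invr (ipC hip y).
Qed.

Lemma op_bounded : exists2 K, 0 <= K & forall x, ip (Q x) (Q x) <= K * ip x x.
Proof.
have [[_ [K HK]] _ _ _ _] := hQ; exists `|K| => // x; apply: le_trans (HK x) _.
by rewrite ler_wpM2r ?(ip_ge0 hip)// ler_norm.
Qed.

(** Strict positivity alone gives no uniform lower bound; the bounded inverse does. It bounds |x| by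
    |Q x|, and Cauchy-Schwarz for the weighted form at [x] and [Q x] bounds |Q x|^2 by a multiple of
    [op_form x x]. *)
Lemma op_form_coercive : exists2 a : R, 0 < a & forall x, a * ip x x <= op_form x x.
Proof.
have [_ _ _ [_ [K HK]] _] := hQ.
have K1 : 0 < `|K| + 1 by rewrite ltr_wpDl.
have [KK KK0 HKK] := op_bounded.
exists ((`|K| + 1) * (KK + 1))^-1; first by rewrite invr_gt0 mulr_gt0// ltr_wpDl.
move=> x; rewrite ler_pdivrMl ?mulr_gt0 ?ltr_wpDl//.
have h1 : ip x x <= (`|K| + 1) * ip (Q x) (Q x).
  have -> : ip x x = ip (Qi (Q x)) (Qi (Q x)) by rewrite op_invl (ipC hip) op_invl.
  apply: le_trans (HK _) _; rewrite ler_wpM2r ?(ip_ge0 hip)//.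
  by apply: le_trans (ler_norm _) _; rewrite lerDl.
have h2 : ip (Q x) (Q x) <= (KK + 1) * op_form x x.
  have h3 := ip_CS op_form_semi_inner x (Q x).
  have h4 : op_form (Q x) (Q x) ^+ 2 <= KK * ip (Q x) (Q x) ^+ 2.
    apply: le_trans (ip_CS hip _ _) _.
    by rewrite [ip (Q x) (Q x) ^+ 2]expr2 mulrA ler_wpM2r ?(ip_ge0 hip).
  have h5 : op_form x (Q x) = ip (Q x) (Q x) by [].
  rewrite h5 in h3.
  have := ip_ge0 op_form_semi_inner x; have := ip_ge0 op_form_semi_inner (Q x).
  have := ip_ge0 hip (Q x); move: h3 h4.
  move: (ip (Q x) (Q x)) (op_form (Q x) (Q x)) (op_form x x) => q t s h3 h4 q0 t0 s0.
  (* [KK + 1] stands in for the square root of [KK], which it exceeds. *)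
  have h6 : t <= (KK + 1) * q.
    rewrite -(@ler_pXn2r _ 2) ?nnegrE ?mulr_ge0 ?addr_ge0// exprMn.
    apply: le_trans h4 _; rewrite ler_wpM2r ?sqr_ge0//; nra.
  have [->|qn0] := eqVneq q 0; first by rewrite mulr_ge0// addr_ge0.
  have qp : 0 < q by rewrite lt_neqAle eq_sym qn0.
  rewrite -(ler_pM2r qp) -expr2; apply: le_trans h3 _.
  by rewrite mulrAC mulrC ler_wpM2r.
apply: le_trans h1 _; rewrite -mulrA ler_wpM2l// ltW//.
Qed.

End positive_operators.

Section noise.
Variables (R : realType) (d : measure_display) (Omega : measurableType d).
Variable P : probability Omega R.

(** The Bochner mean is given only through simple approximations. For these the scalar identity is
    [simple_integral], and replacing [X] by an approximation costs at most |u| times the error in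
    mean norm. *)
Lemma bochner_mean_hdot (H : hilbert R) (X : Omega -> H) (m u : H) :
  strongly_measurable X -> P.-integrable setT (EFin \o (fun w => hdot (X w) u)) ->
  bochner_mean P X m -> (\int[P]_w (hdot (X w) u)%:E = (hdot m u)%:E)%E.
Proof.
move=> mX iX [s [ss sX sm]]; set I := (\int[P]_w (hdot (X w) u)%:E)%E.
have If : I \is a fin_num by exact: integrable_fin_num.
rewrite -(fineK If); congr EFin; apply/eqP; rewrite -subr_eq0 -normr_le0.
apply/ler_addgt0Pl => e e0; rewrite addr0.
pose e' := e / (2 * (`|u| + 1)).
have u1 : 0 < 2 * (`|u| + 1) by rewrite mulr_gt0// ltr_wpDl.
have e'0 : 0 < e' by rewrite divr_gt0.
have h1 : \forall k \near \oo, (\int[P]_w (`|X w - s k w|)%:E < e'%:E)%E.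
  have /= := sX [set x | (x < e'%:E)%E]; apply.
  by apply: open_nbhs_nbhs; split => //=; apply: open_ereal_lt_ereal.
have h2 : \forall k \near \oo, `|m - simple_mean P (s k)| < e'.
  by move/cvgrPdist_lt: sm => /(_ _ e'0).
have [k [hk1 hk2]] := filter_ex (filterI h1 h2).
have [isk Isk] := simple_integral P u (ss k).
have hk3 : `|fine I - hdot (simple_mean P (s k)) u| <= `|u| * e'.
  have iB := integrableB measurableT iX isk.
  rewrite -lee_fin.
  have -> : (`|fine I - hdot (simple_mean P (s k)) u|)%:E =
      `| \int[P]_w ((hdot (X w) u)%:E - (hdot (s k w) u)%:E) |%E.
    by rewrite integralB// -/I Isk -(fineK If).
  apply: le_trans (le_abse_integral _ _ _) _ => //; first by case/integrableP: iB.
  apply: (@le_trans _ _ (\int[P]_w (`|u|%:E * (`|X w - s k w|)%:E))%E).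
    apply: ge0_le_integral => //.
    - by apply: measurableT_comp => //; case/integrableP: iB.
    - apply: emeasurable_funM => //; apply/measurable_EFinP.
      exact/measurable_hnorm/strongly_measurable_sub.
    - move=> w _; rewrite -EFinB -EFinM /= lee_fin -(ipBl (@hdot_semi_inner R H)) mulrC.
      exact: hdot_norm.
  rewrite ge0_integralZl//; last first.
    by apply/measurable_EFinP; exact/measurable_hnorm/strongly_measurable_sub.
  by rewrite EFinM lee_wpmul2l// ltW.
have hk4 : `|hdot (simple_mean P (s k)) u - hdot m u| <= `|u| * e'.
  rewrite distrC -(ipBl (@hdot_semi_inner R H)) mulrC; apply: le_trans (hdot_norm _ _) _.
  by rewrite ler_wpM2r// ltW.
apply: le_trans (ler_distD (hdot (simple_mean P (s k)) u) _ _) _.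
apply: le_trans (lerD hk3 hk4) _.
rewrite -mulrDr /e' -mulr2n -[X in _ * X]mulr_natr mulrCA -mulrA.
rewrite -[leRHS]mulr1 ler_wpM2l ?(ltW e0)//.
rewrite mulrC ler_pdivrMr// mul1r; lra.
Qed.

Lemma measurable_quadratic (H : hilbert R) (Q Qi : H -> H) (X : Omega -> H) :
  positive_selfadjoint hdot Q Qi -> strongly_measurable X ->
  measurable_fun setT (fun w => hdot (Q (X w)) (X w)).
Proof.
move=> hQ [s [ss sX]]; have hH := @hdot_semi_inner R H.
have hF := op_form_semi_inner hH hQ.
have [K K0 HK] := op_bounded hH hQ.
apply: (@measurable_fun_cvg _ _ _ _ (fun k w => hdot (Q (s k w)) (s k w))).
  by move=> k; apply: simple_measurable; exact: (simple_comp (fun x => hdot (Q x) x) (ss k)).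
move=> w _; set x := X w.
have DD y z : op_form hdot Q (y + z) (y + z) =
    op_form hdot Q y y + (2 * op_form hdot Q y z + op_form hdot Q z z).
  by rewrite (ipDl hF) !(ipDr hF) (ipC hF z y); ring.
pose h k := s k w - x.
have e k : hdot (Q (s k w)) (s k w) = hdot (Q x) x + (2 * op_form hdot Q x (h k) + op_form hdot Q (h k) (h k)).
  have -> : s k w = x + h k by rewrite /h addrC subrK.
  exact: DD.
under eq_fun do rewrite e.
suff g0 : (2 * op_form hdot Q x (h k) + op_form hdot Q (h k) (h k))
    @[k --> \oo] --> (0 : R).
  have := cvgD (cvg_cst (hdot (Q x) x)) g0; rewrite addr0; exact.
have h0 : `|h k| @[k --> \oo] --> (0 : R) by exact: sX.
have b1 : (2 * `|Q x| * `|h k| + (K + 1) * (`|h k| * `|h k|)) @[k --> \oo] --> (0 : R).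
  have := cvgD (cvgM (cvg_cst (2 * `|Q x|)) h0) (cvgM (cvg_cst (K + 1)) (cvgM h0 h0)).
  by rewrite !mulr0 addr0; apply.
apply/norm_cvg0P; apply: (@squeeze_cvgr _ _ _ _ (fun=> 0)
  (fun k => 2 * `|Q x| * `|h k| + (K + 1) * (`|h k| * `|h k|))); last 2 first.
- exact: cvg_cst.
- exact: b1.
apply: nearW => k; rewrite normr_ge0/=; apply: le_trans (ler_normD _ _) _.
rewrite lerD//.
  by rewrite normrM ger0_norm// -mulrA ler_pM2l//; exact: hdot_norm.
apply: le_trans (hdot_norm _ _) _; rewrite mulrA ler_wpM2r//.
rewrite -(@ler_pXn2r _ 2) ?nnegrE ?mulr_ge0 ?addr_ge0//.
rewrite exprMn !hnormE; apply: le_trans (HK _) _.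
rewrite ler_wpM2r ?(ip_ge0 hH)//; nra.
Qed.

(** The pointwise inequality [op_inv_CS], integrated; the second moment constraint then bounds the
    factor that depends on the noise by 1. *)
Lemma noise_variance_le (H : hilbert R) (Q Qi : H -> H) (X : Omega -> H) (u : H) :
  positive_selfadjoint hdot Q Qi -> L2_rv P setT hdot X ->
  ('E_P[(fun w => hdot (Q (X w)) (X w))] <= 1)%E ->
  (\int[P]_w (hdot (X w) u ^+ 2)%:E <= (hdot (Qi u) u)%:E)%E.
Proof.
move=> hQ hX; rewrite unlock => hE.
have hH := @hdot_semi_inner R H; have hF := op_form_semi_inner hH hQ.
have mX := L2_rv_strongly hX.
have mQ := measurable_quadratic hQ mX.
have Qi0 : 0 <= hdot (Qi u) u.
  by rewrite (ipC hH) -(op_invr hH hQ u (Qi u)); exact: (ip_ge0 hF (Qi u)).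
apply: (@le_trans _ _ (\int[P]_w ((hdot (Qi u) u)%:E * (hdot (Q (X w)) (X w))%:E))%E).
  apply: ge0_le_integral => //.
  - by move=> w _; rewrite lee_fin sqr_ge0.
  - by apply/measurable_EFinP; apply: measurable_funX; exact: measurable_hdot.
  - by apply: emeasurable_funM => //; apply/measurable_EFinP.
  - by move=> w _; rewrite -EFinM lee_fin mulrC; exact: (op_inv_CS hH hQ).
rewrite ge0_integralZl//.
- by rewrite -[leRHS]mule1 lee_wpmul2l.
- by apply/measurable_EFinP.
- by move=> w _; rewrite lee_fin; exact: (ip_ge0 hF).
Qed.

Lemma noise_expectation (H1 H2 : hilbert R) (X1 : Omega -> H1) (X2 : Omega -> H2)
    (u1 : H1) (u2 : H2) (a : R) :
  L2_rv P setT hdot X1 -> L2_rv P setT hdot X2 ->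
  bochner_mean P X1 0 -> bochner_mean P X2 0 ->
  ('E_P[(fun w => hdot (X1 w) u1 * hdot (X2 w) u2)%R] = 0)%E ->
  ('E_P[(fun w => `|a - hdot (X1 w) u1 - hdot (X2 w) u2| ^+ 2)%R] =
    (a ^+ 2)%:E + (\int[P]_w (hdot (X1 w) u1 ^+ 2)%:E +
     \int[P]_w (hdot (X2 w) u2 ^+ 2)%:E))%E.
Proof.
move=> h1 h2 b1 b2; rewrite unlock => cov.
have s1 := sqint_hdot u1 h1; have s2 := sqint_hdot u2 h2.
have m1 := bochner_mean_hdot (L2_rv_strongly h1) (sqint_int s1) b1.
have m2 := bochner_mean_hdot (L2_rv_strongly h2) (sqint_int s2) b2.
rewrite (ip0l (@hdot_semi_inner R H1)) in m1.
rewrite (ip0l (@hdot_semi_inner R H2)) in m2.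
move: s1 s2 m1 m2 cov.
set x1 := (fun w => hdot (X1 w) u1); set x2 := (fun w => hdot (X2 w) u2).
move=> s1 s2 m1 m2 cov.
have i1 := sqint_int s1; have i2 := sqint_int s2.
have i11 := sqint_mul s1 s1; have i22 := sqint_mul s2 s2; have i12 := sqint_mul s1 s2.
have R1 : \int[P]_w x1 w = 0 by rewrite /Rintegral m1.
have R2 : \int[P]_w x2 w = 0 by rewrite /Rintegral m2.
have R12 : \int[P]_w (x1 w * x2 w) = 0 by rewrite /Rintegral cov.
have ic : P.-integrable setT (EFin \o (fun=> a ^+ 2)) by exact: sqint_int (sqint_cst P _).
have Rc : \int[P]_w (a ^+ 2) = a ^+ 2.
  rewrite Rintegral_cst// -[RHS]mulr1; congr (_ * _).
  by have := @probability_setT _ _ _ P => /= ->.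
have iZ (c : R) (f : Omega -> R) : P.-integrable setT (EFin \o f) ->
    P.-integrable setT (EFin \o (fun w => c * f w)).
  by move=> hf; apply: eq_integrable (integrableZl measurableT c hf).
have iD (f g : Omega -> R) : P.-integrable setT (EFin \o f) ->
    P.-integrable setT (EFin \o g) -> P.-integrable setT (EFin \o (fun w => f w + g w)).
  by move=> hf hg; exact: (integrableD measurableT hf hg).
pose F w := a ^+ 2 + (- 2 * a * x1 w + (- 2 * a * x2 w + (2 * (x1 w * x2 w) +
   (x1 w * x1 w + x2 w * x2 w)))).
have iF : P.-integrable setT (EFin \o F).
  by apply: iD ic (iD _ _ (iZ _ _ i1) (iD _ _ (iZ _ _ i2) (iD _ _ (iZ _ _ i12) (iD _ _ i11 i22)))).
have -> : (\int[P]_w (`|a - hdot (X1 w) u1 - hdot (X2 w) u2| ^+ 2)%:E =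
    \int[P]_w (F w)%:E)%E.
  apply: eq_integral => w _; congr EFin; rewrite real_normK ?num_real// /F /x1 /x2; ring.
have toR f : P.-integrable setT (EFin \o f) ->
    (\int[P]_w (f w)%:E = (\int[P]_w f w)%R%:E)%E.
  by move=> hf; rewrite /Rintegral fineK//; exact: integrable_fin_num.
rewrite (toR _ iF) (_ : (\int[P]_w (hdot (X1 w) u1 ^+ 2)%:E =
  (\int[P]_w (x1 w * x1 w))%R%:E)%E); last first.
  by rewrite -toR//; apply: eq_integral => w _; rewrite expr2.
rewrite (_ : (\int[P]_w (hdot (X2 w) u2 ^+ 2)%:E =
  (\int[P]_w (x2 w * x2 w))%R%:E)%E); last first.
  by rewrite -toR//; apply: eq_integral => w _; rewrite expr2.
rewrite -!EFinD; congr EFin; rewrite /F.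
rewrite RintegralD//; last exact: (iD _ _ (iZ _ _ i1) (iD _ _ (iZ _ _ i2) (iD _ _ (iZ _ _ i12) (iD _ _ i11 i22)))).
rewrite RintegralD//; [|exact: iZ|exact: (iD _ _ (iZ _ _ i2) (iD _ _ (iZ _ _ i12) (iD _ _ i11 i22)))].
rewrite RintegralD//; [|exact: iZ|exact: (iD _ _ (iZ _ _ i12) (iD _ _ i11 i22))].
rewrite RintegralD//; [|exact: iZ|exact: (iD _ _ i11 i22)].
rewrite RintegralD// Rc !RintegralZl// R1 R2 R12; ring.
Qed.

End noise.

(** * Extremal noise *)

Section worst_noise.
Variables (R : realType) (d : measure_display) (Omega : measurableType d).
Variable P : probability Omega R.
Import HBSimple.

(** The extremal noises are fixed vectors with a random scalar amplitude. Simple functions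
    approximating [xi] both pointwise and in mean, multiplied by [v], serve as approximations for
    strong measurability and for the Bochner mean at once. *)
Lemma scaled_rv (H : hilbert R) (xi : Omega -> R) (v : H) :
  sqint P xi -> (\int[P]_w (xi w)%:E = 0)%E ->
  L2_rv P setT hdot (fun w => xi w *: v) /\ bochner_mean P (fun w => xi w *: v) 0.
Proof.
move=> sxi m0; have ixi := sqint_int sxi.
have hH := @hdot_semi_inner R H.
have [g [ig gxi gint]] := approximation_sfun_integrable measurableT ixi.
have sg k : simple_rv (g k : Omega -> R).
  split; first exact: fimfunP.
  by move=> r; rewrite -[X in measurable X]setTI; exact: measurable_funPT.
have sgv k : simple_rv (fun w => g k w *: v) := simple_comp (fun r => r *: v) (sg k).
split.
  split=> //.
    exists (fun k w => g k w *: v); split=> // w.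
    have e k : hdot (g k w *: v - xi w *: v) (g k w *: v - xi w *: v) =
        (g k w - xi w) * (g k w - xi w) * hdot v v.
      by rewrite -scalerBl (ipZl hH) (ipZr hH) mulrA.
    under eq_fun do rewrite e.
    have gw : (g k w - xi w) @[k --> \oo] --> (0 : R).
      have /fine_cvgP[_ h] := gxi w I.
      by have := cvgB h (cvg_cst (xi w)); rewrite subrr; apply.
    have := cvgM (cvgM gw gw) (cvg_cst (hdot v v)).
    by rewrite !mul0r; apply.
  have [mxi Ixi] := sxi.
  under eq_integral do rewrite (ipZl hH) (ipZr hH) mulrA -expr2 EFinM.
  rewrite ge0_integralZr//.
  - by rewrite muleC; apply: lte_mul_pinfty => //; rewrite lee_fin (ip_ge0 hH).
  - by apply/measurable_EFinP; exact: measurable_funX.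
  - by move=> w _; rewrite lee_fin sqr_ge0.
  - by rewrite lee_fin (ip_ge0 hH).
exists (fun k w => g k w *: v); split=> //.
  have e k : (\int[P]_w (`|xi w *: v - g k w *: v|)%:E =
      (`|v|)%:E * \int[P]_w `|(EFin \o xi) w - (g k w)%:E|)%E.
    rewrite -ge0_integralZl//.
    - apply: eq_integral => w _; rewrite -scalerBl normrZ mulrC EFinM.
      by [].
    - apply: measurableT_comp => //; apply: emeasurable_funB; first by case/integrableP: ixi.
      by case/integrableP: (ig k).
  under eq_fun do rewrite e.
  have -> : (0 = `|v|%:E * 0)%E by rewrite mule0.
  by apply: cvgeZl => //; exact: gint.
have mean k : simple_mean P (fun w => g k w *: v) = (\int[P]_w g k w) *: v.
  apply: hdot_inj => u; have [_ h] := simple_integral P u (sgv k).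
  apply: EFin_inj; rewrite -h (ipZl hH).
  under eq_integral do rewrite (ipZl hH) EFinM.
  rewrite integralZr//; last exact: ig.
  by rewrite EFinM /Rintegral fineK//; apply: integrable_fin_num => //; exact: ig.
under eq_fun do rewrite mean.
rewrite -(scale0r v); apply: cvgZr_tmp.
apply/cvgrPdist_lt => e e0.
have h1 : \forall k \near \oo, (\int[P]_w `|(EFin \o xi) w - (g k w)%:E| < e%:E)%E.
  have /= := gint [set x | (x < e%:E)%E]; apply.
  by apply: open_nbhs_nbhs; split => //=; apply: open_ereal_lt_ereal.
apply: filterS h1 => k; rewrite sub0r normrN => hk.
rewrite -lte_fin; apply: le_lt_trans hk.
have iB := integrableB measurableT ixi (ig k).
have -> : (`|\int[P]_w g k w|)%:E = `| \int[P]_w ((EFin \o xi) w - (g k w)%:E) |%E.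
  rewrite integralB//; last exact: ig.
  rewrite [X in (X - _)%E]m0 sub0e abseN /Rintegral.
  have : (\int[P]_w (g k w)%:E)%E \is a fin_num by apply: integrable_fin_num => //; exact: ig.
  by move=> /fineK {2}<-.
by apply: le_abse_integral => //; case/integrableP: iB.
Qed.

(** The maximiser of a linear functional on an ellipsoid: [Qi u], normalised in the form of [Q]. It
    turns [op_inv_CS] into an equality. *)
Lemma worst_direction (H : hilbert R) (Q Qi : H -> H) (u : H) :
  positive_selfadjoint hdot Q Qi ->
  exists v : H, hdot v u ^+ 2 = hdot (Qi u) u /\ hdot (Q v) v <= 1.
Proof.
move=> hQ; have hH := @hdot_semi_inner R H; have hF := op_form_semi_inner hH hQ.
set q := hdot (Qi u) u.
have qE : op_form hdot Q (Qi u) (Qi u) = q.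
  by rewrite /op_form (op_invr hH hQ) (ipC hH).
have q0 : 0 <= q by rewrite -qE; exact: (ip_ge0 hF).
exists ((Num.sqrt q)^-1 *: Qi u).
rewrite -/(op_form hdot Q _ _) (ipZl hF) (ipZr hF) qE (ipZl hH) -/q.
have [->|qn0] := eqVneq q 0; first by rewrite !mulr0 expr0n ler01.
have sn0 : Num.sqrt q != 0.
  by rewrite sqrtr_eq0 -ltNge lt_neqAle eq_sym qn0.
move: (sqr_sqrtr q0) sn0; move: (Num.sqrt q) => s s2 s0; rewrite -s2; split.
  by field.
by rewrite le_eqVlt; apply/orP; left; apply/eqP; field.
Qed.

(** The two scalar variables become the amplitudes of the two worst directions: unit variance makes
    the second moments admissible, and vanishing covariance keeps the two noises uncorrelated
    against all pairs of vectors. *)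
Lemma worst_noise (H1 H2 : hilbert R) (Q1 Q1i : H1 -> H1) (Q2 Q2i : H2 -> H2)
    (u1 : H1) (u2 : H2) :
  (exists xi1 xi2 : {RV P >-> R},
      [/\ ('E_P[xi1] = 0 /\ 'E_P[xi2] = 0)%E,
          ('V_P[xi1] = 1 /\ 'V_P[xi2] = 1)%E &
          covariance P xi1 xi2 = 0%E]) ->
  positive_selfadjoint hdot Q1 Q1i -> positive_selfadjoint hdot Q2 Q2i ->
  exists X1 X2, [/\ noise_set P Q1 Q2 (X1, X2),
    (\int[P]_w (hdot (X1 w) u1 ^+ 2)%:E = (hdot (Q1i u1) u1)%:E)%E &
    (\int[P]_w (hdot (X2 w) u2 ^+ 2)%:E = (hdot (Q2i u2) u2)%:E)%E].
Proof.
move=> [xi1 [xi2 [[E1 E2] [V1 V2] C12]]] hQ1 hQ2.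
have cE (x y : {RV P >-> R}) : ('E_P[x] = 0)%E -> ('E_P[y] = 0)%E ->
    (covariance P x y = \int[P]_w (x w * y w)%:E)%E.
  move=> Ex Ey; rewrite covariance.unlock Ex Ey /= expectation.unlock.
  apply: eq_integral => w _; congr EFin.
  by rewrite -[LHS]/((x w - 0) * (y w - 0)) !subr0.
have sq (x : {RV P >-> R}) : ('E_P[x] = 0)%E -> ('V_P[x] = 1)%E ->
    (\int[P]_w (x w ^+ 2)%:E = 1)%E.
  move=> Ex; rewrite /variance cE// => V; apply: etrans V; exact: eq_integral.
have s1 := sq _ E1 V1; have s2 := sq _ E2 V2.
have q1 : sqint P xi1 by split; [exact: measurable_funPT|rewrite s1 ltry].
have q2 : sqint P xi2 by split; [exact: measurable_funPT|rewrite s2 ltry].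
have C0 : (\int[P]_w (xi1 w * xi2 w)%:E = 0)%E by rewrite -cE.
rewrite expectation.unlock in E1 E2.
have [v1 [v1u v1Q]] := worst_direction u1 hQ1.
have [v2 [v2u v2Q]] := worst_direction u2 hQ2.
have [L1 B1] := scaled_rv v1 q1 E1; have [L2 B2] := scaled_rv v2 q2 E2.
have sqZ (x : {RV P >-> R}) (c : R) : (\int[P]_w (x w ^+ 2)%:E = 1)%E -> 0 <= c ->
    (\int[P]_w (x w ^+ 2 * c)%:E = c%:E)%E.
  move=> h c0; under eq_integral do rewrite EFinM.
  rewrite ge0_integralZr//; first by rewrite h mul1e.
  - by apply/measurable_EFinP; apply: measurable_funX; exact: measurable_funPT.
  - by move=> w _; rewrite lee_fin sqr_ge0.
have qf (H : hilbert R) (Q Qi : H -> H) (x : {RV P >-> R}) (v : H) :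
    positive_selfadjoint hdot Q Qi -> (\int[P]_w (x w ^+ 2)%:E = 1)%E ->
    hdot (Q v) v <= 1 -> ('E_P[(fun w => hdot (Q (x w *: v)) (x w *: v))] <= 1)%E.
  move=> hQ h vQ; have hF := op_form_semi_inner (@hdot_semi_inner R H) hQ.
  rewrite expectation.unlock.
  rewrite (eq_integral (fun w => (x w ^+ 2 * op_form hdot Q v v)%:E)); last first.
    move=> w _; congr EFin; rewrite -/(op_form hdot Q _ _) (ipZl hF) (ipZr hF).
    by rewrite mulrA expr2.
  by rewrite sqZ ?lee_fin//; exact: (ip_ge0 hF).
exists (fun w => xi1 w *: v1), (fun w => xi2 w *: v2); split.
- split=> //=; [|exact: qf hQ1 s1 v1Q|exact: qf hQ2 s2 v2Q].
  move=> w1 w2; rewrite expectation.unlock.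
  rewrite (eq_integral (fun w => (xi1 w * xi2 w)%:E * (hdot v1 w1 * hdot v2 w2)%:E)%E).
    by rewrite integralZr// ?C0 ?mul0e//; exact: (sqint_mul q1 q2).
  move=> w _; rewrite (ipZl (@hdot_semi_inner R H1)) (ipZl (@hdot_semi_inner R H2)) -EFinM.
  by congr EFin; ring.
- rewrite (eq_integral (fun w => (xi1 w ^+ 2 * hdot v1 u1 ^+ 2)%:E)).
    by rewrite sqZ ?sqr_ge0// v1u.
  by move=> w _; rewrite (ipZl (@hdot_semi_inner R H1)) exprMn.
- rewrite (eq_integral (fun w => (xi2 w ^+ 2 * hdot v2 u2 ^+ 2)%:E)).
    by rewrite sqZ ?sqr_ge0// v2u.
  by move=> w _; rewrite (ipZl (@hdot_semi_inner R H2)) exprMn.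
Qed.

End worst_noise.

(** * The guaranteed estimate *)

Section adjoint_problem.
Variables (R : realType) (n : nat) (D : lipschitz_domain R n).
Notation E := 'rV[R]_n.+1.
Notation leb := (lebesgue_rV R n.+1).
Notation L2 := (L2 D).
Notation L2n := (L2n D).
Notation l2 := (@l2_dot R n D).
Notation l2n := (@l2n_dot R n D).
Let hl2 : semi_inner l2 := @l2_dot_semi_inner R n D.
Let hl2n : semi_inner l2n := @l2n_dot_semi_inner R n D.

Lemma state_mixed (A : E -> 'M[R]_n.+1) (c : E -> R) (f : L2) j phi :
  state A c f j phi <-> mixed A c 0 (- f) j phi.
Proof.
split=> -[hj m1 m2]; split=> //.
- by move=> q hq; rewrite m1// (ip0l hl2n).
- by move=> w; rewrite m2 (ipNl hl2).
- by move=> q hq; rewrite m1// (ip0l hl2n).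
- by move=> w; rewrite m2 (ipNl hl2).
Qed.

(** Inversion commutes with transposition, so the adjoint equation is a mixed problem for the
    transposed matrix, which is again coercive. *)
Lemma form_a_adjE (A : E -> 'M[R]_n.+1) (p q : L2n) :
  form_a_adj A p q = form_a (fun x => (A x)^T) p q.
Proof.
rewrite /form_a_adj /form_a; apply: eq_Rintegral => x _.
under eq_bigr do rewrite mulr_suml.
rewrite exchange_big/=; apply: eq_bigr => i _; rewrite mulr_suml.
by apply: eq_bigr => j _; rewrite -trmx_inv mxE; ring.
Qed.

Lemma form_m_sym (c : E -> R) (v w : L2) : form_m c v w = form_m c w v.
Proof. by apply: eq_Rintegral => x _; ring. Qed.

(** The state equation is tested with the adjoint solution and conversely. The terms in [form_a] and
    [form_b] match and [form_m] is symmetric, so only the right-hand sides survive. *)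
Lemma mixed_duality (A : E -> 'M[R]_n.+1) (c : E -> R) (h : L2) j phi r1 r2 p v :
  mixed A c 0 (- h) j phi -> mixed (fun x => (A x)^T) c r1 r2 p v ->
  l2n r1 j + l2 r2 phi = - l2 h v.
Proof.
move=> [hj m1 m2] [hp n1 n2].
rewrite -(n1 _ hj) -(n2 phi) -form_a_adjE /form_a_adj.
have e1 : form_a A j p + form_b p phi = 0 by rewrite m1// (ip0l hl2n).
have e2 : form_b j v - form_m c phi v = - l2 h v by rewrite m2 (ipNl hl2).
rewrite (form_m_sym c v phi); move: e1 e2.
move: (form_a A j p) (form_b p phi) (form_b j v) (form_m c phi v) (l2 h v).
by move=> x1 x2 x3 x4 x5; lra.
Qed.

End adjoint_problem.

Section equivalent_inner_product.
Variables (R : realType) (V : lmodType R) (ip ip' : V -> V -> R).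
Hypotheses (hip : semi_inner ip) (hip' : semi_inner ip').
Hypothesis comp : ip_complete ip setT setT.

(** Lax-Milgram with the symmetric form [ip'] as bilinear form; completeness is required of the
    equivalent form [ip] only. *)
Lemma riesz_equiv (a b : R) : 0 < a ->
  (forall x, a * ip x x <= ip' x x) -> (forall x, ip' x x <= b * ip x x) ->
  forall (F : V -> R) (K : R), (forall t x y, F (t *: x + y) = t * F x + F y) ->
  0 <= K -> (forall x, F x ^+ 2 <= K * ip x x) ->
  exists u, (forall v, ip' u v = F v) /\ a ^+ 2 * ip u u <= K.
Proof.
move=> a0 ha hb F K Fl K0 FK.
have sub : submodule (setT : set V) by split.
have [u _ [uE uK]] : exists2 u, [set: V] u &
    (forall v, [set: V] v -> ip' u v = F v) /\ a ^+ 2 * ip u u <= K.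
  apply: (@lax_milgram R V ip hip setT ip' F (`|b| ^+ 2) a K sub comp) => //.
  - by move=> t x y z; rewrite (ip_linl hip').
  - by move=> t x y z; rewrite (ipDr hip') (ipZr hip').
  - move=> x y; apply: le_trans (ip_CS hip' _ _) _.
    have hb' z : ip' z z <= `|b| * ip z z.
      by apply: le_trans (hb z) _; rewrite ler_wpM2r ?(ip_ge0 hip)// ler_norm.
    have -> : `|b| ^+ 2 * ip x x * ip y y = (`|b| * ip x x) * (`|b| * ip y y) by ring.
    by rewrite ler_pM// (ip_ge0 hip').
by exists u; split=> // v; exact: uE.
Qed.

End equivalent_inner_product.

Section observation_form.
Variables (R : realType) (V : lmodType R) (ip : V -> V -> R).
Hypotheses (hip : semi_inner ip) (comp : ip_complete ip setT setT).
Variables (Q Qi : V -> V) (hQ : positive_selfadjoint ip Q Qi).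
Variables (H1 H2 : hilbert R) (Q1 Q1i : H1 -> H1) (Q2 Q2i : H2 -> H2).
Hypotheses (hQ1 : positive_selfadjoint hdot Q1 Q1i) (hQ2 : positive_selfadjoint hdot Q2 Q2i).
Variables (obs1 : V -> H1) (obs2 : V -> H2).
Hypothesis D1l : forall a x y, obs1 (a *: x + y) = a *: obs1 x + obs1 y.
Hypothesis D2l : forall a x y, obs2 (a *: x + y) = a *: obs2 x + obs2 y.
Variable KD : R.
Hypothesis KD0 : 0 <= KD.
Hypothesis D1b : forall x, hdot (obs1 x) (obs1 x) <= KD * ip x x.
Hypothesis D2b : forall x, hdot (obs2 x) (obs2 x) <= KD * ip x x.

(** The form G of the overview, with [obs1] and [obs2] standing for the observed parts of the state
    generated by a source. *)
Definition obs_form (h k : V) : R :=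
  op_form ip Q h k + op_form hdot Q1 (obs1 h) (obs1 k) + op_form hdot Q2 (obs2 h) (obs2 k).

Let hF := op_form_semi_inner hip hQ.
Let hF1 := op_form_semi_inner (@hdot_semi_inner R H1) hQ1.
Let hF2 := op_form_semi_inner (@hdot_semi_inner R H2) hQ2.

Lemma obs_form_semi_inner : semi_inner obs_form.
Proof.
split.
- move=> a x y z; rewrite /obs_form D1l D2l (ip_linl hF) (ip_linl hF1) (ip_linl hF2); ring.
- by move=> x y; rewrite /obs_form (ipC hF) (ipC hF1) (ipC hF2).
- by move=> x; rewrite !addr_ge0// ?(ip_ge0 hF) ?(ip_ge0 hF1) ?(ip_ge0 hF2).
Qed.

Lemma op_form_le (W : lmodType R) (ipW : W -> W -> R) (T Ti : W -> W) :
  semi_inner ipW -> positive_selfadjoint ipW T Ti ->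
  exists2 K, 0 <= K & forall x, op_form ipW T x x <= K * ipW x x.
Proof.
move=> hW hT; have [K K0 HK] := op_bounded hW hT.
exists (K + 1); first by rewrite addr_ge0.
move=> x; rewrite -(@ler_pXn2r _ 2) ?nnegrE ?mulr_ge0 ?addr_ge0 ?(ip_ge0 hW)//; last first.
  exact: (ip_ge0 (op_form_semi_inner hW hT)).
apply: le_trans (ip_CS hW _ _) _; rewrite exprMn [ipW x x ^+ 2]expr2 mulrA.
rewrite ler_wpM2r ?(ip_ge0 hW)//; apply: le_trans (HK _) _.
by rewrite ler_wpM2r ?(ip_ge0 hW)//; nra.
Qed.

Lemma obs_form_riesz : exists2 a : R, 0 < a & (forall x, a * ip x x <= obs_form x x) /\
  forall (F : V -> R) (K : R), (forall t x y, F (t *: x + y) = t * F x + F y) ->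
  0 <= K -> (forall x, F x ^+ 2 <= K * ip x x) ->
  exists u, (forall v, obs_form u v = F v) /\ a ^+ 2 * ip u u <= K.
Proof.
have [a a0 ha] := op_form_coercive hip hQ; exists a => //.
have ha' x : a * ip x x <= obs_form x x.
  apply: le_trans (ha x) _; rewrite /obs_form -addrA lerDl addr_ge0//.
    exact: (ip_ge0 hF1).
  exact: (ip_ge0 hF2).
split=> //.
have [K K0 HK] := op_form_le hip hQ.
have [K1 K10 HK1] := op_form_le (@hdot_semi_inner R H1) hQ1.
have [K2 K20 HK2] := op_form_le (@hdot_semi_inner R H2) hQ2.
apply: (@riesz_equiv R V ip obs_form hip obs_form_semi_inner comp a
  (K + K1 * KD + K2 * KD)) => // x.
rewrite /obs_form !mulrDl; apply: lerD; first apply: lerD => //.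
- by apply: le_trans (HK1 _) _; rewrite -mulrA ler_wpM2l.
- by apply: le_trans (HK2 _) _; rewrite -mulrA ler_wpM2l.
Qed.

Lemma op_form_riesz (F : V -> R) (K : R) : (forall t x y, F (t *: x + y) = t * F x + F y) ->
  0 <= K -> (forall x, F x ^+ 2 <= K * ip x x) ->
  exists u, forall v, op_form ip Q u v = F v.
Proof.
move=> Fl K0 FK; have [a a0 ha] := op_form_coercive hip hQ.
have [b b0 hb] := op_form_le hip hQ.
have [u [uE _]] := @riesz_equiv R V ip _ hip hF comp a b a0 ha hb F K Fl K0 FK.
by exists u.
Qed.

End observation_form.

Section guaranteed_estimate.
Variables (R : realType) (n : nat) (D : lipschitz_domain R n).
Notation E := 'rV[R]_n.+1.
Notation L2 := (L2 D).
Notation L2n := (L2n D).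
Notation l2 := (@l2_dot R n D).
Notation l2n := (@l2n_dot R n D).
Let hl2 : semi_inner l2 := @l2_dot_semi_inner R n D.
Let hl2n : semi_inner l2n := @l2n_dot_semi_inner R n D.
Variables (A : E -> 'M[R]_n.+1) (hA : coercive_coefficients D A).
Variables (c : E -> R) (mc : measurable_fun D c).
Variables (c1 : R) (hc : forall x, dom D x -> 0 <= c x <= c1).
Variables (d : measure_display) (Omega : measurableType d) (P : probability Omega R).
Hypothesis hP : exists xi1 xi2 : {RV P >-> R},
      [/\ ('E_P[xi1] = 0 /\ 'E_P[xi2] = 0)%E,
          ('V_P[xi1] = 1 /\ 'V_P[xi2] = 1)%E &
          covariance P xi1 xi2 = 0%E].
Variables (Q Qi : L2 -> L2) (hQ : positive_selfadjoint l2 Q Qi) (f0 : L2).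
Variables (H1 H2 : hilbert R).
Variables (Q1 Q1i : H1 -> H1) (hQ1 : positive_selfadjoint hdot Q1 Q1i).
Variables (Q2 Q2i : H2 -> H2) (hQ2 : positive_selfadjoint hdot Q2 Q2i).
Variables (C1 : L2n -> H1) (hC1 : bounded_linear l2n hdot C1).
Variables (C2 : L2 -> H2) (hC2 : bounded_linear l2 hdot C2).
Variables (l1 : L2n) (lf : L2).
Variables (S : L2 -> L2n * L2) (KS : R).
Hypothesis KS0 : 0 <= KS.
Hypothesis SP : forall h, mixed A c 0 (- h) (S h).1 (S h).2.
Hypothesis SK : forall h, hdiv_dot (S h).1 (S h).1 + l2 (S h).2 (S h).2 <= KS * l2 h h.

(** A bounded operator sends null vectors to zero. Hence observations do not depend on
    representatives, and in the Hilbert space the result is Leibniz equality. *)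
Lemma bounded_linear_congr (V : lmodType R) (ip : V -> V -> R) (H : hilbert R) (T : V -> H) x y :
  semi_inner ip -> bounded_linear ip hdot T -> semi_eq ip x y -> T x = T y.
Proof.
move=> hip [Tl [K TK]] xy; have := semi_eq_hdot (Tl (-1) y x).
have : T (-1 *: y + x) = 0.
  apply: hdot_eq0; apply/eqP; rewrite eq_le (ip_ge0 (@hdot_semi_inner R H)) andbT.
  by apply: le_trans (TK _) _; rewrite scaleN1r addrC (_ : ip _ _ = 0)// mulr0.
by move=> -> /esym /eqP; rewrite scaleN1r addrC subr_eq0 => /eqP.
Qed.

Lemma bounded_linearP (V : lmodType R) (ip : V -> V -> R) (H : hilbert R) (T : V -> H) a x y :
  bounded_linear ip hdot T -> T (a *: x + y) = a *: T x + T y.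
Proof. by move=> [Tl _]; exact: semi_eq_hdot. Qed.

Definition obs1 (h : L2) : H1 := C1 (S h).1.
Definition obs2 (h : L2) : H2 := C2 (S h).2.
Definition target (h : L2) : R := functional l1 lf (S h).1 (S h).2.

(** [S] is chosen source by source; unique solvability of the mixed problem makes it linear up to
    null elements. *)
Lemma solution_linear a h k : semi_eq l2n (S (a *: h + k)).1 (a *: (S h).1 + (S k).1) /\
  semi_eq l2 (S (a *: h + k)).2 (a *: (S h).2 + (S k).2).
Proof.
have := mixed_linear hA mc hc a (SP h) (SP k).
rewrite scaler0 addr0 scalerN -opprD => m.
by have [] := mixed_unique hA mc hc (SP (a *: h + k)) m.
Qed.

Lemma obs1_linear a h k : obs1 (a *: h + k) = a *: obs1 h + obs1 k.
Proof.
rewrite /obs1 (bounded_linear_congr hl2n hC1 (solution_linear a h k).1).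
exact: bounded_linearP hC1.
Qed.

Lemma obs2_linear a h k : obs2 (a *: h + k) = a *: obs2 h + obs2 k.
Proof.
rewrite /obs2 (bounded_linear_congr hl2 hC2 (solution_linear a h k).2).
exact: bounded_linearP hC2.
Qed.

Lemma target_linear a h k : target (a *: h + k) = a * target h + target k.
Proof.
rewrite /target /functional (semi_eq_ipr hl2n _ (solution_linear a h k).1) (semi_eq_ipr hl2 _ (solution_linear a h k).2).
rewrite (ipDr hl2n) (ipDr hl2) (ipZr hl2n) (ipZr hl2); ring.
Qed.

Lemma flux_le h : l2n (S h).1 (S h).1 <= KS * l2 h h.
Proof.
apply: le_trans (SK h); rewrite /hdiv_dot -addrA lerDl addr_ge0//; exact: (ip_ge0 hl2).
Qed.

Lemma potential_le h : l2 (S h).2 (S h).2 <= KS * l2 h h.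
Proof.
apply: le_trans (SK h); rewrite lerDr addr_ge0//; [exact: (ip_ge0 hl2n)|exact: (ip_ge0 hl2)].
Qed.

Lemma obs_bounded : exists2 K, 0 <= K & forall h,
  hdot (obs1 h) (obs1 h) <= K * l2 h h /\ hdot (obs2 h) (obs2 h) <= K * l2 h h.
Proof.
have [_ [K1 HK1]] := hC1; have [_ [K2 HK2]] := hC2.
exists ((`|K1| + `|K2|) * KS); first by rewrite mulr_ge0// addr_ge0.
move=> h; split.
- apply: le_trans (HK1 _) _; apply: (@le_trans _ _ (`|K1| * l2n (S h).1 (S h).1)).
    by rewrite ler_wpM2r ?(ip_ge0 hl2n)// ler_norm.
  rewrite -mulrA mulrDl; apply: le_trans (ler_wpM2l _ (flux_le h)) _ => //.
  by rewrite lerDl !mulr_ge0// (ip_ge0 hl2).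
- apply: le_trans (HK2 _) _; apply: (@le_trans _ _ (`|K2| * l2 (S h).2 (S h).2)).
    by rewrite ler_wpM2r ?(ip_ge0 hl2)// ler_norm.
  rewrite -mulrA mulrDl; apply: le_trans (ler_wpM2l _ (potential_le h)) _ => //.
  by rewrite lerDr !mulr_ge0// (ip_ge0 hl2).
Qed.

Lemma target_bounded : exists2 K, 0 <= K & forall h, target h ^+ 2 <= K * l2 h h.
Proof.
have hp := prod_ip_semi_inner hl2n hl2.
pose z : (L2n * L2)%type := (l1, lf).
exists (prod_ip l2n l2 z z * KS); first by rewrite mulr_ge0// (ip_ge0 hp).
move=> h; have -> : target h = prod_ip l2n l2 z (S h) by [].
apply: le_trans (ip_CS hp _ _) _; rewrite -mulrA ler_wpM2l ?(ip_ge0 hp)//.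
apply: le_trans (SK h); rewrite /prod_ip /hdiv_dot lerD2r lerDl.
exact: (ip_ge0 hl2).
Qed.

Lemma sqrB3_le (x y z a b e : R) : x ^+ 2 <= a -> y ^+ 2 <= b -> z ^+ 2 <= e ->
  (x - y - z) ^+ 2 <= 3 * (a + b + e).
Proof.
have := sqr_ge0 (x + y); have := sqr_ge0 (x + z); have := sqr_ge0 (y - z); nra.
Qed.

(* The part of the estimation error that depends on the source [h]. *)
Definition gap (u1 : H1) (u2 : H2) (h : L2) : R :=
  target h - hdot (obs1 h) u1 - hdot (obs2 h) u2.

Lemma gap_linear u1 u2 a h k : gap u1 u2 (a *: h + k) = a * gap u1 u2 h + gap u1 u2 k.
Proof.
rewrite /gap target_linear obs1_linear obs2_linear (ip_linl (@hdot_semi_inner R H1)).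
rewrite (ip_linl (@hdot_semi_inner R H2)); ring.
Qed.

Lemma gap_bounded u1 u2 : exists2 K, 0 <= K & forall h, gap u1 u2 h ^+ 2 <= K * l2 h h.
Proof.
have [K K0 HK] := target_bounded; have [KD KD0 HD] := obs_bounded.
exists (3 * (K + KD * hdot u1 u1 + KD * hdot u2 u2)).
  rewrite mulr_ge0// !addr_ge0 ?mulr_ge0//; exact: (ip_ge0 (@hdot_semi_inner R _)).
move=> h.
have -> : 3 * (K + KD * hdot u1 u1 + KD * hdot u2 u2) * l2 h h =
  3 * (K * l2 h h + KD * l2 h h * hdot u1 u1 + KD * l2 h h * hdot u2 u2) by ring.
apply: sqrB3_le => //.
- apply: le_trans (ip_CS (@hdot_semi_inner R H1) _ _) _.
  rewrite ler_wpM2r ?(ip_ge0 (@hdot_semi_inner R H1))//.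
  by have [] := HD h.
- apply: le_trans (ip_CS (@hdot_semi_inner R H2) _ _) _.
  rewrite ler_wpM2r ?(ip_ge0 (@hdot_semi_inner R H2))//.
  by have [] := HD h.
Qed.

Lemma gap_riesz u1 u2 : exists kap, forall h, op_form l2 Q kap h = gap u1 u2 h.
Proof.
have [K K0 HK] := gap_bounded u1 u2.
exact: (op_form_riesz hl2 (@l2_complete R n D) hQ (gap_linear u1 u2) K0 HK).
Qed.

Let hF : semi_inner (op_form l2 Q) := op_form_semi_inner hl2 hQ.

Lemma state_error f j phi (u1 : H1) (u2 : H2) (k : R) (x1 : H1) (x2 : H2) :
  state A c f j phi ->
  functional l1 lf j phi - hdot (C1 j + x1) u1 - hdot (C2 phi + x2) u2 - k =
  (gap u1 u2 f - k) - hdot x1 u1 - hdot x2 u2.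
Proof.
move=> /state_mixed m; have [e1 e2 _] := mixed_unique hA mc hc m (SP f).
rewrite /gap /target /functional /obs1 /obs2 (semi_eq_ipr hl2n _ e1) (semi_eq_ipr hl2 _ e2).
rewrite (bounded_linear_congr hl2n hC1 e1) (bounded_linear_congr hl2 hC2 e2).
rewrite (ipDl (@hdot_semi_inner R H1)) (ipDl (@hdot_semi_inner R H2)); ring.
Qed.

Notation sigma := (worst_case_error P A c Q f0 Q1 Q2 C1 C2 l1 lf).

(** The upper bound is Cauchy-Schwarz in the form of [Q] for the source together with
    [noise_variance_le]. The supremum is attained: a source on the boundary of the ellipsoid and the
    noise of [worst_noise] reach equality in all three parts simultaneously. *)
Lemma worst_case_errorE u1 u2 k kap : (forall h, op_form l2 Q kap h = gap u1 u2 h) ->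
  sigma u1 u2 k = ((`|gap u1 u2 f0 - k| + Num.sqrt (op_form l2 Q kap kap)) ^+ 2
    + hdot (Q1i u1) u1 + hdot (Q2i u2) u2)%:E.
Proof.
move=> hkap; set q := op_form l2 Q kap kap.
have q0 : 0 <= q by exact: (ip_ge0 hF).
apply/eqP; rewrite eq_le; apply/andP; split.
- apply: ge_ereal_sup => _ [f [j [phi [e1 [e2 [hf hs [[/= L1 L2'] [B1 B2] cov V1 V2] ->]]]]]].
  have -> : (fun w => `|functional l1 lf j phi - hdot (C1 j + e1 w) u1
      - hdot (C2 phi + e2 w) u2 - k| ^+ 2) =
    (fun w => `|(gap u1 u2 f - k) - hdot (e1 w) u1 - hdot (e2 w) u2| ^+ 2).
    by apply/funext => w; rewrite (state_error _ _ _ _ _ hs).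
  rewrite (noise_expectation _ L1 L2' B1 B2 (cov u1 u2)) !EFinD -addeA.
  apply: leeD; last by apply: leeD; [exact: noise_variance_le hQ1 L1 V1|exact: noise_variance_le hQ2 L2' V2].
  rewrite lee_fin -[X in X <= _]real_normK ?num_real// ler_pXn2r ?nnegrE ?addr_ge0 ?sqrtr_ge0//.
  have -> : gap u1 u2 f - k = gap u1 u2 f0 - k + gap u1 u2 (f - f0).
    have := gap_linear u1 u2 1 (f - f0) f0; rewrite scale1r subrK mul1r => ->; ring.
  apply: le_trans (ler_normD _ _) _; rewrite lerD2l -hkap.
  rewrite -(@ler_pXn2r _ 2) ?nnegrE ?sqrtr_ge0// real_normK ?num_real// sqr_sqrtr//.
  apply: le_trans (ip_CS hF _ _) _; rewrite -/q -[leRHS]mulr1 ler_wpM2l//.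
- have [X1 [X2 [nX I1 I2]]] := worst_noise u1 u2 hP hQ1 hQ2.
  pose sg : R := if 0 <= gap u1 u2 f0 - k then 1 else -1.
  (* The source moves by a unit vector along [kap], with the sign of the error left at [f0], so that
     the two contributions add up. For [q = 0] the division by zero gives [t = 0] and [f = f0]. *)
  pose t := sg / Num.sqrt q.
  pose f := f0 + t *: kap.
  have tq : t * q = sg * Num.sqrt q.
    have [->|qn0] := eqVneq q 0; first by rewrite sqrtr0 !mulr0.
    have sn0 : Num.sqrt q != 0 by rewrite sqrtr_eq0 -ltNge lt_neqAle eq_sym qn0.
    by rewrite /t -{2}(sqr_sqrtr q0); field.
  have sg1 : sg * sg = 1 by rewrite /sg; case: ifP; rewrite ?mulr1 ?mulrNN ?mulr1.
  have gf : gap u1 u2 f = gap u1 u2 f0 + sg * Num.sqrt q.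
    by rewrite /f addrC gap_linear -hkap -/q tq addrC.
  apply: ereal_sup_ubound; exists f, (S f).1, (S f).2, X1, X2; split => //.
  + rewrite /source_set /= /f addrC addKr -/(op_form l2 Q _ _) (ipZl hF) (ipZr hF) -/q tq.
    rewrite /t; have [->|qn0] := eqVneq q 0; first by rewrite sqrtr0 !mulr0 ler01.
    have sn0 : Num.sqrt q != 0 by rewrite sqrtr_eq0 -ltNge lt_neqAle eq_sym qn0.
    rewrite (_ : sg / Num.sqrt q * (sg * Num.sqrt q) = sg * sg); first by rewrite sg1.
    by field.
  + exact/state_mixed.
  + have [[/= L1 L2'] [B1 B2] cov V1 V2] := nX.
    have -> : (fun w => `|functional l1 lf (S f).1 (S f).2 - hdot (C1 (S f).1 + X1 w) u1
        - hdot (C2 (S f).2 + X2 w) u2 - k| ^+ 2) =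
      (fun w => `|(gap u1 u2 f - k) - hdot (X1 w) u1 - hdot (X2 w) u2| ^+ 2).
      by apply/funext => w; rewrite (@state_error f (S f).1 (S f).2)//; exact/state_mixed.
    rewrite (noise_expectation _ L1 L2' B1 B2 (cov u1 u2)) I1 I2 !EFinD -addeA.
    congr (_%:E + _)%E; rewrite gf.
    rewrite /sg; case: ifP => h.
      by rewrite ger0_norm// mul1r; congr (_ ^+ 2); ring.
    have h' : gap u1 u2 f0 - k < 0 by rewrite ltNge h.
    by rewrite ltr0_norm//; ring.
Qed.

Lemma optimum : exists (kh : L2),
  let u1 := Q1 (obs1 kh) in let u2 := Q2 (obs2 kh) in
  [/\ forall h, obs_form l2 Q Q1 Q2 obs1 obs2 kh h = target h,
      optimal P A c Q f0 Q1 Q2 C1 C2 l1 lf u1 u2 (gap u1 u2 f0) &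
      forall v1 v2 k', optimal P A c Q f0 Q1 Q2 C1 C2 l1 lf v1 v2 k' ->
        [/\ v1 = u1, v2 = u2 & k' = gap u1 u2 f0]].
Proof.
have [KD KD0 HD] := obs_bounded; have [K K0 HK] := target_bounded.
have [a a0 [_ ha]] := obs_form_riesz hl2 (@l2_complete R n D) hQ hQ1 hQ2
  obs1_linear obs2_linear (fun h => (HD h).1) (fun h => (HD h).2).
have [kh [khE _]] := ha _ _ target_linear K0 HK.
have hH1 := @hdot_semi_inner R H1; have hH2 := @hdot_semi_inner R H2.
have hF1 := op_form_semi_inner hH1 hQ1; have hF2 := op_form_semi_inner hH2 hQ2.
exists kh => u1 u2.
(* The equation defining [kh], with the observation terms moved to the other side: [kh] itself
   represents the gap of the candidate [(u1, u2)]. This is the stationarity condition. *)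
have kapE h : op_form l2 Q kh h = gap u1 u2 h.
  rewrite /gap -khE /obs_form /u1 /u2 (ipC hH1 (obs1 h)) (ipC hH2 (obs2 h)) /op_form; ring.
have [I IE] : exists I, I = op_form l2 Q kh kh + hdot (Q1i u1) u1 + hdot (Q2i u2) u2 by eexists.
have sigma_opt : sigma u1 u2 (gap u1 u2 f0) = I%:E.
  rewrite IE (worst_case_errorE _ kapE) subrr normr0 add0r sqr_sqrtr//; exact: (ip_ge0 hF).
(* A Pythagorean identity: by stationarity all cross terms cancel, so the cost of a competitor
   exceeds [I] by the squares of its distances to the candidate. It gives minimality and uniqueness
   together. *)
have diff v1 v2 kap : (forall h, op_form l2 Q kap h = gap v1 v2 h) ->
    op_form l2 Q kap kap + hdot (Q1i v1) v1 + hdot (Q2i v2) v2 =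
    I + op_form l2 Q (kap - kh) (kap - kh) +
      hdot (Q1i (v1 - u1)) (v1 - u1) + hdot (Q2i (v2 - u2)) (v2 - u2).
  move=> kapvE.
  have i1l (x y z : H1) : hdot (Q1i (x - y)) z = hdot (Q1i x) z - hdot (Q1i y) z.
    by rewrite !(op_inv_sym hH1 hQ1) (ipBl hH1).
  have i2l (x y z : H2) : hdot (Q2i (x - y)) z = hdot (Q2i x) z - hdot (Q2i y) z.
    by rewrite !(op_inv_sym hH2 hQ2) (ipBl hH2).
  have u1E z : hdot (Q1i u1) z = hdot (obs1 kh) z by rewrite /u1 (op_invl hH1 hQ1).
  have u2E z : hdot (Q2i u2) z = hdot (obs2 kh) z by rewrite /u2 (op_invl hH2 hQ2).
  have v1E : hdot (Q1i v1) u1 = hdot (obs1 kh) v1 by rewrite (op_inv_sym hH1 hQ1) (ipC hH1) u1E.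
  have v2E : hdot (Q2i v2) u2 = hdot (obs2 kh) v2 by rewrite (op_inv_sym hH2 hQ2) (ipC hH2) u2E.
  have e := kapvE kh; have e' := kapE kh.
  rewrite IE !(ipBl hF) !(ipBr hF) i1l i2l !(ipBr hH1) !(ipBr hH2) !u1E !u2E v1E v2E.
  rewrite (ipC hF kh kap) e e' /gap; ring.
have p0 v1 v2 kap : 0 <= op_form l2 Q (kap - kh) (kap - kh) /\
    0 <= hdot (Q1i (v1 - u1)) (v1 - u1) /\ 0 <= hdot (Q2i (v2 - u2)) (v2 - u2).
  split; first exact: (ip_ge0 hF).
  split.
  - rewrite (ipC hH1) -(op_invr hH1 hQ1); exact: (ip_ge0 hF1).
  - rewrite (ipC hH2) -(op_invr hH2 hQ2); exact: (ip_ge0 hF2).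
have lowers v1 v2 k : (I%:E <= sigma v1 v2 k)%E.
  have [kap kapvE] := gap_riesz v1 v2; rewrite (worst_case_errorE k kapvE) lee_fin.
  have qk0 := ip_ge0 hF kap.
  have := diff v1 v2 kap kapvE; have [h1 [h2 h3]] := p0 v1 v2 kap.
  have : op_form l2 Q kap kap <= (`|gap v1 v2 f0 - k| + Num.sqrt (op_form l2 Q kap kap)) ^+ 2.
    rewrite -[X in X <= _](sqr_sqrtr qk0) ler_pXn2r ?nnegrE ?addr_ge0 ?sqrtr_ge0//.
    by rewrite lerDr.
  move: h1 h2 h3 => h1 h2 h3 h4 h5.
  apply: (@le_trans _ _ (op_form l2 Q kap kap + hdot (Q1i v1) v1 + hdot (Q2i v2) v2)).
    by rewrite h5 -!addrA lerDl !addr_ge0.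
  by rewrite !lerD2r.
have infE : ereal_inf [set s | exists v1 v2 k', s = sigma v1 v2 k'] = I%:E.
  apply/eqP; rewrite eq_le; apply/andP; split.
    by rewrite -sigma_opt; apply: ereal_inf_lbound; exists u1, u2, (gap u1 u2 f0).
  by apply: le_ereal_inf_tmp => _ [v1 [v2 [k' ->]]]; exact: lowers.
split=> //; first by rewrite /optimal infE.
move=> v1 v2 k'; rewrite /optimal infE.
have [kap kapvE] := gap_riesz v1 v2; rewrite (worst_case_errorE k' kapvE) => -[].
have qk0 := ip_ge0 hF kap.
have := diff v1 v2 kap kapvE; have [h1 [h2 h3]] := p0 v1 v2 kap.
set s := Num.sqrt _; set dl := `|_|.
have s2 : op_form l2 Q kap kap = s ^+ 2 by rewrite sqr_sqrtr.
have s0 : 0 <= s by exact: sqrtr_ge0.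
have d0 : 0 <= dl by exact: normr_ge0.
move=> e1 e2.
(* [dl * (dl + 2 * s)] is the excess caused by a wrong constant. At an optimum this and the three
   squares of [diff] are nonnegative with sum zero, so each vanishes; since [s] is nonnegative, [dl]
   vanishes too. *)
have sq : (dl + s) ^+ 2 = s ^+ 2 + (dl * (dl + 2 * s)) by ring.
have m0 : 0 <= dl * (dl + 2 * s) by rewrite mulr_ge0// addr_ge0// mulr_ge0.
rewrite s2 in e1; rewrite sq in e2.
have z2 : hdot (Q1i (v1 - u1)) (v1 - u1) = 0.
  move: h1 h2 h3 e1 e2 m0; move: (op_form _ _ _ _) (hdot (Q1i (v1 - u1)) _)
    (hdot (Q2i (v2 - u2)) _) (dl * _) (s ^+ 2) (hdot (Q1i v1) v1) (hdot (Q2i v2) v2).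
  move=> x1 x2 x3 x4 x5 x6 x7 *; lra.
have z3 : hdot (Q2i (v2 - u2)) (v2 - u2) = 0.
  move: h1 h2 h3 e1 e2 m0; move: (op_form _ _ _ _) (hdot (Q1i (v1 - u1)) _)
    (hdot (Q2i (v2 - u2)) _) (dl * _) (s ^+ 2) (hdot (Q1i v1) v1) (hdot (Q2i v2) v2).
  move=> x1 x2 x3 x4 x5 x6 x7 *; lra.
have z4 : dl * (dl + 2 * s) = 0.
  move: h1 h2 h3 e1 e2 m0; move: (op_form _ _ _ _) (hdot (Q1i (v1 - u1)) _)
    (hdot (Q2i (v2 - u2)) _) (dl * _) (s ^+ 2) (hdot (Q1i v1) v1) (hdot (Q2i v2) v2).
  move=> x1 x2 x3 x4 x5 x6 x7 *; lra.
have inv0 (H : hilbert R) (T Ti : H -> H) (x : H) : positive_selfadjoint hdot T Ti ->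
    hdot (Ti x) x = 0 -> x = 0.
  move=> hT h; have hH := @hdot_semi_inner R H; apply: hdot_eq0.
  have := op_inv_CS hH hT x x; rewrite h mulr0 => h'.
  by apply/eqP; rewrite -sqrf_eq0 eq_le h' sqr_ge0.
have v1u : v1 = u1 by apply/eqP; rewrite -subr_eq0; apply/eqP; exact: inv0 hQ1 z2.
have v2u : v2 = u2 by apply/eqP; rewrite -subr_eq0; apply/eqP; exact: inv0 hQ2 z3.
split=> //.
have dl0 : dl = 0.
  move/eqP: z4; rewrite mulf_eq0 => /orP[/eqP//|/eqP h].
  by move: d0 s0 h; lra.
have := normr0_eq0 dl0; rewrite v1u v2u => /eqP; rewrite subr_eq0 => /eqP.
by [].
Qed.

End guaranteed_estimate.

(** * The estimation system *)

Section lipschitz_random_variables.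
Variables (R : realType) (d : measure_display) (Omega : measurableType d).
Variable P : probability Omega R.

(** The integral of a nonnegative function is a supremum over the simple functions below it, so
    monotonicity holds for arbitrary nonnegative functions. It bounds the second moment of a random
    field through that of the noise. *)
Lemma le_integral_unmeasurable (f g : Omega -> \bar R) :
  (forall w, 0 <= f w)%E -> (forall w, f w <= g w)%E ->
  (\int[P]_w f w <= \int[P]_w g w)%E.
Proof.
move=> f0 fg; rewrite !ge0_integralTE//; last by move=> w; exact: le_trans (fg w).
apply: ereal_sup_le => _ [h hf <-].
by exists h => // w; exact: le_trans (hf w) (fg w).
Qed.

Variables (H1 H2 : hilbert R) (X1 : Omega -> H1) (X2 : Omega -> H2).
Hypotheses (hX1 : L2_rv P setT hdot X1) (hX2 : L2_rv P setT hdot X2).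

(** A map applied to simple random elements gives a simple one, and the Lipschitz bound carries over
    both the pointwise convergence and the finite second moment. The weakened triangle inequality on
    [S] is a hypothesis because [hdiv_dot] behaves as a form only on [Hdiv]. *)
Lemma L2_rv_lipschitz (V : lmodType R) (S : set V) (ip : V -> V -> R)
    (Phi : H1 -> H2 -> V) (a1 : H1) (a2 : H2) (L : R) :
  (forall v, 0 <= ip v v) ->
  (forall u v, S u -> S v -> ip u u <= 2 * (ip (u - v) (u - v) + ip v v)) ->
  0 <= L -> (forall y1 y2, S (Phi y1 y2)) ->
  (forall y1 y2 z1 z2, ip (Phi y1 y2 - Phi z1 z2) (Phi y1 y2 - Phi z1 z2) <=
    L * (hdot (y1 - z1) (y1 - z1) + hdot (y2 - z2) (y2 - z2))) ->
  L2_rv P S ip (fun w => Phi (a1 + X1 w) (a2 + X2 w)).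
Proof.
move=> ip0 ipS L0 SPhi lip.
have sX1 := L2_rv_strongly hX1; have sX2 := L2_rv_strongly hX2.
have [_ [s1 [ss1 cv1]] foo1] := hX1; have [_ [s2 [ss2 cv2]] foo2] := hX2.
split=> //.
  exists (fun k w => Phi (a1 + s1 k w) (a2 + s2 k w)); split=> [k|w].
    split=> //; have [[r1 _] [r2 _]] := (ss1 k, ss2 k).
    exact: (simple_comp (fun z : H1 * H2 => Phi (a1 + z.1) (a2 + z.2)) (simple_pair r1 r2)).
  have cvL : L * (hdot (s1 k w - X1 w) (s1 k w - X1 w) +
      hdot (s2 k w - X2 w) (s2 k w - X2 w)) @[k --> \oo] --> (0 : R).
    have := cvgM (cvg_cst L) (cvgD (cv1 w) (cv2 w)); rewrite addr0 mulr0; apply.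
  apply: (squeeze_cvgr _ (@cvg_cst _ _ _ _ _) cvL); near=> k; rewrite ip0/=.
  by apply: le_trans (lip _ _ _ _) _; rewrite !opprD !(addrACA _ _ (- _)) !subrr !add0r.
have i2 (H : hilbert R) (X : Omega -> H) : strongly_measurable X ->
    measurable_fun setT (fun w => (hdot (X w) (X w))%:E).
  move=> mX; apply/measurable_EFinP; apply: eq_measurable_fun (measurable_funX 2 (measurable_hnorm mX)).
  by move=> w _; rewrite hnormE.
have p1 w : (0 <= (hdot (X1 w) (X1 w))%:E)%E by rewrite lee_fin (ip_ge0 (@hdot_semi_inner R H1)).
have p2 w : (0 <= (hdot (X2 w) (X2 w))%:E)%E by rewrite lee_fin (ip_ge0 (@hdot_semi_inner R H2)).
(* Comparison with the value at the deterministic point [(a1, a2)] bounds the form by [M] times 1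
   plus the squared norms of the two noises. *)
pose M := 2 * (L + ip (Phi a1 a2) (Phi a1 a2)).
have M0 : 0 <= M by rewrite mulr_ge0// addr_ge0.
apply: (@le_lt_trans _ _ (\int[P]_w (M%:E * (1 + ((hdot (X1 w) (X1 w))%:E +
    (hdot (X2 w) (X2 w))%:E))))%E).
  apply: le_integral_unmeasurable => w; first by rewrite lee_fin.
  rewrite lee_fin; apply: le_trans (ipS _ _ (SPhi _ _) (SPhi a1 a2)) _.
  rewrite /M -mulrA ler_wpM2l// [leRHS]mulrDl; apply: lerD.
    apply: le_trans (lip _ _ _ _) _.
    by rewrite ![_ + X1 w]addrC ![_ + X2 w]addrC !addrK ler_wpM2l// lerDr.
  by rewrite ler_peMr// lerDl addr_ge0// -lee_fin.
have m12 : measurable_fun setT (fun w => (hdot (X1 w) (X1 w))%:E + (hdot (X2 w) (X2 w))%:E)%E.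
  by apply: emeasurable_funD; exact: i2.
rewrite ge0_integralZl//; last 2 first.
- by apply: emeasurable_funD => //; exact: measurable_cst.
- by move=> w _; rewrite adde_ge0// ?lee01// adde_ge0.
rewrite ge0_integralD//; last by move=> w _; rewrite adde_ge0.
rewrite ge0_integralD//; try exact: i2.
rewrite integral_cst// mul1e; apply: lte_mul_pinfty => //.
apply: lte_add_pinfty; last exact: lte_add_pinfty.
by apply: le_lt_trans (probability_le1 P measurableT) (ltry _).
Unshelve. all: by end_near. Qed.

End lipschitz_random_variables.

Section mixed_estimates.
Variables (R : realType) (n : nat) (D : lipschitz_domain R n).
Notation E := 'rV[R]_n.+1.
Notation L2 := (L2 D).
Notation L2n := (L2n D).
Notation l2 := (@l2_dot R n D).
Notation l2n := (@l2n_dot R n D).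
Let hl2 : semi_inner l2 := @l2_dot_semi_inner R n D.
Let hl2n : semi_inner l2n := @l2n_dot_semi_inner R n D.

Lemma hdiv_dot_ge0 (p : L2n) : 0 <= hdiv_dot p p.
Proof. by rewrite addr_ge0 ?(ip_ge0 hl2n) ?(ip_ge0 hl2). Qed.

Lemma l2n_le_hdiv (p : L2n) : l2n p p <= hdiv_dot p p.
Proof. by rewrite lerDl (ip_ge0 hl2). Qed.

Lemma hdiv_null (q : L2n) (v : L2) : hdiv_dot q q + l2 v v <= 0 ->
  l2n q q = 0 /\ l2 v v = 0.
Proof.
have := l2n_le_hdiv q; have := ip_ge0 hl2n q; have := ip_ge0 hl2 v.
by move: (hdiv_dot q q) (l2n q q) (l2 v v) => x y z *; split; lra.
Qed.

Lemma hdiv_dot_congr (p q : L2n) : Hdiv p -> semi_eq l2n p q ->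
  hdiv_dot q q = hdiv_dot p p.
Proof.
move=> hp pq.
have w : semi_eq l2 (wdiv q) (wdiv p).
  by apply: wdiv_eq; apply: weak_div_eq pq (semi_eq_refl hl2 _) (wdivP hp).
rewrite /hdiv_dot (semi_eq_ipl hl2 _ w) (semi_eq_ipr hl2 _ w).
by rewrite (semi_eq_ipl hl2n _ pq) (semi_eq_ipr hl2n _ pq).
Qed.

(** [wdiv] is a chosen representative, so it is linear only on [Hdiv] and up to null elements. This
    inequality is the substitute for the triangle inequality that [L2_rv_lipschitz] asks for. *)
Lemma hdiv_dot_split (p q : L2n) : Hdiv p -> Hdiv q ->
  hdiv_dot p p <= 2 * (hdiv_dot (p - q) (p - q) + hdiv_dot q q).
Proof.
move=> hp hq; rewrite /hdiv_dot.
have w : semi_eq l2 (wdiv (p - q)) (wdiv p - wdiv q).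
  have := wdiv_linear (-1) hq hp.
  by rewrite !scaleN1r ![- _ + _]addrC.
rewrite (semi_eq_ipl hl2 _ w) (semi_eq_ipr hl2 _ w).
have := ip_sumsqr hl2n (p - q) q; have := ip_sumsqr hl2 (wdiv p - wdiv q) (wdiv q).
rewrite !subrK.
move: (l2n p p) (l2n (p - q) (p - q)) (l2n q q) (l2 (wdiv p) _) (l2 (wdiv q) _).
by move=> x1 x2 x3 x4 x5; lra.
Qed.

Variables (A : E -> 'M[R]_n.+1) (hA : coercive_coefficients D A).
Variables (c : E -> R) (mc : measurable_fun D c).
Variables (c1 : R) (hc : forall x, dom D x -> 0 <= c x <= c1).

(** The bound of [mixed_exists] concerns one solution; uniqueness transfers it to all of them. *)
Lemma mixed_bounded : exists2 K, 0 <= K & forall r1 r2 p v, mixed A c r1 r2 p v ->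
  hdiv_dot p p + l2 v v <= K * (l2n r1 r1 + l2 r2 r2).
Proof.
have [K K0 HK] := mixed_exists hA mc hc; exists K => // r1 r2 p v m.
have [p' [v' [m' le]]] := HK r1 r2; have [e1 e2 _] := mixed_unique hA mc hc m' m.
rewrite (hdiv_dot_congr _ e1); last by case: m'.
by rewrite -(semi_eq_ipl hl2 _ e2) -(semi_eq_ipr hl2 _ e2).
Qed.

Lemma mixed_sub (r1 r1' p p' : L2n) (r2 r2' v v' : L2) : mixed A c r1 r2 p v ->
  mixed A c r1' r2' p' v' ->
  mixed A c (r1 - r1') (r2 - r2') (p - p') (v - v').
Proof.
move=> m m'; have := mixed_linear hA mc hc (-1) m' m.
by rewrite !scaleN1r ![- _ + _]addrC.
Qed.

End mixed_estimates.

Lemma le_of_sqr_le (R : realType) (x b : R) : 0 <= b -> 0 <= x -> x ^+ 2 <= b * x -> x <= b.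
Proof.
move=> b0; rewrite le_eqVlt => /predU1P[<-//|x0].
by rewrite expr2 ler_pM2r.
Qed.

Section transposed_operators.
Variables (R : realType) (V : lmodType R) (ip : V -> V -> R) (H : hilbert R).
Variables (C : V -> H) (Ct : (H -> R) -> V).
Hypotheses (hip : semi_inner ip) (hC : bounded_linear ip hdot C) (hCt : transpose ip C Ct).

Lemma transpose_riesz z v : ip v (Ct (riesz z)) = hdot (C v) z.
Proof. by rewrite hCt//; exact: riesz_dual. Qed.

(** For a difference [e] of two values, transposition turns [ip e e] into [hdot (C e) (z - z')].
    Boundedness of [C] then gives the bound, and linearity of [Ct] is never invoked. *)
Lemma transpose_lipschitz : exists2 K, 0 <= K & forall z z',
  ip (Ct (riesz z) - Ct (riesz z')) (Ct (riesz z) - Ct (riesz z')) <=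
    K * hdot (z - z') (z - z').
Proof.
have hH := @hdot_semi_inner R H; have [_ [K HK]] := hC.
exists `|K| => // z z'; set e := _ - Ct _; apply: le_of_sqr_le; rewrite ?mulr_ge0 ?(ip_ge0 hH) ?(ip_ge0 hip)//.
have eE : ip e e = hdot (C e) (z - z').
  by rewrite {2}/e (ipBr hip) !transpose_riesz (ipBr hH).
have := ip_CS hH (C e) (z - z'); rewrite -eE => le.
apply: le_trans le _; rewrite [leRHS]mulrAC ler_wpM2r ?(ip_ge0 hH)//.
by apply: le_trans (HK e) _; rewrite ler_wpM2r ?(ip_ge0 hip)// ler_norm.
Qed.

Lemma residual_lipschitz (Q Qi : H -> H) : positive_selfadjoint hdot Q Qi ->
  exists2 K, 0 <= K & forall y y' x x',
  let r := Ct (riesz (Q (y - C x))) - Ct (riesz (Q (y' - C x'))) in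
  (ip r r <= K * (hdot (y - y') (y - y') + ip (x - x') (x - x'))) : Prop.
Proof.
move=> hQ; have hH := @hdot_semi_inner R H; have [Kt Kt0 HKt] := transpose_lipschitz.
have [q q0 Hq] := op_bounded hH hQ; have [_ [K HK]] := hC; have [bQ _ _ _ _] := hQ.
exists (Kt * (q * (2 * (1 + `|K|)))); first by rewrite !mulr_ge0// addr_ge0.
move=> y y' x x' /=; apply: le_trans (HKt _ _) _; rewrite -mulrA ler_wpM2l//.
have -> : Q (y - C x) - Q (y' - C x') = Q ((y - y') - C (x - x')).
  have -> : y - y' - C (x - x') = -1 *: (y' - C x') + (y - C x).
    have -> : x - x' = -1 *: x' + x by rewrite scaleN1r addrC.
    rewrite (bounded_linearP _ _ _ hC) !scaleN1r opprD opprK opprB [RHS]addrC.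
    by rewrite [C x' - C x]addrC addrACA [- y' + _]addrC.
  by rewrite (bounded_linearP _ _ _ bQ) scaleN1r addrC.
apply: le_trans (Hq _) _; rewrite -mulrA ler_wpM2l//.
apply: le_trans (ip_diffsqr hH _ _) _; rewrite -mulrA ler_wpM2l//.
have e0 := ip_ge0 hip (x - x'); have d0 := ip_ge0 hH (y - y').
have le : hdot (C (x - x')) (C (x - x')) <= `|K| * ip (x - x') (x - x').
  by apply: le_trans (HK _) _; rewrite ler_wpM2r// ler_norm.
have d1 : 0 <= `|K| * hdot (y - y') (y - y') by rewrite mulr_ge0.
move: le e0 d0 d1; rewrite mulrDl mul1r mulrDr.
move: (hdot (C (x - x')) (C (x - x'))) (ip (x - x') (x - x')) (hdot (y - y') (y - y')) => a b e; move: (`|K| * b) (`|K| * e).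
by move=> x1 x2 *; lra.
Qed.

End transposed_operators.

Lemma sqrD_le (R : realType) (x y : R) : (x + y) ^+ 2 <= 2 * (x ^+ 2 + y ^+ 2).
Proof. by rewrite -subr_ge0; have := sqr_ge0 (x - y); congr (_ <= _); ring. Qed.

Section estimation_problem.
Variables (R : realType) (n : nat) (D : lipschitz_domain R n).
Notation E := 'rV[R]_n.+1.
Notation L2 := (L2 D).
Notation L2n := (L2n D).
Notation l2 := (@l2_dot R n D).
Notation l2n := (@l2n_dot R n D).
Let hl2 : semi_inner l2 := @l2_dot_semi_inner R n D.
Let hl2n : semi_inner l2n := @l2n_dot_semi_inner R n D.
Variables (A : E -> 'M[R]_n.+1) (hA : coercive_coefficients D A).
Variables (c : E -> R) (mc : measurable_fun D c).
Variables (c1 : R) (hc : forall x, dom D x -> 0 <= c x <= c1).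
Variables (Q Qi : L2 -> L2) (hQ : positive_selfadjoint l2 Q Qi) (f0 : L2).
Variables (H1 H2 : hilbert R).
Variables (Q1 Q1i : H1 -> H1) (hQ1 : positive_selfadjoint hdot Q1 Q1i).
Variables (Q2 Q2i : H2 -> H2) (hQ2 : positive_selfadjoint hdot Q2 Q2i).
Variables (C1 : L2n -> H1) (hC1 : bounded_linear l2n hdot C1).
Variables (C2 : L2 -> H2) (hC2 : bounded_linear l2 hdot C2).
Variables (C1t : (H1 -> R) -> L2n) (hC1t : transpose l2n C1 C1t).
Variables (C2t : (H2 -> R) -> L2) (hC2t : transpose l2 C2 C2t).
Variables (S : L2 -> L2n * L2) (KS : R).
Hypothesis KS0 : 0 <= KS.
Hypothesis SP : forall h, mixed A c 0 (- h) (S h).1 (S h).2.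
Hypothesis SK : forall h, hdiv_dot (S h).1 (S h).1 + l2 (S h).2 (S h).2 <= KS * l2 h h.

Notation d1 := (obs1 C1 S).
Notation d2 := (obs2 C2 S).
Notation AT := (fun x => (A x)^T).
Notation system := (estimation_system A c Qi f0 Q1 Q2 C1 C2 C1t C2t).
Notation G := (obs_form l2 Q Q1 Q2 d1 d2).

Let hH1 := @hdot_semi_inner R H1.
Let hH2 := @hdot_semi_inner R H2.
Let hF := op_form_semi_inner hl2 hQ.
Let hF1 := op_form_semi_inner hH1 hQ1.
Let hF2 := op_form_semi_inner hH2 hQ2.
Let hG : semi_inner G := obs_form_semi_inner hl2 hQ hQ1 hQ2
  (obs1_linear hA mc hc hC1 SP) (obs2_linear hA mc hc hC2 SP).

Let r1 (y1 : H1) (j : L2n) := C1t (riesz (Q1 (y1 - C1 j))).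
Let r2 (y2 : H2) (phi : L2) := C2t (riesz (Q2 (y2 - C2 phi))).

Lemma state_observed f j phi : mixed A c 0 (- f) j phi -> C1 j = d1 f /\ C2 phi = d2 f.
Proof.
move=> m; have [e1 e2 _] := mixed_unique hA mc hc m (SP f).
by rewrite /obs1 /obs2 (bounded_linear_congr hl2n hC1 e1) (bounded_linear_congr hl2 hC2 e2).
Qed.

Lemma obs1D f h : d1 (f + h) = d1 f + d1 h.
Proof. by have := obs1_linear hA mc hc hC1 SP 1 f h; rewrite !scale1r. Qed.

Lemma obs2D f h : d2 (f + h) = d2 f + d2 h.
Proof. by have := obs2_linear hA mc hc hC2 SP 1 f h; rewrite !scale1r. Qed.

(** [mixed_duality] between the state with source [k] and the adjoint solution; the transposes turn
    the right-hand side into observations of [S k], and the residuals are split along f0 + h. *)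
Lemma adjoint_observed y1 y2 j phi p1 p2 h :
  mixed A c 0 (- (f0 + h)) j phi ->
  mixed AT c (r1 y1 j) (r2 y2 phi) p1 p2 -> forall k,
  - l2 p2 k = op_form hdot Q1 (y1 - d1 f0) (d1 k) - op_form hdot Q1 (d1 h) (d1 k) +
    (op_form hdot Q2 (y2 - d2 f0) (d2 k) - op_form hdot Q2 (d2 h) (d2 k)).
Proof.
move=> m mT k; have [e1 e2] := state_observed m.
have := mixed_duality (SP k) mT.
rewrite (ipC hl2 k p2) (ipC hl2n (r1 _ _)) (ipC hl2 (r2 _ _)) => <-.
rewrite (transpose_riesz hC1t) (transpose_riesz hC2t).
rewrite (ipC hH1 (C1 _)) (ipC hH2 (C2 _)) e1 e2 -(ipBl hF1) -(ipBl hF2).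
by rewrite obs1D obs2D !opprD !addrA.
Qed.

Lemma system_source y1 y2 p1 p2 j phi : system y1 y2 p1 p2 j phi ->
  [/\ mixed A c 0 (- (f0 - Qi p2)) j phi,
      mixed AT c (r1 y1 j) (r2 y2 phi) p1 p2 &
      forall k, G (- Qi p2) k =
        op_form hdot Q1 (y1 - d1 f0) (d1 k) + op_form hdot Q2 (y2 - d2 f0) (d2 k)].
Proof.
move=> [[hp hj] s1 s2 s3 s4].
have m : mixed A c 0 (- (f0 - Qi p2)) j phi.
  split=> // [q hq|w]; first by rewrite s3// (ip0l hl2n).
  by rewrite s4 opprB (ipC hl2).
have mT : mixed AT c (r1 y1 j) (r2 y2 phi) p1 p2.
  by split=> // q hq; rewrite -form_a_adjE s1.
split=> // k; have := adjoint_observed m mT k.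
rewrite /obs_form (ipNl hF).
have -> : op_form l2 Q (Qi p2) k = l2 p2 k := op_invr hl2 hQ p2 k.
move: (l2 p2 k) (op_form hdot Q1 _ _) (op_form hdot Q1 _ _) (op_form hdot Q2 _ _)
  (op_form hdot Q2 _ _) => x1 x2 x3 x4 x5; lra.
Qed.

(** The converse of [system_source]. Comparing the equation for [h] with [adjoint_observed] leaves Q
    h = - p2 in the weak sense, so [h] may be replaced by -Q^-1 p2 in the state equation, which
    closes the system. *)
Lemma source_system y1 y2 p1 p2 j phi h : mixed A c 0 (- (f0 + h)) j phi ->
  mixed AT c (r1 y1 j) (r2 y2 phi) p1 p2 ->
  (forall k, G h k =
    op_form hdot Q1 (y1 - d1 f0) (d1 k) + op_form hdot Q2 (y2 - d2 f0) (d2 k)) ->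
  system y1 y2 p1 p2 j phi.
Proof.
move=> m mT hG'.
have p2E k : - l2 p2 k = op_form l2 Q h k.
  rewrite (adjoint_observed m mT); have := hG' k; rewrite /obs_form.
  move: (op_form l2 _ _ _) (op_form hdot Q1 _ _) (op_form hdot Q1 _ _) (op_form hdot Q2 _ _)
    (op_form hdot Q2 _ _) => x1 x2 x3 x4 x5; lra.
have [hj m1 m2] := m; have [hp m3 m4] := mT; split=> //.
- by move=> q hq; rewrite form_a_adjE m3.
- by move=> q hq; rewrite m1// (ip0l hl2n).
- move=> v; rewrite m2 (ipBr hl2) (ipC hl2 v (Qi p2)) (op_inv_sym hl2 hQ).
  have -> : l2 p2 (Qi v) = - op_form l2 Q h (Qi v) by rewrite -p2E opprK.
  have [_ Qs _ _ _] := hQ.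
  by rewrite /op_form Qs (ipC hl2 h) (op_invr hl2 hQ) (ipNl hl2) (ipDl hl2) !(ipC hl2 v) opprD addrC.
Qed.

Lemma data_bounded : exists2 K, 0 <= K & forall (z1 : H1) (z2 : H2) k,
  (op_form hdot Q1 z1 (d1 k) + op_form hdot Q2 z2 (d2 k)) ^+ 2 <=
  K * (hdot z1 z1 + hdot z2 z2) * l2 k k.
Proof.
have [K1 K10 HK1] := op_bounded hH1 hQ1; have [K2 K20 HK2] := op_bounded hH2 hQ2.
have [KD KD0 HD] := obs_bounded hC1 hC2 KS0 SK.
exists (2 * (K1 + K2) * KD); first by rewrite mulr_ge0// mulr_ge0// addr_ge0.
move=> z1 z2 k; have [D1k D2k] := HD k.
have b1 : op_form hdot Q1 z1 (d1 k) ^+ 2 <= (K1 * hdot z1 z1) * (KD * l2 k k).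
  by apply: le_trans (ip_CS hH1 _ _) _; rewrite ler_pM ?(ip_ge0 hH1).
have b2 : op_form hdot Q2 z2 (d2 k) ^+ 2 <= (K2 * hdot z2 z2) * (KD * l2 k k).
  by apply: le_trans (ip_CS hH2 _ _) _; rewrite ler_pM ?(ip_ge0 hH2).
have t0 : 0 <= KD * l2 k k by rewrite mulr_ge0// (ip_ge0 hl2).
have m1 : 0 <= K1 * hdot z2 z2 * (KD * l2 k k).
  by rewrite !mulr_ge0// ?(ip_ge0 hH2) ?(ip_ge0 hl2).
have m2 : 0 <= K2 * hdot z1 z1 * (KD * l2 k k).
  by rewrite !mulr_ge0// ?(ip_ge0 hH1) ?(ip_ge0 hl2).
have -> : 2 * (K1 + K2) * KD * (hdot z1 z1 + hdot z2 z2) * l2 k k =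
  2 * (K1 * hdot z1 z1 * (KD * l2 k k) + K1 * hdot z2 z2 * (KD * l2 k k) +
   (K2 * hdot z1 z1 * (KD * l2 k k) + K2 * hdot z2 z2 * (KD * l2 k k))) by ring.
apply: le_trans (sqrD_le _ _) _; rewrite ler_wpM2l//.
move: (lerD b1 b2) m1 m2; move: (op_form hdot Q1 _ _) (op_form hdot Q2 _ _).
move: (K1 * hdot z1 z1 * _) (K2 * hdot z2 z2 * _) (K1 * hdot z2 z2 * _) (K2 * hdot z1 z1 * _).
move=> a b e f x y; move: (x ^+ 2) (y ^+ 2) => x2 y2; lra.
Qed.

Lemma system_exists y1 y2 : exists p1 p2 j phi, system y1 y2 p1 p2 j phi.
Proof.
have [KD KD0 HD] := obs_bounded hC1 hC2 KS0 SK.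
have [a a0 [_ ha]] := obs_form_riesz hl2 (@l2_complete R n D) hQ hQ1 hQ2
  (obs1_linear hA mc hc hC1 SP) (obs2_linear hA mc hc hC2 SP)
  (fun h => (HD h).1) (fun h => (HD h).2).
have [K K0 HK] := data_bounded.
pose F k := op_form hdot Q1 (y1 - d1 f0) (d1 k) + op_form hdot Q2 (y2 - d2 f0) (d2 k).
have Fl t x y : F (t *: x + y) = t * F x + F y.
  rewrite /F (obs1_linear hA mc hc hC1 SP) (obs2_linear hA mc hc hC2 SP).
  rewrite (ipDr hF1) (ipDr hF2) (ipZr hF1) (ipZr hF2); ring.
have [|h [hE _]] := ha F _ Fl _ (HK (y1 - d1 f0) (y2 - d2 f0)).
  by rewrite mulr_ge0// addr_ge0 ?(ip_ge0 hH1) ?(ip_ge0 hH2).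
have [KT _ HT] := mixed_exists (coercive_trmx hA) mc hc.
pose j := (S (f0 + h)).1; pose phi := (S (f0 + h)).2.
have [p1 [p2 [mT _]]] := HT (r1 y1 j) (r2 y2 phi).
by exists p1, p2, j, phi; exact: source_system (SP _) mT hE.
Qed.

Lemma system_estimate (l1 : L2n) (lf kh : L2) y1 y2 p1 p2 j phi :
  (forall h, G kh h = target l1 lf S h) -> system y1 y2 p1 p2 j phi ->
  hdot y1 (Q1 (d1 kh)) + hdot y2 (Q2 (d2 kh)) +
    gap C1 C2 l1 lf S (Q1 (d1 kh)) (Q2 (d2 kh)) f0 = functional l1 lf j phi.
Proof.
move=> khE /system_source[m _ hE].
have [e1 e2 _] := mixed_unique hA mc hc m (SP _).
have -> : functional l1 lf j phi = target l1 lf S (f0 - Qi p2).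
  by rewrite /target /functional (semi_eq_ipr hl2n _ e1) (semi_eq_ipr hl2 _ e2).
have -> : target l1 lf S (f0 - Qi p2) = target l1 lf S f0 + target l1 lf S (- Qi p2).
  by have := target_linear hA mc hc l1 lf SP 1 f0 (- Qi p2); rewrite scale1r mul1r.
have [_ Q1s _ _ _] := hQ1; have [_ Q2s _ _ _] := hQ2.
rewrite -(khE (- Qi p2)) (ipC hG) hE /gap /op_form Q1s Q2s (ipBl hH1) (ipBl hH2); ring.
Qed.

(** The source correction solves a linear equation in the coercive form G whose data depend linearly
    on the observations, so testing the difference of two such equations with itself gives the
    bound. *)
Lemma source_lipschitz : exists2 K, 0 <= K & forall y1 y2 p1 p2 j phi y1' y2' p1' p2' j' phi',
  system y1 y2 p1 p2 j phi -> system y1' y2' p1' p2' j' phi' ->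
  l2 (Qi p2 - Qi p2') (Qi p2 - Qi p2') <=
  K * (hdot (y1 - y1') (y1 - y1') + hdot (y2 - y2') (y2 - y2')).
Proof.
have [K K0 HK] := data_bounded; have [a a0 ha] := op_form_coercive hl2 hQ.
exists (K / a ^+ 2); first by rewrite divr_ge0// sqr_ge0.
move=> y1 y2 p1 p2 j phi y1' y2' p1' p2' j' phi' /system_source[_ _ e] /system_source[_ _ e'].
set Y := hdot _ _ + _; set h := Qi p2 - Qi p2'.
have Y0 : 0 <= Y by rewrite addr_ge0 ?(ip_ge0 hH1) ?(ip_ge0 hH2).
have hh0 := ip_ge0 hl2 h.
have GE : G h h = - (op_form hdot Q1 (y1 - y1') (d1 h) + op_form hdot Q2 (y2 - y2') (d2 h)).
  have -> : G h h = G (- Qi p2') h - G (- Qi p2) h.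
    by rewrite -(ipBl hG) opprK addrC.
  rewrite e e' !(ipBl hF1) !(ipBl hF2); ring.
have le : a * l2 h h <= G h h.
  apply: le_trans (ha h) _; rewrite /obs_form -addrA lerDl addr_ge0//.
    exact: (ip_ge0 hF1).
  exact: (ip_ge0 hF2).
apply: le_of_sqr_le => //; first by rewrite mulr_ge0// divr_ge0// sqr_ge0.
rewrite mulrAC -mulrA mulrAC ler_pdivlMr ?exprn_gt0//.
apply: (@le_trans _ _ (G h h ^+ 2)).
  rewrite -exprMn mulrC ler_pXn2r ?nnegrE ?mulr_ge0 ?(ltW a0)//; exact: (ip_ge0 hG).
by rewrite GE sqrrN; apply: le_trans (HK _ _ _) _; rewrite -/Y mulrAC mulrA.
Qed.

(** The estimates are chained: observations control the source, the source controls the state, and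
    observations with the state control the residuals and thus the adjoint solution. With equal
    observations on both sides this is uniqueness. *)
Lemma system_lipschitz : exists2 L, 0 <= L &
  forall y1 y2 p1 p2 j phi y1' y2' p1' p2' j' phi',
  system y1 y2 p1 p2 j phi -> system y1' y2' p1' p2' j' phi' ->
  let Y := hdot (y1 - y1') (y1 - y1') + hdot (y2 - y2') (y2 - y2') in
  hdiv_dot (j - j') (j - j') + l2 (phi - phi') (phi - phi') <= L * Y /\
  hdiv_dot (p1 - p1') (p1 - p1') + l2 (p2 - p2') (p2 - p2') <= L * Y.
Proof.
have [KA KA0 HA] := mixed_bounded hA mc hc.
have [KT KT0 HT] := mixed_bounded (coercive_trmx hA) mc hc.
have [Ks Ks0 Hs] := source_lipschitz.
have [K1 K10 HK1] := residual_lipschitz hl2n hC1 hC1t hQ1.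
have [K2 K20 HK2] := residual_lipschitz hl2 hC2 hC2t hQ2.
pose L1 := KA * Ks; have L10 : 0 <= L1 by exact: mulr_ge0.
pose L2' := KT * ((K1 + K2) * (1 + L1)).
have L20 : 0 <= L2' by rewrite !mulr_ge0// addr_ge0.
exists (L1 + L2'); first exact: addr_ge0.
move=> y1 y2 p1 p2 j phi y1' y2' p1' p2' j' phi' s s' Y.
have leS := Hs _ _ _ _ _ _ _ _ _ _ _ _ s s'.
have [m mT _] := system_source s; have [m' mT' _] := system_source s'.
have Y1 : hdot (y1 - y1') (y1 - y1') <= Y by rewrite lerDl (ip_ge0 hH2).
have Y2 : hdot (y2 - y2') (y2 - y2') <= Y by rewrite lerDr (ip_ge0 hH1).
have Y0 : 0 <= Y := le_trans (ip_ge0 hH1 _) Y1.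
have le1 : hdiv_dot (j - j') (j - j') + l2 (phi - phi') (phi - phi') <= L1 * Y.
  have := HA _ _ _ _ (mixed_sub hA mc hc m m').
  rewrite subrr (ip0l hl2n) add0r opprB opprK addrA subrK -/Y => le.
  by apply: le_trans le _; rewrite -mulrA ler_wpM2l.
have le2 : hdiv_dot (p1 - p1') (p1 - p1') + l2 (p2 - p2') (p2 - p2') <= L2' * Y.
  apply: le_trans (HT _ _ _ _ (mixed_sub (coercive_trmx hA) mc hc mT mT')) _.
  rewrite -mulrA ler_wpM2l// -mulrA mulrDl; apply: lerD.
  - apply: le_trans (HK1 _ _ _ _) _; rewrite ler_wpM2l// mulrDl mul1r lerD//.
    apply: le_trans (l2n_le_hdiv _) _; apply: le_trans le1.
    by rewrite lerDl (ip_ge0 hl2).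
  - apply: le_trans (HK2 _ _ _ _) _; rewrite ler_wpM2l// mulrDl mul1r lerD//.
    by apply: le_trans le1; rewrite lerDr hdiv_dot_ge0.
by split; [apply: le_trans le1 _|apply: le_trans le2 _]; rewrite ler_wpM2r// ?lerDl ?lerDr.
Qed.

End estimation_problem.

Theorem theorem2 (R : realType) (n : nat) (D : lipschitz_domain R n)
    (A : 'rV[R]_n.+1 -> 'M[R]_n.+1) (hA : coercive_coefficients D A)
    (c : 'rV[R]_n.+1 -> R) (hc : piecewise_continuous D c)
    (c0 c1 : R) (hc0 : 0 <= c0) (hc01 : forall x, dom D x -> c0 <= c x <= c1)
    (d : measure_display) (Omega : measurableType d) (P : probability Omega R)
    (hP : exists xi1 xi2 : {RV P >-> R},
      [/\ ('E_P[xi1] = 0 /\ 'E_P[xi2] = 0)%E,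
          ('V_P[xi1] = 1 /\ 'V_P[xi2] = 1)%E &
          covariance P xi1 xi2 = 0%E])
    (Q Qi : L2 D -> L2 D) (hQ : positive_selfadjoint (@l2_dot R n D) Q Qi)
    (f0 : L2 D)
    (H1 H2 : hilbert R) (hH1 : separable H1) (hH2 : separable H2)
    (Q1 Q1i : H1 -> H1) (hQ1 : positive_selfadjoint hdot Q1 Q1i)
    (Q2 Q2i : H2 -> H2) (hQ2 : positive_selfadjoint hdot Q2 Q2i)
    (C1 : L2n D -> H1) (hC1 : bounded_linear (@l2n_dot R n D) hdot C1)
    (C2 : L2 D -> H2) (hC2 : bounded_linear (@l2_dot R n D) hdot C2)
    (C1t : (H1 -> R) -> L2n D) (hC1t : transpose (@l2n_dot R n D) C1 C1t)
    (C2t : (H2 -> R) -> L2 D) (hC2t : transpose (@l2_dot R n D) C2 C2t)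
    (l1 : L2n D) (l2 : L2 D)
    (f : L2 D) (hf : source_set Q f0 f)
    (j : L2n D) (phi : L2 D) (hstate : state A c f j phi)
    (eta1 : Omega -> H1) (eta2 : Omega -> H2)
    (heta : noise_set P Q1 Q2 (eta1, eta2)) :
  let y1 := fun w => C1 j + eta1 w in
  let y2 := fun w => C2 phi + eta2 w in
  let system := fun w p1 p2 jh phih =>
    estimation_system A c Qi f0 Q1 Q2 C1 C2 C1t C2t
      (y1 w) (y2 w) p1 p2 jh phih in
  exists (u1 : H1) (u2 : H2) (k : R),
    [/\ optimal P A c Q f0 Q1 Q2 C1 C2 l1 l2 u1 u2 k,
        forall v1 v2 k', optimal P A c Q f0 Q1 Q2 C1 C2 l1 l2 v1 v2 k' ->
          [/\ v1 = u1, v2 = u2 & k' = k] &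
        exists (p1 : Omega -> L2n D) (p2 : Omega -> L2 D)
               (jh : Omega -> L2n D) (phih : Omega -> L2 D),
          [/\ {ae P, forall w, system w (p1 w) (p2 w) (jh w) (phih w)},
              forall (p1' : Omega -> L2n D) (p2' : Omega -> L2 D)
                     (jh' : Omega -> L2n D) (phih' : Omega -> L2 D),
                {ae P, forall w, system w (p1' w) (p2' w) (jh' w) (phih' w)} ->
                {ae P, forall w,
                  [/\ semi_eq (@l2n_dot R n D) (p1' w) (p1 w),
                      semi_eq (@l2_dot R n D) (p2' w) (p2 w),
                      semi_eq (@l2n_dot R n D) (jh' w) (jh w) &
                      semi_eq (@l2_dot R n D) (phih' w) (phih w)]},
              L2_rv P (@Hdiv R n D) (@hdiv_dot R n D) p1 /\
              L2_rv P (@Hdiv R n D) (@hdiv_dot R n D) jh,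
              L2_rv P setT (@l2_dot R n D) p2 /\
              L2_rv P setT (@l2_dot R n D) phih &
              {ae P, forall w,
                hdot (y1 w) u1 + hdot (y2 w) u2 + k =
                functional l1 l2 (jh w) (phih w)}]].
Proof.
move=> y1 y2 system.
have mc := hc.1.
have hcb x : dom D x -> 0 <= c x <= c1.
  by move=> /hc01/andP[h1 h2]; rewrite h2 (le_trans hc0 h1).
have hl2 := @l2_dot_semi_inner R n D; have hl2n := @l2n_dot_semi_inner R n D.
have [KS KS0 HS] := mixed_exists hA mc hcb.
have /choice[S SP'] : forall h : L2 D, exists q : (L2n D * L2 D)%type,
    mixed A c 0 (- h) q.1 q.2 /\ hdiv_dot q.1 q.1 + l2_dot q.2 q.2 <= KS * l2_dot h h.
  move=> h; have [q [v [m le]]] := HS 0 (- h); exists (q, v); split=> //.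
  by move: le; rewrite (ip0l hl2n) add0r (ipNl hl2) (ipNr hl2) opprK.
have SP h := (SP' h).1; have SK h := (SP' h).2.
have [kh [khE opt uniq]] :=
  optimum hA mc hcb hP hQ f0 hQ1 hQ2 hC1 hC2 l1 l2 KS0 SP SK.
exists (Q1 (obs1 C1 S kh)), (Q2 (obs2 C2 S kh)), (gap C1 C2 l1 l2 S (Q1 (obs1 C1 S kh)) (Q2 (obs2 C2 S kh)) f0).
split=> //.
(* A solution is chosen for each pair of observations and not for each elementary event, so that the
   random fields are functions of the observations and inherit measurability through the Lipschitz
   bound. *)
have /choice[sol solP] : forall y : (H1 * H2)%type, exists s : ((L2n D * L2 D) * (L2n D * L2 D))%type,
    estimation_system A c Qi f0 Q1 Q2 C1 C2 C1t C2t y.1 y.2 s.1.1 s.1.2 s.2.1 s.2.2.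
  move=> [z1 z2].
  have [p1 [p2 [jh [phih s]]]] :=
    system_exists hA mc hcb hQ f0 hQ1 hQ2 hC1 hC2 hC1t hC2t KS0 SP SK z1 z2.
  by exists ((p1, p2), (jh, phih)).
have [L L0 lip] := system_lipschitz hA mc hcb hQ f0 hQ1 hQ2 hC1 hC2 hC1t hC2t KS0 SP SK.
exists (fun w => (sol (y1 w, y2 w)).1.1), (fun w => (sol (y1 w, y2 w)).1.2),
  (fun w => (sol (y1 w, y2 w)).2.1), (fun w => (sol (y1 w, y2 w)).2.2).
have [[/= r1 r2] _ _ _ _] := heta.
have lips z1 z2 z1' z2' := lip _ _ _ _ _ _ _ _ _ _ _ _ (solP (z1, z2)) (solP (z1', z2')).
have d0 := @hdiv_dot_ge0 R n D; have l0 := ip_ge0 hl2.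
have split2 (u v : L2 D) : l2_dot u u <= 2 * (l2_dot (u - v) (u - v) + l2_dot v v).
  by have := ip_sumsqr hl2 (u - v) v; rewrite subrK.
split.
- by apply: aeW => w; exact: solP.
- move=> p1' p2' jh' phih'; apply: filterS => w s'.
  (* Both solutions belong to the same observations, so the right-hand side of the Lipschitz
     estimate is zero. *)
  have := lip _ _ _ _ _ _ _ _ _ _ _ _ s' (solP (y1 w, y2 w)).
  rewrite /= !subrr (ip0l (@hdot_semi_inner R H1)) (ip0l (@hdot_semi_inner R H2)) addr0 mulr0.
  move=> [le1 le2].
  have [e1 e2] := hdiv_null le1; have [e3 e4] := hdiv_null le2.
  by split; [exact: e3|exact: e4|exact: e1|exact: e2].
- split.
  + apply: (@L2_rv_lipschitz _ _ _ P _ _ _ _ r1 r2 _ _ _ (fun z1 z2 => (sol (z1, z2)).1.1) _ _ L) => //.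
    * exact: hdiv_dot_split.
    * by move=> z1 z2; have [[]] := solP (z1, z2).
    * by move=> z1 z2 z1' z2'; apply: le_trans (lips z1 z2 z1' z2').2; rewrite lerDl.
  + apply: (@L2_rv_lipschitz _ _ _ P _ _ _ _ r1 r2 _ _ _ (fun z1 z2 => (sol (z1, z2)).2.1) _ _ L) => //.
    * exact: hdiv_dot_split.
    * by move=> z1 z2; have [[]] := solP (z1, z2).
    * by move=> z1 z2 z1' z2'; apply: le_trans (lips z1 z2 z1' z2').1; rewrite lerDl.
- split.
  + apply: (@L2_rv_lipschitz _ _ _ P _ _ _ _ r1 r2 _ _ _ (fun z1 z2 => (sol (z1, z2)).1.2) _ _ L) => //.
    by move=> z1 z2 z1' z2'; apply: le_trans (lips z1 z2 z1' z2').2; rewrite lerDr.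
  + apply: (@L2_rv_lipschitz _ _ _ P _ _ _ _ r1 r2 _ _ _ (fun z1 z2 => (sol (z1, z2)).2.2) _ _ L) => //.
    by move=> z1 z2 z1' z2'; apply: le_trans (lips z1 z2 z1' z2').1; rewrite lerDr.
- apply: aeW => w.
  by apply: (system_estimate hA mc hcb hQ hQ1 hQ2 hC1 hC2 hC1t hC2t SP khE); exact: solP (y1 w, y2 w).
Qed.
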